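(* In the regression model $Y_i=f(i/n)+\varepsilon_i$, $1\le i\le n$, suppose $f$ is bounded, let $g:[0,1]\to\mathbb{R}$ be a function in $L^2([0,1])$, $G=\left(g(i/n)/n\right)_{1\le i\le n}^T$ (a $1\times n$ row vector), and $\mathcal{F}(f)=\int_0^1fg$. Let $W$ be the prior on $F=\Phi\theta$ induced by the $\mathcal{N}(0,\gamma_nI_{k_n})$ distribution on $\theta$, for a sequence $(\gamma_n)_{n\ge1}$ of positive numbers such that $1/\sqrt n=o(\gamma_n)$. Then: (1) $$E\left\|W(d(GF)\mid Y)-\mathcal{N}\left(GY_{\langle\phi\rangle},\sigma^2G\Sigma G^T\right)\right\|_{\mathrm{TV}}\longrightarrow0,$$ and the distribution of $GY_{\langle\phi\rangle}$ is $\mathcal{N}(GF_{\langle\phi\rangle},\sigma^2G\Sigma G^T)$. (2) Suppose further that $f$ and $g$ belong to some Sobolev class $\mathcal{W}(\alpha,L)$ for $L>0$ and $\alpha>1/2$, with $\int_0^1g^2>0$. Then $G\Sigma G^T\sim\frac1n\int_0^1g^2$, $$E\left\|W\left(d\,\frac{\sqrt n\left(GF-GY_{\langle\phi\rangle}\right)}{\sigma\sqrt{\int_0^1g^2}}\ \Big|\ Y\right)-\mathcal{N}(0,1)\right\|_{\mathrm{TV}}\longrightarrow0$$ and $\dfrac{\sqrt n\left(GY_{\langle\phi\rangle}-GF_{\langle\phi\rangle}\right)}{\sigma\sqrt{\int_0^1g^2}}\to\mathcal{N}(0,1)$ in distribution, as $n\to\infty$. (3) Suppose that $f$ and $g$ belong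 to some Sobolev class $\mathcal{W}(\alpha,L)$ for $L>0$ and $\alpha>1/2$, with $\int_0^1g^2>0$, and suppose further that $k_n$ is large enough so that $n=o(k_n^{2\alpha})$. Then the bias is negligible with respect to the square root of the variance: $$\frac{\sqrt n\left(GF_{\langle\phi\rangle}-\mathcal{F}(f)\right)}{\sigma\sqrt{\int_0^1g^2}}=o(1).$$
   Context: Model: for each $n\ge1$ one observes $Y=(Y_1,\dots,Y_n)$ with $Y_i=f(i/n)+\varepsilon_i$, where the $\varepsilon_i$ are i.i.d. $\mathcal{N}(0,\sigma^2)$, $\sigma>0$ known and not depending on $n$; $f,g:[0,1]\to\mathbb{R}$ are fixed functions; $F_0=(f(i/n))_{1\le i\le n}$, and $E$ and distributions of functions of $Y$ are under $Y\sim\mathcal{N}(F_0,\sigma^2I_n)$. Fourier basis: $\varphi_1\equiv1$, $\varphi_{2m}(x)=\sqrt2\cos(2\pi mx)$, $\varphi_{2m+1}(x)=\sqrt2\sin(2\pi mx)$ for $m\ge1$. Sobolev class: for $\alpha,L>0$, $\mathcal{W}(\alpha,L)$ is the set of $f=\sum_{j\ge1}\theta_j\varphi_j\in L^2([0,1])$ with $\sum_{j\ge1}a_j^2\theta_j^2\le L^2/\pi^{2\alpha}$, where $a_j=j^\alpha$ if $j$ is even and $a_j=(j-1)^\alpha$ if $j$ is odd; for $\alpha>1/2$ the series converges uniformly and the function denotes its (continuous) sum. Regressors: $\phi_j=(\varphi_j(i/n))_{1\le i\le n}\in\mathbb{R}^n$, $1\le j\le k_n$, and $\Phi$ is the $n\times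 k_n$ matrix with columns $\phi_j$. The integer $k_n\geq 1$ grows with $n$ ($k_n\to\infty$), with $k_n\le n$ if $n$ is odd and $k_n\le n-1$ if $n$ is even (then $\Phi$ has rank $k_n$). $\langle\phi\rangle$ is the range of $\Phi$, $\Sigma=\Phi(\Phi^T\Phi)^{-1}\Phi^T$, $Y_{\langle\phi\rangle}=\Sigma Y$, $F_{\langle\phi\rangle}=\Sigma F_0$. The posterior $W(\cdot\mid Y)$ is computed when $F\sim W$ and, conditionally on $F$, $Y\sim\mathcal{N}(F,\sigma^2I_n)$; $W(d(GF)\mid Y)$ is the posterior distribution of $GF$. $u_n\sim v_n$ means $u_n/v_n\to1$; $\|Q-Q'\|_{\mathrm{TV}}=\sup_A|Q(A)-Q'(A)|$; Gaussian distributions may be degenerate. *)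

(* Defs.v *)
From HB Require Import structures.
From mathcomp Require Import all_boot all_order all_algebra.
From mathcomp Require Import all_classical all_reals all_analysis.
From mathcomp Require Import measurable_realfun.

Set Implicit Arguments.
Unset Strict Implicit.
Unset Printing Implicit Defensive.

Import Order.TTheory GRing.Theory Num.Theory.
Import numFieldTopology.Exports numFieldNormedType.Exports.

Local Open Scope classical_set_scope.
Local Open Scope ring_scope.

Section fourier_sobolev.
Context {R : realType}.
Implicit Types (f g : R -> R) (x alpha L : R) (theta : R^nat).

(* A function on [0, 1] is a total function on R of which only the values on
   [0, 1] are used. *)

(* The basis is indexed by j >= 1; the value at j = 0 is never used. *)
Definition fourier (j : nat) (x : R) : R :=
  if j == 1%N then 1
  else if odd j then Num.sqrt 2 * sin (2 * pi * j./2%:R * x)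
  else Num.sqrt 2 * cos (2 * pi * j./2%:R * x).

Definition fourier_sum theta (N : nat) (x : R) : R :=
  \sum_(1 <= j < N.+1) theta j * fourier j x.

Definition sobolev_weight alpha (j : nat) : R :=
  (if odd j then j.-1 else j)%:R `^ alpha.

Definition L2_01 f : Prop :=
  measurable_fun (`[0, 1]%classic : set R) f /\
  (\int[lebesgue_measure]_(x in `[0%R, 1%R]) (f x ^+ 2)%:E < +oo)%E.

(* The first two conditions on theta define the class up to a.e. equality; the
   last one selects, for alpha > 1/2, the everywhere defined sum of the series
   (which then converges uniformly) as the representative of f on [0, 1]. *)
Definition sobolev alpha L f : Prop :=
  L2_01 f /\
  exists theta : R^nat,
    [/\ (\sum_(1 <= j <oo) ((sobolev_weight alpha j * theta j) ^+ 2)%:E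
           <= (L ^+ 2 / pi `^ (2 * alpha))%:E)%E,
        (\int[lebesgue_measure]_(x in `[0%R, 1%R])
           ((f x - fourier_sum theta N x) ^+ 2)%:E @[N --> \oo] --> 0)%E &
        2^-1 < alpha -> forall x, x \in `[0, 1] ->
          fourier_sum theta N x @[N --> \oo] --> f x].

Definition int01 f : R := (\int[lebesgue_measure]_(x in `[0%R, 1%R]) f x)%R.

End fourier_sobolev.

Section regression.
Context {R : realType}.
Implicit Types (f g : R -> R) (n k : nat).

(* Ordinals start at 0: i : 'I_n stands for the index i + 1. *)
Definition grid n (i : 'I_n) : R := i.+1%:R / n%:R.

Definition samples f n : 'cV[R]_n := \col_i f (grid i).

Definition weights g n : 'rV[R]_n := \row_i (g (grid i) / n%:R).

Definition design n k : 'M[R]_(n, k) := \matrix_(i, j) fourier j.+1 (grid i).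

Definition hat_mx n k : 'M[R]_n :=
  design n k *m invmx ((design n k)^T *m design n k) *m (design n k)^T.

Definition cvec n (t : n.-tuple R) : 'cV[R]_n := \col_i tnth t i.

Definition linear_functional g n (F : n.-tuple R) : R :=
  (weights g n *m cvec F) 0 0.

(* With G = weights g n and Sigma = hat_mx n k, this is G Sigma y: it gives
   GY_<phi> at y = Y and GF_<phi> at y = F_0. *)
Definition projected_functional g n k (y : 'cV[R]_n) : R :=
  (weights g n *m (hat_mx n k *m y)) 0 0.

Definition variance_factor g n k : R :=
  (weights g n *m hat_mx n k *m (weights g n)^T) 0 0.

Definition observation f n (e : 'I_n -> R) : 'cV[R]_n :=
  \col_i (f (grid i) + e i).

End regression.

Section probability_notions.
Context {R : realType}.

(* N(m, v), parametrized by its variance v >= 0.  The degenerate case is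
   separated because normal_prob m 0 is not a Dirac mass. *)
Definition gaussian (m v : R) : set R -> \bar R :=
  if v == 0 then \d_m else normal_prob m (Num.sqrt v).

Let gaussian0 m v : gaussian m v set0 = 0%E.
Proof. by rewrite /gaussian; case: ifP => _; exact: measure0. Qed.

Let gaussian_ge0 m v A : (0 <= gaussian m v A)%E.
Proof. by rewrite /gaussian; case: ifP => _; exact: measure_ge0. Qed.

Let gaussian_sigma_additive m v : semi_sigma_additive (gaussian m v).
Proof.
rewrite /gaussian; case: ifP => _; first exact: measure_semi_sigma_additive.
exact: (@measure_semi_sigma_additive _ _ _ (normal_prob m (Num.sqrt v))).
Qed.

HB.instance Definition _ m v := isMeasure.Build _ _ _ (gaussian m v)
  (gaussian0 m v) (@gaussian_ge0 m v) (@gaussian_sigma_additive m v).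

Let gaussian_setT m v : gaussian m v [set: R] = 1%E.
Proof.
rewrite /gaussian; case: ifP => _; first exact: probability_setT.
exact: (probability_setT (normal_prob m (Num.sqrt v))).
Qed.

HB.instance Definition _ m v :=
  Measure_isProbability.Build _ _ _ (gaussian m v) (gaussian_setT m v).

Definition tv_dist d (T : measurableType d) (Q Q' : set T -> \bar R) : \bar R :=
  ereal_sup [set (`|Q A - Q' A|)%E | A in measurable].

Definition mutually_independent d (T : measurableType d) (P : probability T R)
    n (X : 'I_n -> T -> R) : Prop :=
  forall (J : {set 'I_n}) (B : 'I_n -> set R), (forall i, measurable (B i)) ->
    P (\bigcap_(i in [set` J]) X i @^-1` B i)
      = (\prod_(i in J) P (X i @^-1` B i))%E.

Definition cvg_in_distribution (d : nat -> measure_display)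
    (T : forall n, measurableType (d n)) (P : forall n, probability (T n) R)
    (X : forall n, T n -> R) (Q : probability R R) : Prop :=
  forall h : R -> R, continuous h -> bounded_fun h ->
    (\int[P n]_w (h (X n w))%:E @[n --> \oo] --> \int[Q]_x (h x)%:E)%E.

End probability_notions.

Section posterior.
Context {R : realType}.

Definition tuple_cons n (p : R * n.-tuple R) : n.+1.-tuple R :=
  [tuple of p.1 :: p.2].

Lemma measurable_tuple_cons n : measurable_fun setT (@tuple_cons n).
Proof. exact: measurable_cons. Qed.

HB.instance Definition _ n :=
  isMeasurableFun.Build _ _ _ _ (@tuple_cons n) (@measurable_tuple_cons n).

(* N(0, v I_k), as the k-fold product of N(0, v). *)
Fixpoint iid_gaussian (v : R) (k : nat) : probability (k.-tuple R) R :=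
  match k with
  | 0 => dirac [tuple] : probability _ R
  | k'.+1 => distribution (gaussian 0 v \x iid_gaussian v k')%E (@tuple_cons k')
               : probability _ R
  end.

Definition design_tuple n k (theta : k.-tuple R) : n.-tuple R :=
  [tuple (design n k *m cvec theta) i 0 | i < n].

Lemma measurable_design_tuple n k :
  measurable_fun setT (@design_tuple n k).
Proof.
apply/measurable_fun_tnthP => i.
rewrite [X in measurable_fun _ X](_ : _ = fun t : k.-tuple R =>
    \sum_(j < k) design n k i j * tnth t j).
  apply: measurable_sum => j; apply: measurable_funM => //.
  exact: measurable_tnth.
apply/funext => t; rewrite /= tnth_mktuple mxE.
by apply: eq_bigr => j _; rewrite [cvec _ _ _]mxE.
Qed.

HB.instance Definition _ n k := isMeasurableFun.Build _ _ _ _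
  (@design_tuple n k) (@measurable_design_tuple n k).

Definition prior n k (gamma : R) : probability (n.-tuple R) R :=
  distribution (iid_gaussian gamma k) (@design_tuple n k).

(* Density at y of N(F, sigma^2 I_n). *)
Definition likelihood n (sigma : R) (y : 'cV[R]_n) (F : n.-tuple R) : R :=
  \prod_(i < n) normal_pdf (tnth F i) sigma (y i 0).

(* Bayes' formula; this fixes the version of the conditional distribution of F
   given Y = y for every y, not only for almost every y. *)
Definition posterior n (W : probability (n.-tuple R) R) (sigma : R)
    (y : 'cV[R]_n) (A : set (n.-tuple R)) : \bar R :=
  (fine (\int[W]_(F in A) (likelihood sigma y F)%:E) /
   fine (\int[W]_F (likelihood sigma y F)%:E))%:E.

End posterior.

(* Main.v *)
(** Since [Phi^T Phi = n I], the posterior of [theta] is a product of Gaussians,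
    so [GF] given [Y] is exactly [N(c GY_phi, c sigma^2 G Sigma G^T)] with
    [c = n gamma / (sigma^2 + n gamma)], while [GY_phi] is exactly
    [N(GF_phi, sigma^2 G Sigma G^T)].  Two Gaussians are compared through their
    Hellinger affinity, which is explicit, and [n (1 - c)^2 -> 0] by the rate
    assumption on [gamma]: this gives (1), and then (2) once
    [n G Sigma G^T -> \int g^2] is known.

    With the discrete Fourier coefficients [gcoef],
    [GF_phi = \sum_(j <= k) gcoef g j * gcoef f j] and
    [n G Sigma G^T] is the case [f = g].  By Bessel's inequality on the grid, both
    limits reduce to the empirical norm of the tails
    [\sum_(j > k) theta_j phi_j], which is [O(k^-alpha)]: the Gram matrix of the
    [phi_j] on the grid only couples the indices aliased to each other, and
    Schur's test with the Sobolev weights applies to it. *)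

Require Import Defs.
From HB Require Import structures.
From mathcomp Require Import all_boot all_order all_algebra.
From mathcomp Require Import all_classical all_reals all_analysis.
From mathcomp Require Import measurable_realfun.
From mathcomp Require Import zify ring lra.

Set Implicit Arguments.
Unset Strict Implicit.
Unset Printing Implicit Defensive.

Import Order.TTheory GRing.Theory Num.Theory.
Import numFieldTopology.Exports numFieldNormedType.Exports.

Local Open Scope classical_set_scope.
Local Open Scope ring_scope.

(** * Gaussian integrals *)

(** Total variation is of the order of the square root of one minus the affinity, and the posterior
    mean is random, so a square root would have to be averaged. Instead the distance is bounded by
    [lambda] times a quadratic quantity plus [2 / lambda]; expectations are taken for fixed
    [lambda], which needs only a second moment of [GY_phi], and [lambda] is chosen last. The mean
    gap [(1 - c) GY_phi] competes with a standard deviation proportional to [sqrt(G Sigma G^T)],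
    which may be arbitrarily small. Cauchy-Schwarz and Bessel give [GF_phi^2 <= n M^2 G Sigma G^T]
    when [|f| <= M]: this is the origin of the factor [n] in [n (1 - c)^2]. If the variance
    vanishes, so do all retained coefficients of [g], and both laws are the Dirac mass at 0. In the
    bias, the aliasing errors have squared norm [O(k^(-2 alpha))] but are paired with true
    coefficients whose norm is only bounded, so the rate is [k^-alpha]; this matches the assumption
    [n = o(k^(2 alpha))]. *)

Lemma probability_integral_cst d (T : measurableType d) (R : realType)
  (Q : probability T R) (c : \bar R) : (\int[Q]_x c = c)%E.
Proof.
rewrite integral_cst// -[RHS]mule1; congr (_ * _)%E; exact: (probability_setT Q).
Qed.

Section gaussian_integrals.
Context {R : realType}.
Local Notation mu := (@lebesgue_measure R).
Implicit Types (m v s a u x : R) (h : R -> \bar R).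

(** The Radon-Nikodym derivative of [normal_prob] and the explicit density have the same integral
    over every measurable set, hence agree almost everywhere. *)
Lemma ge0_integral_normal_prob m s h : measurable_fun setT h ->
  (forall x, 0 <= h x)%E ->
  (\int[normal_prob m s]_x h x = \int[mu]_x (h x * (normal_pdf m s x)%:E))%E.
Proof.
move=> mh h0.
have dom := normal_prob_dominates m s.
rewrite -(Radon_Nikodym_SigmaFinite.change_of_variables dom)//.
apply: ae_eq_integral => //.
- apply: emeasurable_funM => //.
  exact: measurable_int (Radon_Nikodym_SigmaFinite.f_integrable dom).
- apply: emeasurable_funM => //.
  by apply/measurable_EFinP; exact: measurable_normal_pdf.
- apply: ae_eqe_mul2l; apply: integral_ae_eq => //.
  + exact: Radon_Nikodym_SigmaFinite.f_integrable.
  + by apply/measurable_EFinP; exact: measurable_normal_pdf.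
  + by move=> E _ mE; rewrite -Radon_Nikodym_SigmaFinite.f_integral.
Qed.

Lemma ge0_integral_gaussian m v h : 0 < v -> measurable_fun setT h ->
  (forall x, 0 <= h x)%E ->
  (\int[gaussian m v]_x h x =
   \int[mu]_x (h x * (normal_pdf m (Num.sqrt v) x)%:E))%E.
Proof.
move=> v0 mh h0; rewrite -ge0_integral_normal_prob//.
(* The identity is seen as a measurable map from [measurableTypeR R] to [R], and the integral
   against its distribution moves between these two presentations of the real line. *)
have mid : measurable_fun setT (id : measurableTypeR R -> R) by [].
pose X : {mfun measurableTypeR R >-> R} :=
  HB.pack (id : measurableTypeR R -> R) (isMeasurableFun.Build _ _ _ _ _ mid).
rewrite -[RHS](ge0_integral_distribution X mh h0).
apply: eq_measure_integral => A mA _.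
by rewrite /= /gaussian (gt_eqF v0).
Qed.

Lemma integral_gaussian0 m v h : v = 0 -> measurable_fun setT h ->
  (\int[gaussian m v]_x h x = h m)%E.
Proof.
move=> v0 mh; rewrite (eq_measure_integral (@dirac _ R m R))/=.
  by rewrite integral_dirac// diracT mul1e.
by move=> A mA _; rewrite v0 /gaussian /= eqxx.
Qed.

Lemma gaussianT m v : gaussian m v setT = 1%E.
Proof. exact: (@probability_setT _ _ _ (gaussian m v)). Qed.

Lemma gaussian_pdfE m v x : 0 < v -> normal_pdf m (Num.sqrt v) x =
  (Num.sqrt (v * pi *+ 2))^-1 * expR (- (x - m) ^+ 2 / (v *+ 2)).
Proof.
move=> v0; rewrite normal_pdfE ?gt_eqF ?sqrtr_gt0//.
by rewrite /normal_peak /normal_fun !sqr_sqrtr ?ltW.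
Qed.

End gaussian_integrals.

(** * Affine images of Gaussian laws *)

Section gaussian_affine.
Context {R : realType}.
Local Notation mu := (@lebesgue_measure R).
Implicit Types (m v s a u x : R) (h : R -> \bar R).

Definition aff a u : measurableTypeR R -> measurableTypeR R := fun x => a + u * x.

Lemma measurable_aff a u : measurable_fun setT (aff a u).
Proof. by apply: measurable_funD => //; exact: measurable_funM. Qed.

Let aff_image a u : {measure set (measurableTypeR R) -> \bar R} :=
  measure_function_pushforward__canonical__measure_function_Measure
    mu (measurable_aff a u).

(** By uniqueness of Lebesgue measure it is enough to look at intervals []c, d]]. A negative [u]
    turns the preimage into an interval closed on the left, of the same length. *)
Let lebesgue_measure_aff a u : u != 0 -> forall A, measurable A ->
  mu A = mscale `|u|%:nng (aff_image a u) A.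
Proof.
move=> u0; apply: lebesgue_measure_unique => _ [[c d]] _ <-.
rewrite -[RHS]/(`|u|%:E * mu (aff a u @^-1` `]c, d]%classic))%E.
have [ugt|ult] := ltP 0 u.
  rewrite [X in (_ * mu X)%E](_ : _ = `](c - a) / u, (d - a) / u]%classic); last first.
    apply/seteqP; split => x /=; rewrite !in_itv/= /aff;
      by rewrite ltr_pdivrMr// ler_pdivlMr// ltrBlDl lerBrDl (mulrC x).
  rewrite gtr0_norm// !lebesgue_measure_itv/= !lte_fin.
  rewrite ltr_pM2r ?invr_gt0// ltrD2r; case: ifP => _; last by rewrite mule0.
  by rewrite -!EFinB -EFinM; congr EFin; field.
have {}ult : u < 0 by rewrite lt_neqAle u0.
rewrite [X in (_ * mu X)%E](_ : _ = `[(d - a) / u, (c - a) / u[%classic); last first.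
  apply/seteqP; split => x /=; rewrite !in_itv/= /aff;
    by rewrite ltr_ndivlMr// ler_ndivrMr// ltrBlDl lerBrDl (mulrC x) andbC//.
rewrite ltr0_norm// !lebesgue_measure_itv/= !lte_fin.
rewrite ltr_nM2r ?invr_lt0// ltrD2r; case: ifP => _; last by rewrite mule0.
by rewrite -!EFinB -EFinM; congr EFin; field.
Qed.

Lemma ge0_integral_affine a u h : u != 0 -> measurable_fun setT h ->
  (forall x, 0 <= h x)%E ->
  (\int[mu]_x h x = `|u|%:E * \int[mu]_x h (a + u * x)%R)%E.
Proof.
move=> u0 mh h0.
rewrite (eq_measure_integral (mscale `|u|%:nng (aff_image a u))); last first.
  by move=> A mA _; exact: lebesgue_measure_aff.
rewrite ge0_integral_mscale//=; congr (_ * _)%E.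
by rewrite (ge0_integral_pushforward (measurable_aff a u)).
Qed.

(** For [v = 0] or [u = 0] both sides are evaluations at a point. Otherwise this is the change of
    variables by an affine map, whose Jacobian [|u|] is absorbed by the normalizing constant of the
    density. *)
Lemma ge0_integral_gaussian_affine m v a u h : 0 <= v ->
  measurable_fun setT h -> (forall x, 0 <= h x)%E ->
  (\int[gaussian m v]_x h (a + u * x)%R
   = \int[gaussian (a + u * m) (u ^+ 2 * v)]_x h x)%E.
Proof.
move=> v0 mh h0.
have mha : measurable_fun setT (fun x : R => h (a + u * x)).
  apply: (measurableT_comp mh).
  by apply: measurable_funD => //; exact: measurable_funM.
have [->|vn0] := eqVneq v 0.
  rewrite mulr0; apply: (eq_trans (integral_gaussian0 _ erefl mha)).
  exact/esym/integral_gaussian0.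
have {v0 vn0}v0 : 0 < v by rewrite lt_neqAle eq_sym vn0.
have [->|u0] := eqVneq u 0.
  rewrite expr2 !mul0r [RHS]integral_gaussian0//.
  under eq_integral do rewrite !mul0r addr0.
  by rewrite addr0 (probability_integral_cst (gaussian m v)).
have uv0 : 0 < u ^+ 2 * v by rewrite mulr_gt0// exprn_even_gt0.
apply: (eq_trans (ge0_integral_gaussian _ v0 mha (fun x => h0 _))).
apply: (eq_trans _ (esym (ge0_integral_gaussian _ uv0 mh h0))).
rewrite [RHS](ge0_integral_affine a u0); last 2 first.
- apply: emeasurable_funM => //.
  by apply/measurable_EFinP; exact: measurable_normal_pdf.
- by move=> x; rewrite mule_ge0// lee_fin normal_pdf_ge0.
rewrite -ge0_integralZl//; last 2 first.
- apply: emeasurable_funM => //.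
  apply/measurable_EFinP.
  apply: (measurableT_comp (measurable_normal_pdf _ _)).
  by apply: measurable_funD => //; exact: measurable_funM.
- by move=> x _; rewrite mule_ge0// lee_fin normal_pdf_ge0.
apply: eq_integral => x _; rewrite [RHS]muleCA; congr (_ * _)%E.
rewrite -EFinM; congr EFin.
rewrite !gaussian_pdfE// mulrA; congr (_ * _).
  rewrite [u ^+ 2 * v * _ *+ 2](_ : _ = u ^+ 2 * (v * pi *+ 2)); last by ring.
  by rewrite sqrtrM ?sqr_ge0// sqrtr_sqr invfM mulVKf// normr_eq0.
by congr expR; field; rewrite u0 gt_eqF.
Qed.
End gaussian_affine.

(** * Mixing a Gaussian over its mean *)

Section gaussian_mixture.
Context {R : realType}.
Local Notation mu := (@lebesgue_measure R).
Implicit Types (m v s a u x : R) (h : R -> \bar R).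

(** The joint density of a pair, with [x] of law [N(m, v)] and [z] given [x] of law [N(a + u x, w)],
    factored the other way: marginal density of [z] times conditional density of [x] given [z]. *)
Lemma gaussian_pdf_mul m v a u w x z : 0 < v -> 0 < w ->
  let V := w + u ^+ 2 * v in
  normal_pdf (a + u * x) (Num.sqrt w) z * normal_pdf m (Num.sqrt v) x =
  normal_pdf (a + u * m) (Num.sqrt V) z *
  normal_pdf ((m * w + u * v * (z - a)) / V) (Num.sqrt (w * v / V)) x.
Proof.
move=> v0 w0 V.
have V0 : 0 < V by rewrite ltr_wpDr// mulr_ge0 ?sqr_ge0 ?ltW.
have T0 : 0 < w * v / V by rewrite divr_gt0// mulr_gt0.
rewrite !gaussian_pdfE// !(mulrACA _ (expR _)) -!invfM -!expRD; congr (_^-1 * expR _).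
  have p0 : 0 <= pi :> R by exact: pi_ge0.
  rewrite -!sqrtrM ?mulrn_wge0 ?mulr_ge0 ?(ltW w0) ?(ltW V0)//.
  by congr Num.sqrt; field; rewrite gt_eqF.
by rewrite /V; field; rewrite !gt_eqF.
Qed.

Lemma ge0_integral_gaussian_mixture m v a u w h : 0 < v -> 0 <= w ->
  measurable_fun setT h -> (forall x, 0 <= h x)%E ->
  (\int[gaussian m v]_x \int[gaussian (a + u * x) w]_z h z
   = \int[gaussian (a + u * m) (w + u ^+ 2 * v)]_z h z)%E.
Proof.
move=> v0 w0 mh h0.
have [->|wn0] := eqVneq w 0.
  rewrite add0r.
  apply: (eq_trans _ (ge0_integral_gaussian_affine _ _ _ (ltW v0) mh h0)).
  by apply: eq_integral => x _; exact: integral_gaussian0.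
have {w0 wn0}w0 : 0 < w by rewrite lt_neqAle eq_sym wn0.
set V := w + _.
have V0 : 0 < V by rewrite ltr_wpDr// mulr_ge0 ?sqr_ge0 ?ltW.
pose F (p : measurableTypeR R * measurableTypeR R) : \bar R :=
  (h p.2 * (normal_pdf (a + u * p.1) (Num.sqrt w) p.2)%:E)%E.
have mpdf : measurable_fun setT (fun p : measurableTypeR R * measurableTypeR R =>
    normal_pdf (a + u * p.1) (Num.sqrt w) p.2).
  rewrite [X in measurable_fun _ X](_ : _ = fun p =>
    (Num.sqrt (w * pi *+ 2))^-1 * expR (- (p.2 - (a + u * p.1)) ^+ 2 / (w *+ 2))).
    apply: measurable_funM => //; apply: measurableT_comp => //.
    apply: measurable_funM => //; apply: measurableT_comp => //.
    apply: measurable_funX; apply: measurable_funB => //.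
    by apply: measurable_funD => //; apply: measurable_funM.
  by apply/funext => p; rewrite gaussian_pdfE.
have mF : measurable_fun setT F.
  by apply: emeasurable_funM; [exact: (measurableT_comp mh)|exact/measurable_EFinP].
have F0 p : (0 <= F p)%E by rewrite mule_ge0// lee_fin normal_pdf_ge0.
have FE x : (\int[gaussian (a + u * x) w]_z h z = \int[mu]_z F (x, z))%E.
  exact: ge0_integral_gaussian.
apply: (eq_trans (eq_integral _ _ (fun x _ => FE x))).
have mFF : measurable_fun setT (fun x : R => \int[mu]_z F (x, z))%E.
  exact: (@measurable_fun_fubini_tonelli_F _ _ (measurableTypeR R) (measurableTypeR R) R mu F mF F0).
apply: (eq_trans (ge0_integral_gaussian _ v0 mFF _)).
  by move=> x; exact: integral_ge0.
pose G (p : measurableTypeR R * measurableTypeR R) : \bar R :=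
  (F p * (normal_pdf m (Num.sqrt v) p.1)%:E)%E.
have mG : measurable_fun setT G.
  apply: emeasurable_funM => //; apply/measurable_EFinP.
  by apply: (measurableT_comp (measurable_normal_pdf _ _)).
have G0 p : (0 <= G p)%E by rewrite mule_ge0// lee_fin normal_pdf_ge0.
transitivity (\int[mu]_x \int[mu]_z G (x, z))%E.
  apply: eq_integral => x _; rewrite /G/= ge0_integralZr//.
    exact: measurableT_comp mF _.
  by rewrite lee_fin normal_pdf_ge0.
apply: (eq_trans (@fubini_tonelli _ _ _ _ R mu mu G mG G0)).
apply: (eq_trans _ (esym (ge0_integral_gaussian _ V0 mh h0))).
(* After the exchange of integrals, the conditional density of [x] given [z] integrates to 1 and
   only the marginal of [z] is left. *)
apply: eq_integral => z _.
rewrite /G/F/=.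
under eq_integral do rewrite -muleA -EFinM gaussian_pdf_mul// EFinM muleA -/V.
rewrite ge0_integralZl//; last 2 first.
- by move=> x _; rewrite lee_fin normal_pdf_ge0.
- by rewrite mule_ge0// lee_fin normal_pdf_ge0.
by rewrite integral_normal_pdf mule1.
by apply/measurable_EFinP; exact: measurable_normal_pdf.
Qed.

End gaussian_mixture.

(** * Conjugacy for Gaussian products *)

Section gaussian_linear.
Context {R : realType}.
Implicit Types (m v s a p x : R) (h : R -> \bar R).

(** The dependence of a Gaussian likelihood on one coordinate: [p] is the precision and [b] the
    linear term brought by the data. *)
Definition tilt p b x : R := expR (- (p * x ^+ 2) / 2 + b * x).

Lemma measurable_tilt p b : measurable_fun setT (tilt p b).
Proof.
apply: measurableT_comp => //; apply: measurable_funD; last exact: measurable_funM.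
apply: measurable_funM => //; apply: measurableT_comp => //.
by apply: measurable_funM => //; exact: measurable_funX.
Qed.

Lemma ge0_integral_gaussian_tilt v p b : 0 < v -> 0 <= p ->
  exists2 Z : R, 0 < Z & forall h, measurable_fun setT h ->
  (forall x, 0 <= h x)%E ->
  (\int[gaussian 0 v]_x (h x * (tilt p b x)%:E) = Z%:E *
   \int[gaussian (v / (1 + p * v) * b) (v / (1 + p * v))]_x h x)%E.
Proof.
move=> v0 p0; set s := v / _.
have pv0 : 0 < 1 + p * v by rewrite ltr_wpDr// mulr_ge0// ltW.
have s0 : 0 < s by rewrite divr_gt0.
(* Completing the square in the tilted density leaves the ratio of the two normalizing constants and
   the factor [expR (s * b ^+ 2 / 2)]. *)
pose Z := Num.sqrt (s * pi *+ 2) / Num.sqrt (v * pi *+ 2) * expR (s * b ^+ 2 / 2).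
have spi0 w : 0 < w -> 0 < Num.sqrt (w * pi *+ 2) :> R.
  by move=> w0; rewrite sqrtr_gt0 mulrn_wgt0// mulr_gt0// pi_gt0.
have Z0 : 0 < Z by rewrite mulr_gt0 ?expR_gt0// divr_gt0// spi0.
have ZE x : tilt p b x * normal_pdf 0 (Num.sqrt v) x =
            Z * normal_pdf (s * b) (Num.sqrt s) x.
  rewrite !gaussian_pdfE// /tilt /Z mulrCA -expRD.
  rewrite [RHS]mulrACA -expRD [_ / _ / _]mulrAC divff ?mul1r ?gt_eqF ?spi0//.
  congr (_ * expR _).
  by rewrite /s; field; rewrite !gt_eqF.
exists Z => // h mh h0.
have mt : measurable_fun setT (fun x : R => h x * (tilt p b x)%:E)%E.
  by apply: emeasurable_funM => //; apply/measurable_EFinP; exact: measurable_tilt.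
have t0 x : (0 <= h x * (tilt p b x)%:E)%E by rewrite mule_ge0// lee_fin expR_ge0.
have mp : measurable_fun setT (fun x : measurableTypeR R =>
    h x * (normal_pdf (s * b) (Num.sqrt s) x)%:E)%E.
  apply: emeasurable_funM => //; apply/measurable_EFinP.
  exact: measurable_normal_pdf.
apply: (eq_trans (ge0_integral_gaussian _ v0 mt t0)).
apply: (eq_trans _ (congr1 (mule Z%:E) (esym (ge0_integral_gaussian _ s0 mh h0)))).
rewrite -ge0_integralZl//; last 2 first.
- by move=> x _; rewrite mule_ge0// lee_fin normal_pdf_ge0.
- by rewrite lee_fin ltW.
by apply: eq_integral => x _; rewrite -muleA -EFinM ZE EFinM muleCA.
Qed.

Definition tilts k p (b : 'I_k -> R) (t : k.-tuple R) : R :=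
  \prod_(j < k) tilt p (b j) (tnth t j).

Definition dot k (u : 'I_k -> R) (t : k.-tuple R) : R :=
  \sum_(j < k) u j * tnth t j.

Lemma measurable_tilts k p b : measurable_fun setT (@tilts k p b).
Proof.
apply: measurable_prod => j _; apply: (measurableT_comp (measurable_tilt _ _)).
exact: measurable_tnth.
Qed.

Lemma measurable_dot k u : measurable_fun setT (@dot k u).
Proof.
apply: measurable_sum => j; apply: measurable_funM => //.
exact: measurable_tnth.
Qed.

Lemma tilts_ge0 k p b t : 0 <= @tilts k p b t.
Proof. by apply: prodr_ge0 => j _; exact: expR_ge0. Qed.

(** The constant [K] comes before [a], [u] and [h]: the same [K] then normalizes the numerator and
    the denominator of Bayes' formula. The offset [a] is universally quantified for the induction,
    in which the first coordinate shifts it by [u ord0 * x]; integrating that coordinate out is a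
    Gaussian mixture. *)
Lemma ge0_integral_iid_gaussian_tilt v p k (b : 'I_k -> R) : 0 < v -> 0 <= p ->
  exists2 K : R, 0 < K & forall a (u : 'I_k -> R) h, measurable_fun setT h ->
  (forall x, 0 <= h x)%E ->
  (\int[iid_gaussian v k]_t (h (a + dot u t)%R * (tilts p b t)%:E) = K%:E *
   \int[gaussian (a + v / (1 + p * v) * \sum_(j < k) u j * b j)
     (v / (1 + p * v) * \sum_(j < k) u j ^+ 2)]_x h x)%E.
Proof.
move=> v0 p0; have pv0 : 0 < 1 + p * v by rewrite ltr_wpDr// mulr_ge0// ltW.
set s := v / _.
have s0 : 0 < s by rewrite divr_gt0.
elim: k b => [|k IH] b.
  exists 1 => // a u h mh h0.
  rewrite mul1e !big_ord0 !mulr0 addr0.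
  apply: (eq_trans _ (esym (integral_gaussian0 _ erefl mh))).
  rewrite /= integral_dirac//; last first.
    apply: emeasurable_funM.
      apply: (measurableT_comp mh); apply: measurable_funD => //.
      exact: measurable_dot.
    by apply/measurable_EFinP; exact: measurable_tilts.
  by rewrite diracT mul1e /dot /tilts !big_ord0 mule1 addr0.
have [K K0 HK] := IH (fun j => b (lift ord0 j)).
have [Z Z0 HZ] := ge0_integral_gaussian_tilt (b ord0) v0 p0.
exists (K * Z); first by rewrite mulr_gt0.
move=> a u h mh h0.
set a' := s * \sum_(j < k) u (lift ord0 j) * b (lift ord0 j).
set w := s * \sum_(j < k) u (lift ord0 j) ^+ 2.
have w0 : 0 <= w.
  by apply: mulr_ge0; [exact: ltW|apply: sumr_ge0 => j _; exact: sqr_ge0].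
have dotE x (t : k.-tuple R) : a + dot u (tuple_cons (x, t)) =
    (a + u ord0 * x) + dot (fun j => u (lift ord0 j)) t.
  rewrite /dot big_ord_recl tnth0 addrA; congr (_ + _).
  by apply: eq_bigr => j _; rewrite tnthS.
have tiltsE x (t : k.-tuple R) : tilts p b (tuple_cons (x, t)) =
    tilt p (b ord0) x * tilts p (fun j => b (lift ord0 j)) t.
  rewrite /tilts big_ord_recl tnth0; congr (_ * _).
  by apply: eq_bigr => j _; rewrite tnthS.
pose F t := (h (a + dot u t)%R * (tilts p b t)%:E)%E.
have mF : measurable_fun setT F.
  apply: emeasurable_funM.
    apply: (measurableT_comp mh); apply: measurable_funD => //.
    exact: measurable_dot.
  by apply/measurable_EFinP; exact: measurable_tilts.
have F0 t : (0 <= F t)%E by rewrite mule_ge0// lee_fin tilts_ge0.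
apply: (eq_trans (ge0_integral_distribution _ mF F0)).
have mFc : measurable_fun setT (F \o @tuple_cons R k).
  exact: (measurableT_comp mF (@measurable_tuple_cons R k)).
apply: (eq_trans (fubini_tonelli1 _ mFc (fun _ => F0 _))).
pose H x := (\int[gaussian (a + a' + u ord0 * x) w]_z h z)%E.
have H0 x : (0 <= H x)%E by exact: integral_ge0.
have FE x : fubini_F (iid_gaussian v k) (F \o @tuple_cons R k) x =
    (K%:E * (H x * (tilt p (b ord0) x)%:E))%E.
  rewrite /fubini_F/= /F.
  transitivity (\int[iid_gaussian v k]_t (
     (tilt p (b ord0) x)%:E * (h ((a + u ord0 * x) + dot (fun j => u (lift ord0 j)) t)%R *
     (tilts p (fun j => b (lift ord0 j)) t)%:E)))%E.
    by apply: eq_integral => t _; rewrite dotE tiltsE EFinM muleCA.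
  rewrite ge0_integralZl//; last 3 first.
  - apply: emeasurable_funM.
      apply: (measurableT_comp mh); apply: measurable_funD => //.
      exact: measurable_dot.
    by apply/measurable_EFinP; exact: measurable_tilts.
  - by move=> t _; rewrite mule_ge0// lee_fin tilts_ge0.
  - by rewrite lee_fin expR_ge0.
  apply: (eq_trans (congr1 (mule _) (HK _ _ _ mh h0))).
  by rewrite [a + _ + _]addrAC muleCA [X in (_ * X)%E]muleC.
apply: (eq_trans (eq_integral _ _ (fun x _ => FE x))).
(* Up to the nonzero constant [K], [H] is a partial integral of a jointly measurable function, so
   Tonelli gives its measurability. *)
have mH : measurable_fun setT H.
  pose g (q : R * k.-tuple R) := (h ((a + u ord0 * q.1) +
    dot (fun j => u (lift ord0 j)) q.2)%R * (tilts p (fun j => b (lift ord0 j)) q.2)%:E)%E.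
  have mg : measurable_fun setT g.
    apply: emeasurable_funM.
      apply: (measurableT_comp mh); apply: measurable_funD.
        by apply: measurable_funD => //; exact: measurable_funM.
      exact: (measurableT_comp (measurable_dot _)).
    by apply/measurable_EFinP; exact: (measurableT_comp (measurable_tilts _ _)).
  have g0 q : (0 <= g q)%E by rewrite mule_ge0// lee_fin tilts_ge0.
  have mG := @measurable_fun_fubini_tonelli_F _ _ _ _ R (iid_gaussian v k) g mg g0.
  rewrite (_ : H = fun x => (K^-1%:E * fubini_F (iid_gaussian v k) g x)%E).
    exact: emeasurable_funM.
  apply/funext => x.
  apply: (eq_trans _ (congr1 (mule _) (esym (HK (a + u ord0 * x) _ _ mh h0)))).
  by rewrite muleA -EFinM mulVf ?gt_eqF// mul1e [a + _ + _]addrAC.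
have mHt : measurable_fun setT (fun x => H x * (tilt p (b ord0) x)%:E)%E.
  by apply: emeasurable_funM => //; apply/measurable_EFinP; exact: measurable_tilt.
have Ht0 x : setT x -> (0 <= H x * (tilt p (b ord0) x)%:E)%E.
  by move=> _; rewrite mule_ge0// lee_fin expR_ge0.
have K0' : (0 <= K%:E)%E by rewrite lee_fin ltW.
apply: (eq_trans (ge0_integralZl _ measurableT mHt Ht0 K0')).
apply: (eq_trans (congr1 (mule K%:E) (HZ _ mH H0))).
rewrite muleA -EFinM; apply: congr1.
apply: (eq_trans (ge0_integral_gaussian_mixture _ _ _ s0 w0 mh h0)).
have -> : a + a' + u ord0 * (s * b ord0) = a + s * \sum_(j < k.+1) u j * b j.
  by rewrite big_ord_recl /a'; ring.
suff -> : w + u ord0 ^+ 2 * s = s * \sum_(j < k.+1) u j ^+ 2 by [].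
by rewrite big_ord_recl /w; ring.
Qed.

End gaussian_linear.

(** * The Fourier basis on the grid *)

Section trigonometric_sums.
Context {R : realType}.
Implicit Types (m n i j q : nat) (x : R).

Definition trig (b : bool) m x : R :=
  if b then sin (2 * pi * m%:R * x) else cos (2 * pi * m%:R * x).

Lemma sin_natpi q x : sin (q%:R * pi + x) = (-1) ^+ q * sin x.
Proof.
elim: q x => [|q IH] x; first by rewrite mul0r add0r expr0 mul1r.
by rewrite -[q.+1%:R]natr1 mulrDl mul1r -addrA IH [pi + x]addrC sinDpi exprSr; ring.
Qed.

Lemma sin_nat2pi q : sin (2 * pi * q%:R : R) = 0.
Proof.
have -> : 2 * pi * q%:R = (2 * q)%:R * pi + 0 :> R by rewrite natrM; ring.
by rewrite sin_natpi sin0 mulr0.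
Qed.

Lemma cos_nat2pi q : cos (2 * pi * q%:R : R) = 1.
Proof.
elim: q => [|q IH]; first by rewrite mulr0 cos0.
by rewrite -[q.+1%:R]natr1 mulrDr mulr1 [X in _ + X]mulr_natl cosD2pi.
Qed.

Lemma sin_natpi_neq0 n m : (0 < n)%N -> ~~ (n %| m)%N ->
  sin (pi * m%:R / n%:R : R) != 0.
Proof.
move=> n0 nm.
rewrite (_ : _ / _ = (m %/ n)%:R * pi + pi * (m %% n)%:R / n%:R); last first.
  by rewrite {1}(divn_eq m n) natrD natrM; field; rewrite pnatr_eq0 -lt0n.
rewrite sin_natpi mulf_neq0 ?expf_neq0 ?oppr_eq0 ?oner_eq0// gt_eqF// sin_gt0_pi//.
have r0 : (0 < m %% n)%N by rewrite lt0n.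
apply/andP; split; first by rewrite divr_gt0 ?ltr0n// mulr_gt0 ?pi_gt0 ?ltr0n.
by rewrite ltr_pdivrMr ?ltr0n// ltr_pM2l ?pi_gt0// ltr_nat ltn_mod.
Qed.

(** If [n] divides [m], every angle is a multiple of [2 pi]. Otherwise multiplication by [2 sin t],
    with [t = pi m / n] and [sin t] nonzero, makes the sum telescope, and the end terms agree by
    periodicity. *)
Lemma trig_grid_sum n m b : (0 < n)%N ->
  \sum_(i < n) trig b m (grid i) = if ~~ b && (n %| m)%N then n%:R else 0 :> R.
Proof.
move=> n0; have n0' : n%:R != 0 :> R by rewrite pnatr_eq0 -lt0n.
have [/dvdnP[q ->]|nm] := boolP (n %| m)%N.
  have E (i : 'I_n) : 2 * pi * (q * n)%:R * grid i = 2 * pi * (q * i.+1)%:R :> R.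
    by rewrite /grid !natrM; field.
  rewrite /trig; case: b => /=.
    by rewrite big1// => i _; rewrite E sin_nat2pi.
  under eq_bigr do rewrite E cos_nat2pi.
  by rewrite sumr_const card_ord.
rewrite andbF.
set t : R := pi * m%:R / n%:R.
have st : 2 * sin t != 0 by rewrite mulf_neq0 ?sin_natpi_neq0// pnatr_eq0.
have E (i : 'I_n) : 2 * pi * m%:R * grid i = (2 * i.+1)%:R * t.
  by rewrite /grid /t !natrM; field.
(* The discrete primitive: product-to-sum turns [2 sin t] times the term of angle [2 (i + 1) t] into
   the difference of [u] at [i + 1] and at [i]. *)
pose u k : R := if b then - cos ((2 * k).+1%:R * t) else sin ((2 * k).+1%:R * t).
have uE (i : 'I_n) : 2 * sin t * trig b m (grid i) = u i.+1 - u i.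
  have e1 : (2 * i.+1).+1%:R * t = (2 * i.+1)%:R * t + t by rewrite -[(2 * i.+1).+1%:R]natr1; ring.
  have e2 : (2 * i).+1%:R * t = (2 * i.+1)%:R * t - t.
    by rewrite mulnS -[(2 * i).+1%:R]natr1 !(natrD,natrM); ring.
  rewrite /trig /u E e1 e2; case: ifP => _; rewrite ?cosB ?cosD ?sinB ?sinD; ring.
apply: (mulfI st); rewrite mulr0 mulr_sumr.
under eq_bigr do rewrite uE.
rewrite -(big_mkord xpredT (fun i => u i.+1 - u i)) telescope_sumr//.
have e : (2 * n).+1%:R * t = 2 * pi * m%:R + t.
  by rewrite -[(2 * n).+1%:R]natr1 natrM /t; field.
rewrite /u muln0 mul1r e; case: ifP => _.
  by rewrite cosD cos_nat2pi sin_nat2pi; ring.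
by rewrite sinD cos_nat2pi sin_nat2pi; ring.
Qed.

Lemma fourierE j x : (1 < j)%N ->
  fourier j x = Num.sqrt 2 * trig (odd j) j./2 x.
Proof.
move=> j1; rewrite /fourier /trig ifF; last by rewrite gtn_eqF.
by case: ifP.
Qed.

Lemma fourier1 x : fourier 1 x = 1. Proof. by []. Qed.

(** Product-to-sum formulas in a form uniform in the parities. Frequencies are natural numbers, so
    their distance is written with [maxn] and [minn], and the signs in [e] depend on which one is
    larger. The value of [e.1] for equal parities fixes the norm on the diagonal. *)
Lemma fourier_mul j j' : (1 < j)%N -> (1 < j')%N ->
  exists e : R * R,
  [/\ `|e.1| = 1, `|e.2| = 1, odd j = odd j' -> e.1 = 1 &
   forall x, fourier j x * fourier j' x =
    e.1 * trig (odd j != odd j') (maxn j./2 j'./2 - minn j./2 j'./2) x +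
    e.2 * trig (odd j != odd j') (j./2 + j'./2) x].
Proof.
move=> j1 j1'.
suff H : exists e : R * R,
  [/\ `|e.1| = 1, `|e.2| = 1, odd j = odd j' -> e.1 = 1 &
   forall x, trig (odd j) j./2 x * trig (odd j') j'./2 x *+ 2 =
    e.1 * trig (odd j != odd j') (maxn j./2 j'./2 - minn j./2 j'./2) x +
    e.2 * trig (odd j != odd j') (j./2 + j'./2) x].
  case: H => e [e1 e2 e3 He]; exists e; split => // x.
  rewrite -He !fourierE// mulrACA -expr2 sqr_sqrtr//; ring.
set m := j./2; set m' := j'./2; rewrite /trig.
have E x : 2 * pi * (m + m')%:R * x = 2 * pi * m%:R * x + 2 * pi * m'%:R * x.
  by rewrite natrD; ring.
have [mm'|mm'] := leqP m m'.
  have D x : 2 * pi * (m' - m)%:R * x = 2 * pi * m'%:R * x - 2 * pi * m%:R * x.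
    by rewrite natrB//; ring.
  case: (odd j); case: (odd j') => /=.
  - exists (1, -1); rewrite normrN normr1; split => // x.
    by rewrite E D cosB cosD /=; ring.
  - exists (-1, 1); rewrite normrN normr1; split => // x.
    by rewrite E D sinB sinD /=; ring.
  - exists (1, 1); rewrite normr1; split => // x.
    by rewrite E D sinB sinD /=; ring.
  - exists (1, 1); rewrite normr1; split => // x.
    by rewrite E D cosB cosD /=; ring.
have D x : 2 * pi * (m - m')%:R * x = 2 * pi * m%:R * x - 2 * pi * m'%:R * x.
  by rewrite natrB ?(ltnW mm')//; ring.
case: (odd j); case: (odd j') => /=.
- exists (1, -1); rewrite normrN normr1; split => // x.
  by rewrite E D cosB cosD /=; ring.
- exists (1, 1); rewrite normr1; split => // x.
  by rewrite E D sinB sinD /=; ring.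
- exists (-1, 1); rewrite normrN normr1; split => // x.
  by rewrite E D sinB sinD /=; ring.
- exists (1, 1); rewrite normr1; split => // x.
  by rewrite E D cosB cosD /=; ring.
Qed.

Definition gram n j j' : R := \sum_(i < n) fourier j (grid i) * fourier j' (grid i).

Lemma gramC n j j' : gram n j j' = gram n j' j.
Proof. by apply: eq_bigr => i _; rewrite mulrC. Qed.

(** The grid keeps the difference and the sum of the two frequencies only when they are multiples of
    [n], and each then contributes at most [n]. *)
Lemma gram_bound n j j' : (0 < n)%N -> (1 < j)%N -> (1 < j')%N ->
  `|gram n j j'| <= n%:R * ((j'./2 == j./2 %[mod n])%:R +
                            (n %| j'./2 + j./2)%:R).
Proof.
move=> n0 j1 j1'; have [e [e1 e2 _ He]] := fourier_mul j1 j1'.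
have -> : (j'./2 == j./2 %[mod n]) = (n %| maxn j./2 j'./2 - minn j./2 j'./2)%N.
  have [mm'|mm'] := leqP j./2 j'./2; first by rewrite eqn_mod_dvd.
  by rewrite eq_sym eqn_mod_dvd// ltnW.
rewrite /gram; under eq_bigr do rewrite He.
rewrite big_split/= -!mulr_sumr.
rewrite !trig_grid_sum// addnC mulrDr.
apply: (le_trans (ler_normD _ _)); rewrite !normrM e1 e2 !mul1r.
by apply: lerD; case: (_ && _) / andP => [[_ ->]|_];
  rewrite ?mulr1 ?normr0 ?ger0_norm// mulr_ge0.
Qed.

(** The range of the indices keeps every sum of two frequencies below [n], so that nothing is
    aliased. For even [n] the index [n] is excluded, since its frequency [n / 2] is aliased with
    itself. *)
Lemma gram_orthonormal n j j' : (0 < j)%N -> (0 < j')%N ->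
  (j <= if odd n then n else n.-1)%N -> (j' <= if odd n then n else n.-1)%N ->
  gram n j j' = n%:R * (j == j')%:R.
Proof.
wlog jj' : j j' / (j <= j')%N.
  move=> H j0 j0' jn j'n; have [|/ltnW] := leqP j j' => jj'; first exact: H.
  by rewrite gramC H// eq_sym.
move=> j0 j0' jn j'n.
have n0 : (0 < n)%N by case: (n) jn => //=; rewrite leqn0; case: (j) j0.
have half_lt i : (0 < i)%N -> (i <= if odd n then n else n.-1)%N -> (i./2 + i./2 < n)%N.
  move=> i0; rewrite addnn => ile.
  have := odd_double_half i; have := odd_double_half n.
  case: ifP ile => nn ile; rewrite ?nn => e1 e2; last by move: n0 ile; case: (n) => //= n' _; lia.
  by move: ile i0; case: (odd i) e2 => /= e2; lia.
have [j1|j1] := leqP j 1.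
  have -> : j = 1%N by apply/eqP; rewrite eqn_leq j1.
  have [j1'|j1'] := leqP j' 1.
    have -> : j' = 1%N by apply/eqP; rewrite eqn_leq j1'.
    rewrite /gram; under eq_bigr do rewrite fourier1 mulr1.
    by rewrite sumr_const card_ord mulr1.
  rewrite (ltn_eqF j1') mulr0 /gram.
  under eq_bigr do rewrite fourier1 mul1r fourierE//.
  rewrite -mulr_sumr trig_grid_sum//.
  have : ~~ (n %| j'./2)%N.
    rewrite gtnNdvd ?half_gt0//; have := half_lt _ j0' j'n; lia.
  by move/negbTE => ->; rewrite andbF mulr0.
have j1' := leq_trans j1 jj'.
have [e [e1 e2 e3 He]] := fourier_mul j1 j1'.
rewrite /gram; under eq_bigr do rewrite He.
rewrite big_split/= -!mulr_sumr.
rewrite !trig_grid_sum//.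
have hj := half_leq jj'; rewrite (maxn_idPr hj) (minn_idPl hj).
have -> : (n %| j./2 + j'./2)%N = false.
  apply/negbTE; rewrite gtnNdvd//.
    by rewrite addn_gt0 half_gt0 j1.
  by apply: leq_ltn_trans (half_lt _ j0' j'n); rewrite leq_add2r.
rewrite andbF mulr0 addr0.
have -> : (n %| j'./2 - j./2)%N = (j./2 == j'./2).
  have [e0|ne] := eqVneq j./2 j'./2; first by rewrite e0 subnn dvdn0.
  have hlt : (j./2 < j'./2)%N by rewrite ltn_neqAle ne.
  rewrite gtnNdvd ?subn_gt0//; have := half_lt _ j0' j'n; lia.
rewrite negbK.
have -> : (j == j') = (odd j == odd j') && (j./2 == j'./2).
  apply/eqP/andP => [->//|[/eqP ho /eqP h]].
  by rewrite -(odd_double_half j) -(odd_double_half j') ho h.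
have [ho|ho] := eqVneq (odd j) (odd j'); last by rewrite /= !mulr0.
rewrite /=.
by rewrite e3// mul1r; case: (_ == _); rewrite ?mulr1 ?mulr0.
Qed.

End trigonometric_sums.

(** * Aliasing and tails on the grid *)

Section sobolev_tail.
Context {R : realType}.
Implicit Types (alpha s : R) (theta : R^nat) (k n m i j q N : nat).

(** Cauchy condensation: grouping [2 q] with [2 q + 1] gives [P (2 Q) <= 1 + rho * P Q] with
    [rho = 2 ^ (1 - s) < 1]. As [P N <= P (2 N)], every partial sum is at most [1 / (1 - rho)]. *)
Lemma sum_powR_bound s : 1 < s ->
  exists S : R, 0 <= S /\ forall N, \sum_(1 <= q < N) (q%:R `^ s)^-1 <= S.
Proof.
move=> s1; have s0 : 0 <= s by rewrite ltW// (lt_trans ltr01).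
pose f q : R := (q%:R `^ s)^-1.
have f0 q : 0 <= f q by rewrite invr_ge0 powR_ge0.
pose P N := \sum_(1 <= q < N) f q.
pose rho : R := 2 `^ (1 - s).
have rho1 : rho < 1.
  by rewrite /rho /powR pnatr_eq0/= expR_lt1 nmulr_rlt0 ?subr_lt0// ln_gt0// ltr1n.
have f2 q : f (2 * q)%N *+ 2 = rho * f q.
  rewrite /f natrM powRM ?ler0n// invfM /rho powRB ?pnatr_eq0 ?implybT// powRr1//.
  by ring.
have P2 Q : P (2 * Q)%N <= 1 + rho * P Q.
  elim: Q => [|[|Q] IH].
  - by rewrite /P !big_geq// mulr0 addr0.
  - by rewrite /P big_nat1 (big_geq (leqnn 1)) mulr0 addr0 /f powR1 invr1.
  rewrite mulnS /P addnC addn2 2?[in leLHS]big_nat_recr//= [in leRHS]big_nat_recr//=.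
  rewrite mulrDr [leRHS]addrA -[leLHS]addrA; apply: lerD; first exact: IH.
  rewrite -f2 mulr2n; apply: lerD => //.
  rewrite lef_pV2 ?posrE ?powR_gt0 ?ltr0n ?muln_gt0//.
  by rewrite ge0_ler_powR// ?nnegrE ?ler0n// ler_nat.
exists (1 - rho)^-1; split; first by rewrite invr_ge0 subr_ge0 ltW.
move=> N; rewrite -/(P N).
have PN : P N <= P (2 * N)%N.
  have [N0|N1] := leqP N 1; first by rewrite {1}/P big_geq// sumr_ge0.
  rewrite /P [leRHS](big_cat_nat _ _ (n := N)) ?leq_pmull// ?(ltnW N1)//=.
  by rewrite lerDl sumr_ge0.
rewrite -div1r ler_pdivlMr ?subr_gt0// mulrBr mulr1 lerBlDr mulrC.
exact: le_trans PN (P2 N).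
Qed.

Lemma sum_residue n r Q (F : nat -> R) : (0 < n)%N ->
  \sum_(0 <= m < Q * n) (m == r %[mod n])%:R * F m =
  \sum_(0 <= q < Q) F (q * n + r %% n)%N.
Proof.
move=> n0; elim: Q => [|Q IH]; first by rewrite mul0n !big_geq.
rewrite big_nat_recr//= -IH (big_cat_nat _ _ (n := Q * n)) ?leq_pmull ?leq_mul//=.
congr (_ + _); rewrite -{1}[(Q * n)%N]add0n big_addn mulSn addnK big_mkord.
rewrite (bigD1 (Ordinal (ltn_pmod r n0)))//= big1 ?addr0 => [|i].
  by rewrite addnC modnMDl modn_mod eqxx mul1r.
rewrite -val_eqE /= addnC modnMDl (modn_small (ltn_ord i)) => /negbTE ->.
by rewrite mul0r.
Qed.

Lemma sum_half M (F : nat -> R) :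
  \sum_(0 <= j < M.*2) F j./2 = 2 * \sum_(0 <= m < M) F m.
Proof.
elim: M => [|M IH]; first by rewrite !big_geq// mulr0.
rewrite doubleS !big_nat_recr//= IH doubleK uphalf_double; ring.
Qed.

(** The weight depends only on the frequency [j./2], shared by a cosine and a sine, so sums over
    indices reduce to sums over frequencies. *)
Lemma sobolev_weightE alpha j : sobolev_weight alpha j = (j./2.*2)%:R `^ alpha :> R.
Proof.
rewrite /sobolev_weight; case: ifP => oj.
  by rewrite -{1}(odd_double_half j) oj.
by rewrite -{1}(odd_double_half j) oj.
Qed.

Lemma sobolev_weight_sqr alpha j :
  sobolev_weight alpha j ^+ 2 = (j./2.*2)%:R `^ (2 * alpha) :> R.
Proof.
by rewrite sobolev_weightE -powR_mulrn ?powR_ge0// -powRrM mulrC.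
Qed.

(** Rounding [j] down to an even number loses at most one, which the strict inequality [k < j]
    allows. *)
Lemma sobolev_weight_ge alpha k j : 0 <= alpha -> (k < j)%N ->
  k%:R `^ (2 * alpha) <= sobolev_weight alpha j ^+ 2 :> R.
Proof.
move=> a0 kj; rewrite sobolev_weight_sqr ge0_ler_powR ?nnegrE ?ler0n ?mulr_ge0//.
by rewrite ler_nat; have := odd_double_half j; case: (odd j) => /=; lia.
Qed.

Lemma sobolev_weight_gt0 alpha j : (1 < j)%N -> 0 < sobolev_weight alpha j :> R.
Proof.
by move=> j1; rewrite sobolev_weightE powR_gt0// ltr0n double_gt0 half_gt0.
Qed.

(** In a residue class modulo [n], the smallest frequency contributes at most [k ^ (-2 alpha)]
    thanks to the cutoff [k <= m.*2]. The next ones are at least [q n], hence [q k], and sum to at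
    most [S] times the same power. This is the constant [1 + S]. *)
Lemma sum_alias_weight alpha : 2^-1 < alpha -> exists C : R, 0 <= C /\
  forall n k r N, (0 < k <= n)%N ->
  \sum_(0 <= m < N) (m == r %[mod n])%:R *
     ((k <= m.*2)%N%:R * ((m.*2)%:R `^ (2 * alpha))^-1) <= C / k%:R `^ (2 * alpha).
Proof.
move=> ha; have s1 : 1 < 2 * alpha by rewrite -ltr_pdivrMl// mulr1.
have s0 : 0 <= 2 * alpha by rewrite ltW// (lt_trans ltr01).
have [S [S0 HS]] := sum_powR_bound s1.
exists (1 + S); split; first by rewrite addr_ge0.
move=> n k r N /andP[k0 kn]; have n0 := leq_trans k0 kn.
pose F m : R := (k <= m.*2)%N%:R * ((m.*2)%:R `^ (2 * alpha))^-1.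
have F0 m : 0 <= F m by rewrite mulr_ge0// invr_ge0 powR_ge0.
have kp : 0 < k%:R `^ (2 * alpha) :> R by rewrite powR_gt0// ltr0n.
have : \sum_(0 <= m < N) (m == r %[mod n])%:R * F m <=
       \sum_(0 <= m < N.+1 * n) (m == r %[mod n])%:R * F m.
  rewrite [leRHS](big_cat_nat _ _ (n := N))//=.
    by rewrite lerDl sumr_ge0// => m _; rewrite mulr_ge0.
  by rewrite (leq_trans (leqnSn N))// leq_pmulr.
move=> /le_trans; apply; rewrite sum_residue// big_nat_recl//.
rewrite mulrDl mul1r; apply: lerD.
  rewrite /F mul0n add0n; case: leqP => hk; last by rewrite mul0r invr_ge0 powR_ge0.
  rewrite mul1r lef_pV2 ?posrE//; last by rewrite powR_gt0// ltr0n (leq_trans k0).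
  by rewrite ge0_ler_powR// ?nnegrE ?ler0n// ler_nat.
apply: le_trans (_ : \sum_(0 <= q < N) (q.+1%:R `^ (2 * alpha))^-1 / k%:R `^ (2 * alpha) <= _).
  apply: ler_sum => q _; rewrite /F.
  have hk : (k * q.+1 <= (q.+1 * n + r %% n).*2)%N.
    rewrite -addnn (leq_trans _ (leq_addr _ _))// (leq_trans _ (leq_addr _ _))//.
    by rewrite mulnC leq_mul.
  apply: (@le_trans _ _ ((q.+1 * n + r %% n).*2%:R `^ (2 * alpha))^-1).
    by rewrite ler_piMl ?invr_ge0 ?powR_ge0// lern1 leq_b1.
  rewrite -invfM -powRM ?ler0n// -natrM lef_pV2 ?posrE; last 2 first.
  - by rewrite powR_gt0// ltr0n double_gt0 addn_gt0 muln_gt0 n0.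
  - by rewrite powR_gt0// ltr0n muln_gt0.
  by rewrite ge0_ler_powR// ?nnegrE ?ler0n// ler_nat mulnC.
rewrite -mulr_suml ler_pM2r ?invr_gt0//.
apply: le_trans (HS N.+1).
by rewrite big_add1.
Qed.

Lemma grid_tail_bound alpha : 2^-1 < alpha -> exists C : R, 0 <= C /\
  forall theta n k N, (0 < k <= n)%N ->
  \sum_(i < n) (\sum_(k.+1 <= j < N.+1) theta j * fourier j (grid i)) ^+ 2 <=
  n%:R * (C / k%:R `^ (2 * alpha) *
    \sum_(k.+1 <= j < N.+1) (sobolev_weight alpha j * theta j) ^+ 2).
Proof.
move=> ha; have [C [C0 HC]] := sum_alias_weight ha.
have a0 : 0 <= alpha by rewrite ltW// (lt_trans _ ha)// invr_gt0.
(* One [C] for each of the two residue classes aliased with [j], the frequencies congruent to [j./2]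
   and to its opposite; the factor 2 counts the two indices of each frequency. *)
exists (2 * (C + C)); split; first by rewrite mulr_ge0// addr_ge0.
move=> theta n k N /andP[k0 kn]; have n0 := leq_trans k0 kn.
pose a j : R := sobolev_weight alpha j.
pose c j := `|a j * theta j|.
have agt0 j : (k < j)%N -> 0 < a j.
  by move=> kj; apply: sobolev_weight_gt0; exact: leq_ltn_trans kj.
have -> : \sum_(i < n) (\sum_(k.+1 <= j < N.+1) theta j * fourier j (grid i)) ^+ 2 =
    \sum_(k.+1 <= j < N.+1) \sum_(k.+1 <= l < N.+1) theta j * theta l * gram n j l.
  under eq_bigr => i _.
    rewrite expr2 big_distrlr/=.
    over.
  rewrite exchange_big/=; apply: eq_bigr => j _.
  rewrite exchange_big/=; apply: eq_bigr => l _.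
  by rewrite /gram mulr_sumr; apply: eq_bigr => i _; rewrite mulrACA.
(* Schur's test: 2 c_j c_l / (a_j a_l) <= (c_j / a_l)^2 + (c_l / a_j)^2 *)
pose T j l := c j ^+ 2 * (`|gram n j l| / a l ^+ 2).
apply: (@le_trans _ _ (\sum_(k.+1 <= j < N.+1) \sum_(k.+1 <= l < N.+1) (T j l + T l j) / 2)).
  rewrite big_nat [leRHS]big_nat; apply: ler_sum => j /andP[kj _].
  rewrite big_nat [leRHS]big_nat; apply: ler_sum => l /andP[kl _].
  have aj := agt0 _ kj; have al := agt0 _ kl.
  apply: (le_trans (ler_norm _)).
  rewrite 2!normrM /T (gramC n l j).
  have -> : `|theta j| = c j / a j.
    by rewrite /c normrM (gtr0_norm aj) mulrC mulKf// gt_eqF.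
  have -> : `|theta l| = c l / a l.
    by rewrite /c normrM (gtr0_norm al) mulrC mulKf// gt_eqF.
  rewrite -subr_ge0.
  have -> : (c j ^+ 2 * (`|gram n j l| / a l ^+ 2) + c l ^+ 2 * (`|gram n j l| / a j ^+ 2)) / 2 -
    c j / a j * (c l / a l) * `|gram n j l| = `|gram n j l| / 2 * (c j / a l - c l / a j) ^+ 2.
    by field; rewrite !gt_eqF.
  by rewrite mulr_ge0 ?sqr_ge0// mulr_ge0// invr_ge0.
apply: (@le_trans _ _ (\sum_(k.+1 <= j < N.+1) \sum_(k.+1 <= l < N.+1) T j l)).
  under eq_bigr do rewrite -mulr_suml big_split/=.
  rewrite -mulr_suml big_split/= [X in _ + X]exchange_big/= ler_pdivrMr//.
  by rewrite mulr_natr mulr2n.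
rewrite mulr_sumr mulr_sumr big_nat [leRHS]big_nat; apply: ler_sum => j /andP[kj _].
rewrite -mulr_sumr -/(a j) -(real_normK (num_real (a j * theta j))) -/(c j).
rewrite mulrA mulrC ler_wpM2r ?sqr_ge0//.
have nk0 : 0 <= n%:R :> R by rewrite ler0n.
pose w m : R := (k <= m.*2)%N%:R * ((m.*2)%:R `^ (2 * alpha))^-1.
have w0 m : 0 <= w m by rewrite mulr_ge0// invr_ge0 powR_ge0.
(* A representative of [- j./2] modulo [n], so that the second aliasing condition is a congruence as
   well. *)
pose r2 := (n - j./2 %% n)%N.
have aliasE m : (n %| m + j./2)%N = (m == r2 %[mod n]).
  have jn : (j./2 %% n <= n)%N by rewrite ltnW// ltn_mod.
  rewrite -(eqn_modDr (j./2)) /r2 -(modnDmr (n - _)%N) subnK// modnn.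
  by rewrite /dvdn.
pose F m : R := (m == j./2 %[mod n])%:R * w m + (m == r2 %[mod n])%:R * w m.
have F0 m : 0 <= F m by rewrite addr_ge0// mulr_ge0.
apply: (@le_trans _ _ (\sum_(k.+1 <= l < N.+1) n%:R * F l./2)).
  rewrite big_nat [leRHS]big_nat; apply: ler_sum => l /andP[kl _].
  have -> : F l./2 = ((l./2 == j./2 %[mod n])%:R + (n %| l./2 + j./2)%:R) / a l ^+ 2.
    rewrite /F aliasE -mulrDl; congr (_ * _).
    rewrite /w sobolev_weight_sqr (_ : (k <= _)%N) ?mul1r//.
    by have := odd_double_half l; case: (odd l) => /=; lia.
  rewrite mulrA ler_wpM2r ?invr_ge0 ?sqr_ge0//.
  by apply: gram_bound => //; exact: leq_ltn_trans k0 _.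
rewrite -mulr_sumr -!mulrA ler_wpM2l//.
(* The terms are nonnegative, so the range may be enlarged to one made of complete pairs of indices
   with the same frequency. *)
apply: (@le_trans _ _ (\sum_(0 <= l < N.+1.*2) F l./2)).
  have [hN|hN] := leqP N.+1 k.+1; first by rewrite big_geq// sumr_ge0.
  rewrite [leRHS](big_cat_nat _ _ (n := k.+1))//=; last by lia.
  rewrite ler_wpDl ?sumr_ge0// [leRHS](big_cat_nat _ _ (n := N.+1))//=; last 2 first.
  - exact: ltnW.
  - by lia.
  by rewrite lerDl sumr_ge0.
rewrite sum_half ler_wpM2l// mulrDl big_split/=.
by apply: lerD; apply: HC; rewrite k0.
Qed.

End sobolev_tail.

(** * Sobolev functions and their coefficients *)

Section fourier_integrals.
Context {R : realType}.
Local Notation mu := (@lebesgue_measure R).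
Implicit Types (h f g : R -> R) (v : R).

(** Integrability travels with the value, since additivity of the integral requires it at each
    step. *)
Definition has_int01 h v :=
  mu.-integrable `[0, 1] (EFin \o h) /\ int01 h = v.

Lemma has_int01D h1 h2 v1 v2 : has_int01 h1 v1 -> has_int01 h2 v2 ->
  has_int01 (fun x => h1 x + h2 x) (v1 + v2).
Proof.
move=> [i1 <-] [i2 <-]; split; last by rewrite /int01 RintegralD.
by apply: eq_integrable (integrableD _ i1 i2).
Qed.

Lemma has_int01Z c h v : has_int01 h v -> has_int01 (fun x => c * h x) (c * v).
Proof.
move=> [i <-]; split; last by rewrite /int01 RintegralZl.
by apply: eq_integrable (integrableZl _ c i).
Qed.

Lemma has_int01_sum (I : Type) (s : seq I) (h : I -> R -> R) (v : I -> R) :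
  (forall i, has_int01 (h i) (v i)) ->
  has_int01 (fun x => \sum_(i <- s) h i x) (\sum_(i <- s) v i).
Proof.
move=> H; elim: s => [|i s IH].
  rewrite big_nil; split; last first.
    by rewrite /int01 /Rintegral integral0_eq// => x _; rewrite big_nil.
  by apply: eq_integrable (integrable0 _ _) => // x _ /=; rewrite big_nil.
rewrite big_cons.
rewrite (_ : (fun x => _) = (fun x => h i x + \sum_(j <- s) h j x)); first exact: has_int01D.
by apply/funext => x; rewrite big_cons.
Qed.

Lemma has_int01_FTC h (F : R -> R) : continuous h ->
  (forall x : R, is_derive x 1 F (h x)) -> has_int01 h (F 1 - F 0).
Proof.
move=> ch dF.
have ch' : {within `[0, 1], continuous (h : R -> R^o)} by exact: continuous_subspaceT.
split; first by apply: continuous_compact_integrable => //; exact: segment_compact.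
have cF x : {for x, continuous F}.
  by apply: differentiable_continuous; apply/derivable1_diffP.
rewrite /int01 /Rintegral (continuous_FTC2 (F := F)) ?ltr01//=.
- split.
  + by move=> x _.
  + by apply: cvg_at_right_filter; exact: cF.
  + by apply: cvg_at_left_filter; exact: cF.
- by move=> x _; rewrite derive1E; apply: derive_val.
Qed.

Lemma has_int01_trig b m : has_int01 (trig b m) (~~ b && (m == 0%N))%:R.
Proof.
have [->|m0] := eqVneq m 0%N.
  rewrite andbT; have -> : trig b 0 = cst (~~ b)%:R :> (R -> R).
    by apply/funext => x; rewrite /trig mulr0 mul0r sin0 cos0; case: b.
  have H : has_int01 (cst (~~ b)%:R : R -> R) ((~~ b)%:R * 1 - (~~ b)%:R * 0).
    apply: (has_int01_FTC (F := fun x => (~~ b)%:R * x)).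
      by move=> x; exact: cvg_cst.
    by move=> x; apply: is_derive_eq; rewrite /= [LHS]mulr1.
  by rewrite mulr1 mulr0 subr0 in H.
rewrite andbF.
have c0 : 2 * pi * m%:R != 0 :> R by rewrite !mulf_neq0// ?pnatr_eq0// gt_eqF// pi_gt0.
set c : R := 2 * pi * m%:R.
have dc (x : R) : is_derive x 1 (fun x => c * x) c.
  by apply: is_derive_eq; rewrite /= [LHS]mulr1.
have cc : continuous (fun x : R => c * x).
  by move=> x; apply: cvgM; [exact: cvg_cst|exact: cvg_id].
rewrite [X in has_int01 _ X](_ : _ =
   (if b then - c^-1 * cos (c * 1) else c^-1 * sin (c * 1)) -
   (if b then - c^-1 * cos (c * 0) else c^-1 * sin (c * 0))); last first.
  by rewrite mulr1 mulr0 /c cos_nat2pi sin_nat2pi cos0 sin0 /=; case: b; ring.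
rewrite /trig -/c; case: b.
  apply: (has_int01_FTC (F := fun x => - c^-1 * cos (c * x))).
    by move=> x; apply: (continuous_comp (cc x)); exact: continuous_sin.
  move=> x; apply: is_derive_eq.
  by rewrite -[LHS]/(- c^-1 * (- sin (c * x) * c)); field.
apply: (has_int01_FTC (F := fun x => c^-1 * sin (c * x))).
  by move=> x; apply: (continuous_comp (cc x)); exact: continuous_cos.
move=> x; apply: is_derive_eq.
by rewrite -[LHS]/(c^-1 * (cos (c * x) * c)); field.
Qed.

(** The argument is the one used on the grid, where the condition that [n] divides a frequency
    becomes the condition that the frequency is 0. *)
Lemma has_int01_fourier_mul j j' : (0 < j)%N -> (0 < j')%N ->
  has_int01 (fun x => fourier j x * fourier j' x) (j == j')%:R.
Proof.
wlog jj' : j j' / (j <= j')%N.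
  move=> H j0 j0'; have [|/ltnW] := leqP j j' => jj'; first exact: H.
  by rewrite eq_sym (_ : (fun x => _) = (fun x => fourier j' x * fourier j x));
    [exact: H|apply/funext => x; rewrite mulrC].
move=> j0 j0'.
have [j1|j1] := leqP j 1.
  have -> : j = 1%N by apply/eqP; rewrite eqn_leq j1.
  have [j1'|j1'] := leqP j' 1.
    have -> : j' = 1%N by apply/eqP; rewrite eqn_leq j1'.
    have := has_int01_trig false 0; congr has_int01; apply/funext => x.
    by rewrite !fourier1 /trig mulr0 mul0r cos0 mulr1.
  rewrite (ltn_eqF j1').
  have := has_int01Z (Num.sqrt 2) (has_int01_trig (odd j') j'./2).
  rewrite [j'./2 == 0%N]gtn_eqF ?half_gt0// andbF mulr0.
  by congr has_int01; apply/funext => x; rewrite fourier1 mul1r fourierE.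
have j1' := leq_trans j1 jj'.
have [e [e1 e2 e3 He]] := fourier_mul (R := R) j1 j1'.
rewrite (funext He).
have hj := half_leq jj'; rewrite (maxn_idPr hj) (minn_idPl hj).
rewrite (_ : (j == j')%:R = e.1 * (~~ (odd j != odd j') && (j'./2 - j./2 == 0)%N)%:R +
   e.2 * (~~ (odd j != odd j') && (j./2 + j'./2 == 0)%N)%:R); last first.
  rewrite [(j./2 + _ == _)%N]gtn_eqF; last by rewrite addn_gt0 half_gt0 j1.
  rewrite andbF mulr0 addr0 negbK subn_eq0.
  have -> : (j == j') = (odd j == odd j') && (j'./2 <= j./2)%N.
    apply/eqP/andP => [->//|[/eqP ho h]].
    rewrite -(odd_double_half j) -(odd_double_half j') ho.
    by congr (_ + _.*2)%N; apply/eqP; rewrite eqn_leq hj.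
  by have [ho|ho] := eqVneq (odd j) (odd j'); rewrite /= ?mulr0// e3// mul1r.
apply: (has_int01D (has_int01Z _ (has_int01_trig _ _)) (has_int01Z _ (has_int01_trig _ _))).
Qed.

Lemma has_int01_fourier_sum_mul (theta eta : R^nat) N :
  has_int01 (fun x => fourier_sum theta N x * fourier_sum eta N x)
            (\sum_(1 <= j < N.+1) theta j * eta j).
Proof.
(* Shifting the indices makes all of them positive, so that orthonormality holds for every term as
   [has_int01_sum] requires. *)
rewrite (_ : (fun x => _) = fun x => \sum_(0 <= j < N) \sum_(0 <= l < N)
    theta j.+1 * eta l.+1 * (fourier j.+1 x * fourier l.+1 x)); last first.
  apply/funext => x; rewrite /fourier_sum !big_add1/= big_distrlr/=.
  by apply: eq_bigr => j _; apply: eq_bigr => l _; rewrite mulrACA.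
rewrite big_add1/= (_ : \sum_(0 <= i < N) _ = \sum_(0 <= j < N) \sum_(0 <= l < N)
    theta j.+1 * eta l.+1 * (j.+1 == l.+1)%:R).
  apply: has_int01_sum => j; apply: has_int01_sum => l.
  exact/has_int01Z/has_int01_fourier_mul.
rewrite big_mkord [RHS]big_mkord; apply: eq_bigr => j _.
rewrite big_mkord (bigD1 j)//= eqxx mulr1 big1 ?addr0// => l lj.
by rewrite eqSS eq_sym (negbTE (lj : (l : nat) != j)) mulr0.
Qed.

End fourier_integrals.

(** * Coefficients of Sobolev functions and Parseval's identity *)

Section sobolev_functions.
Context {R : realType}.
Local Notation mu := (@lebesgue_measure R).
Implicit Types (alpha L : R) (f g : R -> R) (theta eta : R^nat).

(** Membership in the class for [alpha > 1/2], in real-valued form: a bound on finite sums in place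
    of an extended real series, with pointwise convergence on the interval. *)
Definition sobolev_coef alpha (Q : R) theta f :=
  (forall N, \sum_(1 <= j < N) (sobolev_weight alpha j * theta j) ^+ 2 <= Q) /\
  (forall x, x \in `[0, 1] -> fourier_sum theta N x @[N --> \oo] --> f x).

Lemma sobolev_coefP alpha L f : 2^-1 < alpha -> sobolev alpha L f ->
  exists Q theta, sobolev_coef alpha Q theta f.
Proof.
move=> ha [_ [theta [HQ _ Hx]]]; exists (L ^+ 2 / pi `^ (2 * alpha)), theta.
split; last exact: Hx.
move=> N; rewrite -lee_fin; apply: le_trans HQ.
rewrite -sumEFin; apply: nneseries_lim_ge => j _.
by rewrite lee_fin sqr_ge0.
Qed.

Lemma normr_fourier_le2 j (x : R) : `|fourier j x| <= 2.
Proof.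
have s2 : Num.sqrt 2 <= 2 :> R.
  by rewrite -[leRHS]gtr0_norm// -sqrtr_sqr ler_sqrt// ?expr2; lra.
rewrite /fourier; case: ifP => _; first by rewrite normr1 ler1n.
case: ifP => _; rewrite normrM (ger0_norm (sqrtr_ge0 _)) -[leRHS]mulr1 ler_pM//.
  exact: sin_max.
exact: cos_max.
Qed.

(** The weight of index 1 is a power of 0 and cannot control the constant mode, which is therefore
    kept apart; all later weights are at least 1. *)
Lemma sobolev_coef_sum alpha Q theta f N : 0 <= alpha -> sobolev_coef alpha Q theta f ->
  \sum_(1 <= j < N) theta j ^+ 2 <= theta 1%N ^+ 2 + Q.
Proof.
move=> a0 [HQ _].
have [N1|N1] := leqP N 1.
  rewrite big_geq// addr_ge0 ?sqr_ge0// (le_trans _ (HQ 0%N))//.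
  by rewrite big_geq.
rewrite big_ltn// lerD2l.
apply: le_trans (HQ N); rewrite [leRHS]big_ltn//.
apply: ler_wpDl; first exact: sqr_ge0.
rewrite big_nat [leRHS]big_nat; apply: ler_sum => j /andP[j1 _].
rewrite exprMn -[leLHS]mul1r ler_wpM2r ?sqr_ge0//.
by have := @sobolev_weight_ge R alpha 1 j a0 j1; rewrite powR1.
Qed.

Lemma sobolev_coef_tail alpha Q theta f k N : 0 <= alpha -> (0 < k)%N ->
  sobolev_coef alpha Q theta f ->
  \sum_(k.+1 <= j < N) theta j ^+ 2 <= Q / k%:R `^ (2 * alpha).
Proof.
move=> a0 k0 [HQ _]; have kp : 0 < k%:R `^ (2 * alpha) :> R by rewrite powR_gt0// ltr0n.
rewrite ler_pdivlMr// mulr_suml.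
have [Nk|Nk] := leqP N k.+1.
  by rewrite big_geq// (le_trans _ (HQ 0%N))// big_geq.
apply: le_trans (HQ N); rewrite [leRHS](big_cat_nat _ _ (n := k.+1)) ?(ltnW Nk)//=.
apply: ler_wpDl; first by rewrite sumr_ge0// => j _; exact: sqr_ge0.
rewrite big_nat [leRHS]big_nat; apply: ler_sum => j /andP[kj _].
by rewrite exprMn mulrC ler_wpM2r ?sqr_ge0// sobolev_weight_ge.
Qed.

(** With [a] the weight, [|theta_j| <= (a theta_j)^2 + a^-2]. The first terms sum to at most [Q],
    and the second ones converge because [2 alpha > 1]. *)
Lemma sobolev_coef_summable alpha Q theta f : 2^-1 < alpha ->
  sobolev_coef alpha Q theta f ->
  exists S : R, forall N, \sum_(1 <= j < N) `|theta j| <= S.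
Proof.
move=> ha [HQ _].
have s1 : 1 < 2 * alpha by rewrite -ltr_pdivrMl// mulr1.
have s0 : 0 <= 2 * alpha by rewrite ltW// (lt_trans ltr01).
have [S [S0 HS]] := sum_powR_bound s1.
have Q0 : 0 <= Q by rewrite (le_trans _ (HQ 0%N))// big_geq.
exists (`|theta 1%N| + (Q + 2 * S)) => N.
have [N1|N1] := leqP N 1.
  by rewrite big_geq// addr_ge0// addr_ge0// mulr_ge0.
rewrite big_ltn// lerD2l.
apply: (@le_trans _ _ (\sum_(2 <= j < N)
    ((sobolev_weight alpha j * theta j) ^+ 2 + (sobolev_weight alpha j ^+ 2)^-1))).
  rewrite big_nat [leRHS]big_nat; apply: ler_sum => j /andP[j1 _].
  have aj : 0 < sobolev_weight alpha j :> R := sobolev_weight_gt0 alpha j1.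
  set a := sobolev_weight alpha j in aj *.
  have -> : `|theta j| = `|a * theta j| / a.
    by rewrite normrM (gtr0_norm aj) mulrC mulKf// gt_eqF.
  rewrite -(real_normK (num_real (a * theta j))) -exprVn.
  have := sqr_ge0 (`|a * theta j| - a^-1).
  have : 0 <= `|a * theta j| / a by rewrite mulr_ge0// invr_ge0 ltW.
  nra.
rewrite big_split/=; apply: lerD.
  apply: le_trans (HQ N); rewrite [leRHS]big_ltn//.
  by apply: ler_wpDl; first exact: sqr_ge0.
pose F m : R := ((m.*2)%:R `^ (2 * alpha))^-1.
apply: (@le_trans _ _ (\sum_(2 <= j < N.*2) F j./2)).
  rewrite [leRHS](big_cat_nat _ _ (n := N))//=; last by lia.
  under eq_bigr do rewrite sobolev_weight_sqr.
  by rewrite lerDl sumr_ge0// => j _; rewrite invr_ge0 powR_ge0.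
have -> : \sum_(2 <= j < N.*2) F j./2 = 2 * \sum_(1 <= m < N) F m.
  have := sum_half N F; rewrite [X in X = _](big_cat_nat _ _ (n := 2))//=; last by lia.
  rewrite [X in _ = _ * X](big_cat_nat _ _ (n := 1))//=; last by lia.
  rewrite big_nat_recr//= !big_nat1 mulrDr mulr2n => h.
  lra.
rewrite ler_wpM2l//; apply: le_trans (HS N).
rewrite big_nat [leRHS]big_nat; apply: ler_sum => m /andP[m0 _].
rewrite /F lef_pV2 ?posrE ?powR_gt0 ?ltr0n ?double_gt0//.
by rewrite ge0_ler_powR ?nnegrE ?ler0n// ler_nat -addnn leq_addr.
Qed.

Lemma sobolev_coef_bounded alpha Q theta f : 2^-1 < alpha ->
  sobolev_coef alpha Q theta f ->
  exists M : R, forall N x, `|fourier_sum theta N x| <= M.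
Proof.
move=> ha H; have [S HS] := sobolev_coef_summable ha H.
exists (S * 2) => N x; apply: le_trans (ler_norm_sum _ _ _) _.
apply: (@le_trans _ _ (\sum_(1 <= j < N.+1) `|theta j| * 2)).
  by apply: ler_sum => j _; rewrite normrM ler_wpM2l// normr_fourier_le2.
by rewrite -mulr_suml ler_wpM2r.
Qed.

Lemma continuous_fourier_sum theta N : continuous (fourier_sum theta N).
Proof.
have cf j : continuous (@fourier R j).
  rewrite /fourier; case: (j == 1%N); first by move=> x; exact: cvg_cst.
  have cc (c : R) : continuous (fun x : R => c * x).
    by move=> x; apply: cvgM; [exact: cvg_cst|exact: cvg_id].
  case: (odd j) => x; (apply: cvgM; first exact: cvg_cst);
    apply: (continuous_comp (cc _ x)); [exact: continuous_sin|exact: continuous_cos].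
rewrite /fourier_sum; elim: (index_iota _ _) => [|j s IH].
  by under eq_fun do rewrite big_nil; move=> x; exact: cvg_cst.
under eq_fun do rewrite big_cons.
by move=> x; apply: cvgD; [apply: cvgM; [exact: cvg_cst|exact: cf]|exact: IH].
Qed.

(** The integrals of products of partial sums are exact by orthonormality. These products converge
    pointwise and are uniformly bounded by absolute summability of the coefficients, so dominated
    convergence applies. *)
Lemma parseval alpha Q Q' theta eta f g : 2^-1 < alpha ->
  measurable_fun (`[0, 1]%classic : set R) f ->
  measurable_fun (`[0, 1]%classic : set R) g ->
  sobolev_coef alpha Q theta f -> sobolev_coef alpha Q' eta g ->
  \sum_(1 <= j < N.+1) theta j * eta j @[N --> \oo] --> int01 (fun x => f x * g x).
Proof.
move=> ha mf mg Hf Hg.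
have [M HM] := sobolev_coef_bounded ha Hf.
have [M' HM'] := sobolev_coef_bounded ha Hg.
have M0 : 0 <= M by rewrite (le_trans _ (HM 0%N 0)).
pose p N x := fourier_sum theta N x * fourier_sum eta N x.
have cp N : continuous (p N).
  by move=> x; apply: cvgM; exact: continuous_fourier_sum.
have m01 : measurable (`[0, 1]%classic : set (measurableTypeR R)) by exact: measurable_itv.
pose D : set (measurableTypeR R) := `[0, 1]%classic.
have mp N : measurable_fun D (fun x => (p N x)%:E).
  apply/measurable_EFinP/measurable_funTS.
  exact: (continuous_measurable_fun (cp N)).
have mfg : measurable_fun D (fun x => (f x * g x)%:E).
  by apply/measurable_EFinP; exact: measurable_funM.
have cvp : {ae mu, forall x, D x -> (p N x)%:E @[N --> \oo] --> (f x * g x)%:E}.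
  apply: aeW => x Dx; apply: cvg_EFin; first exact: nearW.
  by apply: cvgM; [exact: Hf.2|exact: Hg.2].
have ic : mu.-integrable D (cst (M * M')%:E).
  apply: eq_integrable (continuous_compact_integrable (f := cst (M * M')) _ _) => //.
    exact: segment_compact.
  by apply: continuous_subspaceT => x; exact: cvg_cst.
have dom : {ae mu, forall x N, D x -> (`|(p N x)%:E| <= cst (M * M')%:E x)%E}.
  by apply: aeW => x N _; rewrite /= lee_fin normrM ler_pM.
have [ifg _ H] := dominated_convergence m01 mp mfg cvp ic dom.
have E N : (\int[mu]_(x in D) (p N x)%:E = (\sum_(1 <= j < N.+1) theta j * eta j)%:E)%E.
  have [ip <-] := has_int01_fourier_sum_mul theta eta N.
  by rewrite /int01 /Rintegral fineK//; exact: integrable_fin_num.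
rewrite /int01 /Rintegral.
have fin : (\int[mu]_(x in D) (f x * g x)%:E)%E \is a fin_num.
  exact: integrable_fin_num.
rewrite -(fineK fin) in H; move/fine_cvgP : H => [_].
rewrite (_ : fine \o _ = fun N => \sum_(1 <= j < N.+1) theta j * eta j)//.
by apply/funext => N /=; rewrite E.
Qed.

End sobolev_functions.

(** * Discrete Fourier coefficients and the bias *)

Section grid_coefficients.
Context {R : realType}.
Implicit Types (alpha : R) (f g r : R -> R) (theta eta : R^nat) (n k N : nat).

Definition gcoef n r j : R := (\sum_(i < n) r (grid i) * fourier j (grid i)) / n%:R.

Definition gnorm2 n r : R := (\sum_(i < n) r (grid i) ^+ 2) / n%:R.

(** Nothing is aliased among the first [k] indices, so the grid recovers the coefficients of such a
    trigonometric polynomial exactly. *)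
Lemma gcoef_fourier_sum n k theta j : (0 < j <= k)%N ->
  (k <= if odd n then n else n.-1)%N ->
  gcoef n (fourier_sum theta k) j = theta j.
Proof.
move=> /andP[j0 jk] kn.
have n0 : (0 < n)%N.
  by case: (n) kn => //=; rewrite leqn0 => /eqP k0; move: jk; rewrite k0 leqNgt j0.
have n0' : n%:R != 0 :> R by rewrite pnatr_eq0 -lt0n.
have -> : gcoef n (fourier_sum theta k) j =
    (\sum_(1 <= l < k.+1) theta l * gram n l j) / n%:R.
  rewrite /gcoef; congr (_ / _).
  under eq_bigr do rewrite mulr_suml.
  rewrite exchange_big/=; apply: eq_bigr => l _.
  by rewrite /gram mulr_sumr; apply: eq_bigr => i _; rewrite mulrA.
rewrite (bigD1_seq j) ?iota_uniq ?mem_index_iota ?j0//=.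
rewrite gram_orthonormal// ?(leq_trans jk)// eqxx mulr1 big_nat_cond big1 ?addr0 ?mulfK//.
move=> l /andP[/andP[l0 lk] lj]; rewrite gram_orthonormal// ?(leq_trans jk)//.
  by rewrite (negbTE lj) !mulr0.
exact: leq_trans kn.
Qed.

Lemma gcoefB n f r j : gcoef n f j = gcoef n (fun x => f x - r x) j + gcoef n r j.
Proof.
rewrite /gcoef -mulrDl -big_split/=; congr (_ / _).
by apply: eq_bigr => i _; rewrite mulrBl subrK.
Qed.

Lemma gcoef_bessel n k r : (0 < n)%N -> (k <= if odd n then n else n.-1)%N ->
  \sum_(1 <= j < k.+1) gcoef n r j ^+ 2 <= gnorm2 n r.
Proof.
move=> n0 kn; have n0' : n%:R != 0 :> R by rewrite pnatr_eq0 -lt0n.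
have gK h j : n%:R * gcoef n h j = \sum_(i < n) h (grid i) * fourier j (grid i).
  by rewrite /gcoef mulrC divfK.
(* [s] is the orthogonal projection of [r] on the grid: its inner products with [r] and with itself
   both equal [n B], and the squared norm of [r - s] is nonnegative. *)
pose s := fourier_sum (gcoef n r) k.
set B := \sum_(1 <= j < _) _.
have rsE : \sum_(i < n) r (grid i) * s (grid i) = n%:R * B.
  rewrite /s /B; under eq_bigr do rewrite mulr_sumr.
  rewrite exchange_big/= mulr_sumr; apply: eq_bigr => j _.
  rewrite expr2 mulrA gK mulr_suml; apply: eq_bigr => i _; ring.
have ssE : \sum_(i < n) s (grid i) * s (grid i) = n%:R * B.
  rewrite /B mulr_sumr {2}/s; under eq_bigr do rewrite mulr_sumr.
  rewrite exchange_big/=; apply: eq_big_nat => j /andP[j0 jk].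
  have := @gcoef_fourier_sum n k (gcoef n r) j.
  rewrite j0 -ltnS jk => /(_ isT kn) => E.
  rewrite [RHS](_ : _ = n%:R * gcoef n s j * gcoef n r j); last first.
    by rewrite E expr2 mulrA.
  by rewrite gK mulr_suml; apply: eq_bigr => i _; ring.
have : 0 <= \sum_(i < n) (r (grid i) - s (grid i)) ^+ 2.
  by apply: sumr_ge0 => i _; exact: sqr_ge0.
have -> : \sum_(i < n) (r (grid i) - s (grid i)) ^+ 2 =
    \sum_(i < n) r (grid i) ^+ 2 - 2 * \sum_(i < n) r (grid i) * s (grid i)
    + \sum_(i < n) s (grid i) * s (grid i).
  rewrite mulr_sumr -sumrB -big_split/=.
  by apply: eq_bigr => i _; ring.
rewrite rsE ssE => h.
rewrite /gnorm2 ler_pdivlMr ?ltr0n//; lra.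
Qed.

Lemma grid_in01 n (i : 'I_n) : (grid i : R) \in `[0, 1].
Proof.
have n0 : (0 < n)%N := leq_ltn_trans (leq0n _) (ltn_ord i).
rewrite in_itv/= /grid divr_ge0//= ler_pdivrMr ?ltr0n// mul1r ler_nat.
exact: ltn_ord.
Qed.

(** At fixed [n] there are finitely many grid points, so the bound on finite tails passes to the
    pointwise limit. The constant depends only on [alpha]. *)
Lemma gnorm2_tail alpha : 2^-1 < alpha -> exists C : R, 0 <= C /\
  forall Q theta f n k, sobolev_coef alpha Q theta f -> (0 < k <= n)%N ->
  gnorm2 n (fun x => f x - fourier_sum theta k x) <= C * Q / k%:R `^ (2 * alpha).
Proof.
move=> ha; have [C [C0 HC]] := @grid_tail_bound R alpha ha.
exists C; split=> // Q theta f n k H /andP[k0 kn].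
have n0 := leq_trans k0 kn.
have Q0 : 0 <= Q by rewrite (le_trans _ (H.1 0%N))// big_geq.
have kp : 0 < k%:R `^ (2 * alpha) :> R by rewrite powR_gt0// ltr0n.
pose u N : R := \sum_(i < n) (fourier_sum theta N (grid i) - fourier_sum theta k (grid i)) ^+ 2.
have cu : u N @[N --> \oo] --> \sum_(i < n) (f (grid i) - fourier_sum theta k (grid i)) ^+ 2.
  rewrite /u; elim: (index_enum _) => [|i s IH].
    by under eq_fun do rewrite big_nil; rewrite big_nil; exact: cvg_cst.
  under eq_fun do rewrite big_cons; rewrite big_cons.
  apply: cvgD => //.
  have ci : fourier_sum theta N (grid i) - fourier_sum theta k (grid i) @[N --> \oo]
      --> f (grid i) - fourier_sum theta k (grid i).
    by apply: cvgB; [exact: H.2 (grid_in01 i)|exact: cvg_cst].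
  by rewrite expr2; under eq_fun do rewrite expr2; exact: cvgM.
rewrite /gnorm2 ler_pdivrMr ?ltr0n//.
apply: (cvgr_to_le cu); near=> N.
have kN : (k <= N)%N by near: N; exists k.
have -> : u N = \sum_(i < n) (\sum_(k.+1 <= j < N.+1) theta j * fourier j (grid i)) ^+ 2.
  apply: eq_bigr => i _; congr (_ ^+ 2).
  by rewrite /fourier_sum (big_cat_nat _ _ (n := k.+1))//= addrAC subrr add0r.
apply: le_trans (HC theta n k N _) _; first by rewrite k0.
rewrite mulrC ler_wpM2r// -mulrA -[leRHS]mulrA [Q / _]mulrC ler_wpM2l//.
rewrite ler_wpM2l ?invr_ge0 ?(ltW kp)//.
apply: le_trans (H.1 N.+1); rewrite [leRHS](big_cat_nat _ _ (n := k.+1))//=.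
by rewrite lerDr sumr_ge0// => j _; exact: sqr_ge0.
Unshelve. all: end_near. Qed.

(** Each discrete coefficient is the true one plus an aliasing error, [rho] for [f] and [tau] for
    [g], whose squared norms are [O(k^(-2 alpha))] by Bessel. The product of true coefficients gives
    a truncated Parseval sum; the terms mixing a true coefficient with an error dominate and fix the
    rate. *)
Lemma gcoef_bias alpha Q Q' theta eta f g : 2^-1 < alpha ->
  measurable_fun (`[0, 1]%classic : set R) f ->
  measurable_fun (`[0, 1]%classic : set R) g ->
  sobolev_coef alpha Q theta f -> sobolev_coef alpha Q' eta g ->
  exists C : R, 0 <= C /\ forall n k, (0 < k <= if odd n then n else n.-1)%N ->
  `|\sum_(1 <= j < k.+1) gcoef n g j * gcoef n f j - int01 (fun x => f x * g x)|
   <= C / k%:R `^ alpha.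
Proof.
move=> ha mf mg Hf Hg.
have a0 : 0 <= alpha by rewrite ltW// (lt_trans _ ha)// invr_gt0.
have [C [C0 HC]] := gnorm2_tail ha.
have Q0 : 0 <= Q by rewrite (le_trans _ (Hf.1 0%N))// big_geq.
have Q0' : 0 <= Q' by rewrite (le_trans _ (Hg.1 0%N))// big_geq.
have par := parseval ha mf mg Hf Hg.
pose A := theta 1%N ^+ 2 + Q; pose A' := eta 1%N ^+ 2 + Q'.
have A0 : 0 <= A by rewrite addr_ge0 ?sqr_ge0.
have A0' : 0 <= A' by rewrite addr_ge0 ?sqr_ge0.
(* [A] and [A'] bound the squared norms of the true coefficients. [C * Q] and [C * Q'] occur twice,
   for the mixed terms and for the product of the two errors; [Q + Q'] pays for the truncation of
   Parseval's sum. *)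
exists (A + A' + C * Q + C * Q' + C * Q + C * Q' + Q + Q'); split.
  by have := mulr_ge0 C0 Q0; have := mulr_ge0 C0 Q0'; lra.
move=> n k /andP[k0 kn].
have n0 : (0 < n)%N.
  by case: (n) kn => //=; rewrite leqn0 => /eqP k0'; rewrite k0' in k0.
have kn' : (0 < k <= n)%N.
  by rewrite k0 (leq_trans kn)//; case: ifP => // _; exact: leq_pred.
set K := k%:R `^ alpha.
have K1 : 1 <= K.
  have : (1 : R) `^ alpha <= K by rewrite ge0_ler_powR ?nnegrE ?ler1n.
  by rewrite powR1.
have K2 : k%:R `^ (2 * alpha) = K ^+ 2.
  by rewrite /K -powR_mulrn ?powR_ge0// -powRrM mulrC.
have Kp : 0 < K := lt_le_trans ltr01 K1.
set I := int01 _.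
pose rho j := gcoef n (fun x => f x - fourier_sum theta k x) j.
pose tau j := gcoef n (fun x => g x - fourier_sum eta k x) j.
pose S := \sum_(1 <= j < k.+1) theta j * eta j.
have Hrho : \sum_(1 <= j < k.+1) rho j ^+ 2 <= C * Q / K ^+ 2.
  by apply: le_trans (gcoef_bessel _ n0 kn) _; rewrite -K2; exact: HC.
have Htau : \sum_(1 <= j < k.+1) tau j ^+ 2 <= C * Q' / K ^+ 2.
  by apply: le_trans (gcoef_bessel _ n0 kn) _; rewrite -K2; exact: HC.
have HS : `|S - I| <= (Q + Q') / K.
  have cS : `|S - \sum_(1 <= j < N.+1) theta j * eta j| @[N --> \oo] --> `|S - I|.
    by apply: cvg_norm; apply: cvgB => //; exact: cvg_cst.
  apply: (cvgr_to_le cS); near=> N.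
  have kN : (k <= N)%N by near: N; exists k.
  rewrite /S [X in _ - X](big_cat_nat _ _ (n := k.+1))//= opprD addrA subrr add0r normrN.
  apply: le_trans (ler_norm_sum _ _ _) _.
  apply: (@le_trans _ _ (\sum_(k.+1 <= j < N.+1) (theta j ^+ 2 + eta j ^+ 2))).
    apply: ler_sum => j _; rewrite ler_norml.
    have := sqr_ge0 (theta j + eta j); have := sqr_ge0 (theta j - eta j).
    by move=> h1 h2; apply/andP; split; nra.
  rewrite big_split/= mulrDl.
  have KK : K <= K ^+ 2 by rewrite expr2 ler_peMl// ltW.
  apply: lerD.
    apply: (le_trans (sobolev_coef_tail _ a0 k0 Hf)).
    by rewrite K2 ler_wpM2l// lef_pV2 ?posrE// exprn_gt0.
  apply: (le_trans (sobolev_coef_tail _ a0 k0 Hg)).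
  by rewrite K2 ler_wpM2l// lef_pV2 ?posrE// exprn_gt0.
have -> : \sum_(1 <= j < k.+1) gcoef n g j * gcoef n f j - I =
  \sum_(1 <= j < k.+1) (tau j * theta j + eta j * rho j + tau j * rho j) + (S - I).
  rewrite addrA; congr (_ - _); rewrite /S -big_split/=.
  apply: eq_big_nat => j /andP[j0 jk].
  have jk' : (0 < j <= k)%N by rewrite j0 -ltnS.
  rewrite (gcoefB n g (fourier_sum eta k)) (gcoefB n f (fourier_sum theta k)).
  rewrite !gcoef_fourier_sum// -/(rho j) -/(tau j); ring.
apply: le_trans (ler_normD _ _) _.
apply: le_trans (lerD _ HS) _; last first.
  rewrite (_ : A + A' + C * Q + C * Q' + C * Q + C * Q' + Q + Q' =
    (A + A' + C * Q + C * Q' + C * Q + C * Q') + (Q + Q')); last by ring.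
  rewrite [leRHS]mulrDl; apply: lerD (lexx _); exact: lexx.
apply: le_trans (ler_norm_sum _ _ _) _.
apply: (@le_trans _ _ (\sum_(1 <= j < k.+1)
   (theta j ^+ 2 / K + eta j ^+ 2 / K + K * tau j ^+ 2 + K * rho j ^+ 2 +
     (K * tau j ^+ 2 + K * rho j ^+ 2)))).
  (* The weight [K] balances a bounded square against an error of squared norm [O(K^-2)], so that
     both sides become [O(1 / K)]. *)
  have amgm (a b : R) : `|a * b| <= b ^+ 2 / K + K * a ^+ 2.
    have e : (b ^+ 2 / K + K * a ^+ 2) = (b / K - a) ^+ 2 * K + 2 * (a * b).
      by field; rewrite gt_eqF.
    have e' : (b ^+ 2 / K + K * a ^+ 2) = (b / K + a) ^+ 2 * K - 2 * (a * b).
      by field; rewrite gt_eqF.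
    have h1 : 0 <= (b / K - a) ^+ 2 * K by rewrite mulr_ge0 ?sqr_ge0 ?ltW.
    have h2 : 0 <= (b / K + a) ^+ 2 * K by rewrite mulr_ge0 ?sqr_ge0 ?ltW.
    by rewrite ler_norml; apply/andP; split; lra.
  apply: ler_sum => j _.
  apply: le_trans (ler_normD _ _) _; apply: lerD; last first.
    apply: le_trans (amgm _ _) _; rewrite addrC lerD2l mulrC ler_wpM2r ?sqr_ge0//.
    by rewrite invf_ple ?posrE// (le_trans _ K1)// invf_le1.
  apply: le_trans (ler_normD _ _) _.
  rewrite [eta j * _]mulrC.
  apply: le_trans (lerD (amgm _ _) (amgm _ _)) _.
  by rewrite le_eqVlt; apply/orP; left; apply/eqP; ring.
rewrite !big_split/= -!mulr_suml -!mulr_sumr.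
have h1 := sobolev_coef_sum k.+1 a0 Hf; have h2 := sobolev_coef_sum k.+1 a0 Hg.
have KQ c : K * (c / K ^+ 2) = c / K by field; rewrite gt_eqF.
have h3 : K * \sum_(1 <= j < k.+1) rho j ^+ 2 <= C * Q / K by rewrite -KQ ler_pM2l.
have h4 : K * \sum_(1 <= j < k.+1) tau j ^+ 2 <= C * Q' / K by rewrite -KQ ler_pM2l.
have h5 : (\sum_(1 <= j < k.+1) theta j ^+ 2) / K <= A / K by rewrite ler_pM2r ?invr_gt0.
have h6 : (\sum_(1 <= j < k.+1) eta j ^+ 2) / K <= A' / K by rewrite ler_pM2r ?invr_gt0.
clear h1 h2; clearbody A A'; rewrite !mulrDl; lra.
Unshelve. all: end_near. Qed.

End grid_coefficients.

(** * Projection, posterior and noise *)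

Section projection.
Context {R : realType}.
Variables (n k : nat).
Hypothesis n0 : (0 < n)%N.
Hypothesis kn : (k <= if odd n then n else n.-1)%N.
Implicit Types (f g : R -> R) (y : 'cV[R]_n).

Let n0' : n%:R != 0 :> R. Proof. by rewrite pnatr_eq0 -lt0n. Qed.

Lemma design_gram : (design n k)^T *m design n k = (n%:R%:M : 'M[R]_k).
Proof.
apply/matrixP => j l; rewrite !mxE.
transitivity (gram n j.+1 l.+1 : R).
  by apply: eq_bigr => i _; rewrite !mxE.
rewrite gram_orthonormal ?(leq_trans _ kn)// eqSS.
by rewrite -[(j == l)%N]/(j == l) mulr_natr.
Qed.

Lemma hat_mxE : hat_mx n k = n%:R^-1 *: (design n k *m (design n k)^T) :> 'M[R]_n.
Proof.
rewrite /hat_mx design_gram invmx_scalar mul_mx_scalar.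
by rewrite -scalemxAl.
Qed.

Lemma hat_mx_idem : hat_mx n k *m hat_mx n k = hat_mx n k :> 'M[R]_n.
Proof.
rewrite hat_mxE -scalemxAl -scalemxAr mulmxA -(mulmxA (design n k)) design_gram.
by rewrite mul_mx_scalar -scalemxAl !scalerA; congr (_ *: _); field.
Qed.

Lemma hat_mx_tr : (hat_mx n k)^T = hat_mx n k :> 'M[R]_n.
Proof. by rewrite hat_mxE linearZ/= trmx_mul trmxK. Qed.

Lemma weights_design g (j : 'I_k) : (weights g n *m design n k) 0 j = gcoef n g j.+1.
Proof.
by rewrite mxE /gcoef mulr_suml; apply: eq_bigr => i _; rewrite !mxE mulrAC.
Qed.

Lemma projected_functionalE g y : projected_functional g k y =
  \sum_(j < k) gcoef n g j.+1 * (((design n k)^T *m y) j 0 / n%:R).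
Proof.
rewrite /projected_functional hat_mxE -scalemxAl -scalemxAr !mulmxA -!mulmxA mulmxA mxE mxE.
rewrite mulr_sumr; apply: eq_bigr => j _.
by rewrite weights_design; ring.
Qed.

Lemma projected_functional_samples g f : projected_functional g k (samples f n) =
  \sum_(1 <= j < k.+1) gcoef n g j * gcoef n f j.
Proof.
rewrite projected_functionalE big_add1/= big_mkord; apply: eq_bigr => j _.
rewrite mxE {2}/gcoef; congr (_ * (_ / _)).
by apply: eq_bigr => i _; rewrite !mxE mulrC.
Qed.

Lemma variance_factorE g : variance_factor g n k =
  projected_functional g k (samples g n) / n%:R.
Proof.
rewrite /variance_factor /projected_functional mulmxA.
have -> : (weights g n)^T = n%:R^-1 *: samples g n.
  by apply/matrixP => i j; rewrite !mxE mulrC.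
by rewrite -scalemxAr mxE mulrC.
Qed.

(** The hat matrix is symmetric and idempotent. In this form the factor is the sum of squares of the
    coefficients that [GY_phi] puts on the noise. *)
Lemma variance_factor_sqr g : variance_factor g n k =
  \sum_(i < n) ((weights g n *m hat_mx n k) 0 i) ^+ 2.
Proof.
rewrite /variance_factor -[in LHS]hat_mx_idem -{2}hat_mx_tr mulmxA -mulmxA -trmx_mul mxE.
by apply: eq_bigr => i _; rewrite expr2 [(_^T) i 0]mxE.
Qed.

Lemma variance_factor_ge0 g : 0 <= variance_factor g n k.
Proof. by rewrite variance_factor_sqr sumr_ge0// => i _; exact: sqr_ge0. Qed.

Lemma variance_factor_gcoef g : n%:R * variance_factor g n k =
  \sum_(1 <= j < k.+1) gcoef n g j ^+ 2.
Proof. by rewrite variance_factorE projected_functional_samples mulrC divfK. Qed.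

End projection.

Lemma sum_mul_sqr_le (R : realFieldType) (I : Type) (s : seq I) (x y : I -> R) :
  (\sum_(i <- s) x i * y i) ^+ 2 <=
  (\sum_(i <- s) x i ^+ 2) * (\sum_(i <- s) y i ^+ 2).
Proof.
set P := \sum_(i <- s) x i * y i; set X := \sum_(i <- s) x i ^+ 2.
set Y := \sum_(i <- s) y i ^+ 2.
have H (a b : R) : 0 <= a ^+ 2 * X + 2 * (a * b) * P + b ^+ 2 * Y.
  rewrite /X /P /Y !mulr_sumr -!big_split/= sumr_ge0// => i _.
  suff -> : a ^+ 2 * x i ^+ 2 + 2 * (a * b) * (x i * y i) + b ^+ 2 * y i ^+ 2 =
    (a * x i + b * y i) ^+ 2 by exact: sqr_ge0.
  ring.
have X0 : 0 <= X by rewrite sumr_ge0// => i _; exact: sqr_ge0.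
have Y0 : 0 <= Y by rewrite sumr_ge0// => i _; exact: sqr_ge0.
have [X00|Xn0] := eqVneq X 0.
  have [->|P0] := eqVneq P 0; first by rewrite expr0n mulr_ge0.
  (* With [X = 0] and [P] nonzero, this choice makes the quadratic form equal to [- Y - 2], which is
     negative. *)
  have := H (- (Y + 1) / P) 1; rewrite X00 mulr0 add0r expr1n mul1r mulr1.
  by rewrite -mulrA divfK//; lra.
(* At this point the form equals [X * (X * Y - P ^+ 2)]. *)
have := H P (- X).
have : 0 < X by rewrite lt_neqAle eq_sym Xn0.
move=> Xp h; rewrite -(ler_pM2l Xp); nra.
Qed.

(** Cauchy-Schwarz for the discrete coefficients, then Bessel for those of [f]. It controls the mean
    of [GY_phi] relative to its standard deviation, however small the latter is. *)
Lemma projected_functional_samples_le (R : realType) n k (f g : R -> R) (M : R) :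
  (0 < n)%N -> (k <= if odd n then n else n.-1)%N ->
  (forall x, x \in `[0, 1] -> `|f x| <= M) ->
  projected_functional g k (samples f n) ^+ 2 <= n%:R * variance_factor g n k * M ^+ 2.
Proof.
move=> n0 kn fM; rewrite projected_functional_samples// variance_factor_gcoef//.
apply: le_trans (sum_mul_sqr_le _ _ _) _.
rewrite ler_wpM2l ?sumr_ge0// => [j _|]; first exact: sqr_ge0.
apply: le_trans (gcoef_bessel _ n0 kn) _.
rewrite /gnorm2 ler_pdivrMr ?ltr0n// mulr_natr -[n in leRHS]card_ord -sumr_const.
apply: ler_sum => i _; rewrite -(real_normK (num_real (f _))) ler_sqr ?nnegrE//.
  exact/fM/grid_in01.
exact: le_trans (normr_ge0 _) (fM _ (grid_in01 i)).
Qed.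

(** * The conjugate posterior *)

Section posterior_law.
Context {R : realType}.
Variables (n k : nat).
Hypothesis n0 : (0 < n)%N.
Hypothesis kn : (k <= if odd n then n else n.-1)%N.
Variables (sigma gamma : R) (g : R -> R) (y : 'cV[R]_n).
Hypothesis sigma_gt0 : 0 < sigma.
Hypothesis gamma_gt0 : 0 < gamma.

Let n0' : n%:R != 0 :> R. Proof. by rewrite pnatr_eq0 -lt0n. Qed.

Definition shrinkage : R := n%:R * gamma / (sigma ^+ 2 + n%:R * gamma).

Let b (j : 'I_k) : R := ((design n k)^T *m y) j 0 / sigma ^+ 2.

Let C0 : R := \prod_(i < n) (normal_peak sigma * expR (- (y i 0) ^+ 2 / (sigma ^+ 2 *+ 2))).

(** Since [Phi^T Phi = n I], the quadratic part in [theta] has no cross terms and the likelihood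
    splits over coordinates, with precision [n / sigma^2] and linear term [Phi^T y / sigma^2]. [C0]
    gathers what depends on [y] alone. *)
Lemma likelihood_design t : likelihood sigma y (design_tuple n t) =
  C0 * tilts (n%:R / sigma ^+ 2) b t.
Proof.
have s0 : sigma != 0 by rewrite gt_eqF.
rewrite /likelihood /C0.
under eq_bigr do rewrite normal_pdfE//.
rewrite !big_split/= -mulrA; congr (_ * _).
rewrite /tilts /tilt /normal_fun -!expR_sum -expRD; congr expR.
pose v i : R := (design n k *m cvec t) i 0.
have vE i : tnth (design_tuple n t) i = v i by rewrite tnth_mktuple.
have vv : \sum_(i < n) v i ^+ 2 = n%:R * \sum_(j < k) tnth t j ^+ 2.
  transitivity (((design n k *m cvec t)^T *m (design n k *m cvec t)) 0 0).
    by rewrite mxE; apply: eq_bigr => i _; rewrite [_^T _ _]mxE expr2.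
  rewrite trmx_mul mulmxA -(mulmxA (cvec t)^T) design_gram// mul_mx_scalar.
  rewrite -scalemxAl mxE mxE; congr (_ * _).
  by apply: eq_bigr => j _; rewrite !mxE expr2.
have yv : \sum_(i < n) y i 0 * v i = \sum_(j < k) tnth t j * ((design n k)^T *m y) j 0.
  transitivity (((design n k *m cvec t)^T *m y) 0 0).
    by rewrite mxE; apply: eq_bigr => i _; rewrite [_^T _ _]mxE mulrC.
  rewrite trmx_mul -mulmxA mxE; apply: eq_bigr => j _; congr (_ * _).
  by rewrite !mxE.
transitivity (\sum_(i < n) - (y i 0) ^+ 2 / (sigma ^+ 2 *+ 2) +
   (sigma ^+ 2)^-1 * (\sum_(i < n) y i 0 * v i) - (sigma ^+ 2 *+ 2)^-1 * \sum_(i < n) v i ^+ 2).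
  rewrite !mulr_sumr -sumrN -!big_split/=; apply: eq_bigr => i _.
  by rewrite vE; field.
rewrite vv yv -addrA; congr (_ + _).
rewrite !mulr_sumr -sumrN -!big_split/=; apply: eq_bigr => j _.
by rewrite /b; field.
Qed.

Let C0_gt0 : 0 < C0.
Proof.
apply: prodr_gt0 => i _; rewrite mulr_gt0 ?expR_gt0// normal_peak_gt0//.
by rewrite gt_eqF.
Qed.

Lemma measurable_likelihood : measurable_fun setT (@likelihood R n sigma y).
Proof.
apply: measurable_prod => i _.
rewrite (_ : (fun F => _) = fun F : n.-tuple R => normal_pdf (y i 0) sigma (tnth F i)).
  by apply: (measurableT_comp (measurable_normal_pdf _ _)); exact: measurable_tnth.
apply/funext => F; rewrite !normal_pdfE ?gt_eqF// /normal_fun.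
by rewrite -[y i 0 - _]opprB sqrrN.
Qed.

Lemma likelihood_ge0 F : 0 <= likelihood sigma y F.
Proof. by apply: prodr_ge0 => i _; exact: normal_pdf_ge0. Qed.

Lemma linear_functional_design t : linear_functional g (design_tuple n t) =
  dot (fun j : 'I_k => gcoef n g j.+1) t.
Proof.
rewrite /linear_functional.
have -> : cvec (design_tuple n t) = design n k *m cvec t.
  by apply/matrixP => i j; rewrite !mxE tnth_mktuple mxE; apply: eq_bigr => l _; rewrite !mxE.
rewrite mulmxA mxE /dot; apply: eq_bigr => j _.
by rewrite weights_design mxE.
Qed.

Lemma measurable_linear_functional :
  measurable_fun setT (linear_functional g (n := n)).
Proof.
rewrite (_ : linear_functional g (n := n) = fun F : n.-tuple R =>
    \sum_(i < n) weights g n 0 i * tnth F i).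
  apply: measurable_sum => i; apply: measurable_funM => //.
  exact: measurable_tnth.
by apply/funext => F; rewrite /linear_functional mxE; apply: eq_bigr => i _; rewrite [cvec _ _ _]mxE.
Qed.

Lemma integral_likelihood : exists2 K : R, 0 < K & forall B : set R, measurable B ->
  (\int[prior n k gamma]_(F in linear_functional g (n := n) @^-1` B) (likelihood sigma y F)%:E
   = K%:E * gaussian (shrinkage * projected_functional g k y)
       (shrinkage * (sigma ^+ 2 * variance_factor g n k)) B)%E.
Proof.
have s0 : sigma != 0 by rewrite gt_eqF.
have s20 : 0 < sigma ^+ 2 by rewrite exprn_gt0.
have p0 : 0 <= n%:R / sigma ^+ 2 by rewrite divr_ge0// ltW.
have [K K0 HK] := ge0_integral_iid_gaussian_tilt b gamma_gt0 p0.
exists (C0 * K); first by rewrite mulr_gt0 ?C0_gt0.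
move=> B mB.
set A := _ @^-1` _.
have mA : measurable A.
  by rewrite /A -[_ @^-1` _]setTI; exact: measurable_linear_functional.
rewrite integral_mkcond.
pose h x : \bar R := (\1_B x)%:E.
have mh : measurable_fun setT h by apply/measurable_EFinP; exact: measurable_indic.
have h0 x : (0 <= h x)%E by rewrite lee_fin.
pose G F : \bar R := ((fun F => (likelihood sigma y F)%:E) \_ A)%E F.
have mG : measurable_fun setT G.
  apply/(measurable_restrictT _ mA); apply: measurable_funTS.
  by apply/measurable_EFinP; exact: measurable_likelihood.
have G0 F : (0 <= G F)%E.
  by apply: erestrict_ge0 => F' _; rewrite lee_fin likelihood_ge0.
apply: (eq_trans (ge0_integral_distribution _ mG G0)).
pose u (j : 'I_k) := gcoef n g j.+1.
have GE t : (G \o @design_tuple R n k) t =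
    (C0%:E * (h (0 + dot u t)%R * (tilts (n%:R / sigma ^+ 2) b t)%:E))%E.
  rewrite /G/= patchE add0r /h indicE.
  have -> : (design_tuple n t \in A) = (dot u t \in B).
    by apply/idP/idP; rewrite !inE /A/= linear_functional_design.
  case: (_ \in B); last by rewrite mul0e mule0.
  by rewrite likelihood_design EFinM mul1e.
apply: (eq_trans (eq_integral _ _ (fun t _ => GE t))).
have mht : measurable_fun setT (fun t => h (0 + dot u t)%R * (tilts (n%:R / sigma ^+ 2) b t)%:E)%E.
  apply: emeasurable_funM.
    apply: (measurableT_comp mh); apply: measurable_funD => //.
    exact: measurable_dot.
  by apply/measurable_EFinP; exact: measurable_tilts.
have ht0 t : setT t -> (0 <= h (0 + dot u t)%R * (tilts (n%:R / sigma ^+ 2) b t)%:E)%E.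
  by move=> _; rewrite mule_ge0// lee_fin tilts_ge0.
have C00 : (0 <= C0%:E)%E by rewrite lee_fin ltW// C0_gt0.
apply: (eq_trans (ge0_integralZl _ measurableT mht ht0 C00)).
rewrite EFinM -muleA; apply: congr1.
apply: (eq_trans (HK _ _ _ mh h0)); apply: congr1.
set m1 := 0 + _; set v1 := gamma / _ * _.
(* The posterior variance of one coordinate is [sigma^2 / n], the variance of its least squares
   estimator, multiplied by the shrinkage factor. *)
have sE : gamma / (1 + n%:R / sigma ^+ 2 * gamma) = shrinkage * (sigma ^+ 2 / n%:R).
  rewrite /shrinkage; field; rewrite n0' s0 /=.
  have e0 : 0 < sigma ^+ 2 + n%:R * gamma by rewrite addr_gt0// mulr_gt0// ltr0n.
  by rewrite !gt_eqF// addrC.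
have -> : m1 = shrinkage * projected_functional g k y.
  rewrite /m1 add0r sE -mulrA projected_functionalE//; congr (_ * _).
  rewrite mulr_sumr; apply: eq_bigr => j _; rewrite /u /b.
  by field; rewrite n0' s0.
have -> : v1 = shrinkage * (sigma ^+ 2 * variance_factor g n k).
  rewrite /v1 sE -mulrA; congr (_ * _); rewrite -mulrA; congr (_ * _).
  apply: (mulfI n0'); rewrite mulVKf// variance_factor_gcoef//.
  by rewrite big_add1/= big_mkord.
by rewrite integral_indic// setIT.
Qed.

Lemma posterior_linear_functional (B : set R) : measurable B ->
  posterior (prior n k gamma) sigma y (linear_functional g (n := n) @^-1` B) =
  gaussian (shrinkage * projected_functional g k y)
    (shrinkage * (sigma ^+ 2 * variance_factor g n k)) B.
Proof.
move=> mB; have [K K0 HK] := integral_likelihood.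
set Q := gaussian _ _.
have finQ : Q B \is a fin_num.
  by rewrite fin_numE; exact: (fin_num_measure Q).
rewrite /posterior HK// -/Q.
(* The denominator of Bayes' formula is the numerator for [B = setT], so it equals [K]. *)
have -> : (\int[prior n k gamma]_F (likelihood sigma y F)%:E = K%:E)%E.
  by rewrite -[RHS]mule1 -(gaussianT (shrinkage * projected_functional g k y)
    (shrinkage * (sigma ^+ 2 * variance_factor g n k))) -HK.
rewrite -(fineK finQ) -EFinM /=; congr EFin.
by rewrite mulrAC divff ?mul1r// gt_eqF.
Qed.

End posterior_law.

(** * Joint law of the noise *)

Section independent_gaussians.
Context {R : realType}.

Definition rect n (B : 'I_n -> set R) : set (n.-tuple R) :=
  [set t | forall i, B i (tnth t i)].

Definition rects n : set (set (n.-tuple R)) :=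
  [set A | exists2 B : 'I_n -> set R, (forall i, measurable (B i)) & A = rect B].

Lemma measurable_rect n (B : 'I_n -> set R) :
  (forall i, measurable (B i)) -> measurable (rect B).
Proof.
move=> mB; rewrite (_ : rect B = \big[setI/setT]_(i < n) ((tnth (T:=R))^~ i @^-1` B i)).
  apply: bigsetI_measurable => i _; rewrite -[_ @^-1` _]setTI.
  exact: measurable_tnth.
rewrite -bigcap_seq; apply/seteqP; split => t /= H i; first by move=> _; exact: H.
by apply: H; rewrite /= mem_index_enum.
Qed.

Lemma measurable_tuple_rects n :
  @measurable _ (n.-tuple R) = <<s @rects n >>.
Proof.
apply/seteqP; split; last first.
  apply: smallest_sub; first exact: sigma_algebra_measurable.
  by move=> _ [B mB ->]; exact: measurable_rect.
apply: smallest_sub; first exact: smallest_sigma_algebra.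
move=> A; rewrite -bigcup_seq => -[i _ [C mC <-]].
apply: sub_sigma_algebra; exists (fun j => if j == i then C else setT).
  by move=> j; case: ifP.
apply/seteqP; split => t /=.
  by move=> [_ Ct] j; case: eqP => [->|].
by move=> H; split => //; have := H i; rewrite eqxx.
Qed.

Lemma setI_closed_rects n : setI_closed (@rects n).
Proof.
move=> _ _ [B mB ->] [C mC ->]; exists (fun i => B i `&` C i).
  by move=> i; exact: measurableI.
apply/seteqP; split => t /=.
  by move=> [Bt Ct] i; split; [exact: Bt|exact: Ct].
by move=> H; split => i; have [] := H i.
Qed.

Lemma iid_gaussian_rect v n (B : 'I_n -> set R) : (forall i, measurable (B i)) ->
  iid_gaussian v n (rect B) = (\prod_(i < n) gaussian 0 v (B i))%E.
Proof.
elim: n B => [|n IH] B mB.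
  rewrite big_ord0 /= diracE mem_set//.
  by move=> [].
rewrite big_ord_recl -IH//.
rewrite -product_measure1E//; last exact: measurable_rect.
rewrite /= /distribution /pushforward; congr product_measure1.
apply/seteqP; split => -[x t] /=.
  move=> H; split; first by have := H ord0; rewrite tnth0.
  by move=> i; have := H (lift ord0 i); rewrite tnthS.
move=> [B0 Bt] i; case: (unliftP ord0 i) => [j ->|->]; last by rewrite tnth0.
by rewrite tnthS; exact: Bt.
Qed.

(** Independence and the marginals fix the joint law on rectangles, a pi-system generating the
    product sigma-algebra, so the joint law is [iid_gaussian]. The law of a linear combination is
    then the tilted formula with a trivial tilt. *)
Lemma law_linear_gaussian d (T : measurableType d) (P : probability T R) n
  (X : 'I_n -> {RV P >-> R}) v : 0 < v ->
  (forall i A, measurable A -> distribution P (X i) A = gaussian 0 v A) ->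
  mutually_independent P (fun i => X i : T -> R) ->
  forall a (u : 'I_n -> R) B, measurable B ->
  P ((fun w => a + \sum_(i < n) u i * X i w) @^-1` B) =
  gaussian a (v * \sum_(i < n) u i ^+ 2) B.
Proof.
move=> v0 Xlaw Xind a u B mB.
pose Z w : n.-tuple R := [tuple X i w | i < n].
have mZ : measurable_fun setT Z.
  apply/measurable_fun_tnthP => i.
  rewrite [Y in measurable_fun _ Y](_ : _ = (X i : T -> R)).
    exact: measurable_funPT.
  by apply/funext => w; rewrite /= tnth_mktuple.
pose ZZ : {mfun T >-> n.-tuple R} := HB.pack Z (isMeasurableFun.Build _ _ _ _ _ mZ).
have law A : measurable A -> distribution P ZZ A = iid_gaussian v n A.
  apply: (measure_unique (@rects n) (fun=> setT)).
  - exact: measurable_tuple_rects.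
  - exact: setI_closed_rects.
  - move=> _; exists (fun=> setT) => //.
    by apply/seteqP; split.
  - by rewrite bigcup_const.
  - move=> _ [C mC ->]; apply: (eq_trans _ (esym (iid_gaussian_rect v mC))).
    have := Xind [set: 'I_n]%SET C mC.
    rewrite (_ : \bigcap_(i in _) _ = Z @^-1` rect C); last first.
      apply/seteqP; split => w /= H i.
        by rewrite tnth_mktuple; apply: H => /=; rewrite finset.in_setT.
      by move=> _; have := H i; rewrite tnth_mktuple.
    move=> E; apply: (eq_trans E); apply: eq_big => [i|i _].
      by rewrite finset.in_setT.
    exact: Xlaw.
  - by move=> _; apply: (le_lt_trans (probability_le1 _ _)); rewrite ?ltry.
have [K K0 HK] := ge0_integral_iid_gaussian_tilt (fun _ : 'I_n => 0 : R) v0 (lexx (0:R)).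
have tilts1 t : tilts 0 (fun=> 0 : R) t = 1 :> R.
  by rewrite /tilts big1// => j _; rewrite /tilt !mul0r oppr0 mul0r addr0 expR0.
have H C : measurable C -> iid_gaussian v n ((fun t => a + dot u t) @^-1` C) =
   (K%:E * gaussian a (v * \sum_(i < n) u i ^+ 2) C)%E.
  move=> mC; pose h x : \bar R := (\1_C x)%:E.
  have mh : measurable_fun setT h by apply/measurable_EFinP; exact: measurable_indic.
  have h0 x : (0 <= h x)%E by rewrite lee_fin.
  have md : measurable_fun setT (fun t => a + @dot R n u t).
    by apply: measurable_funD => //; exact: measurable_dot.
  have := HK a u h mh h0.
  rewrite (eq_bigr (fun=> 0)); last by move=> j _; rewrite mulr0.
  rewrite big1_eq mulr0 addr0 mul0r addr0 divr1.
  have -> : (\int[gaussian a (v * \sum_(j < n) u j ^+ 2)]_x h x)%E =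
     gaussian a (v * \sum_(j < n) u j ^+ 2) C.
    by rewrite integral_indic// setIT.
  move=> <-.
  have mpre : measurable ((fun t => a + @dot R n u t) @^-1` C).
    by rewrite -[_ @^-1` _]setTI; exact: md.
  apply: (@eq_trans _ _ (\int[iid_gaussian v n]_t
      (\1_((fun t => a + dot u t) @^-1` C) t)%:E)%E).
    by rewrite integral_indic// setIT.
  apply: eq_integral => t _.
  by rewrite tilts1 mule1 /h !indicE.
(* With the trivial tilt both sides have total mass 1 at [setT], which determines [K]. *)
have K1 : K = 1.
  have := H setT measurableT.
  rewrite preimage_setT gaussianT mule1 (probability_setT (iid_gaussian v n)).
  by move=> [].
rewrite -[RHS]mul1e -K1 -H// -law.
  rewrite /distribution /pushforward; congr (P _).
  have ZE w : dot u (Z w) = \sum_(i < n) u i * X i w.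
    by apply: eq_bigr => i _; rewrite tnth_mktuple.
  by apply/seteqP; split => w /=; rewrite ZE.
by rewrite -[_ @^-1` _]setTI; apply: measurable_funD => //; exact: measurable_dot.
Qed.

End independent_gaussians.

(** * Total variation between Gaussians *)

Section gaussian_distance.
Context {R : realType}.
Local Notation mu := (@lebesgue_measure R).
Implicit Types (m v : R).

Definition affinity m1 v1 m2 v2 : R :=
  Num.sqrt (2 * (Num.sqrt v1 * Num.sqrt v2) / (v1 + v2)) *
  expR (- (m1 - m2) ^+ 2 / (4 * (v1 + v2))).

(* Completing the square: sqrt (p1 p2) is the affinity times a Gaussian density. *)
Lemma gaussian_pdf_affinity m1 v1 m2 v2 x : 0 < v1 -> 0 < v2 ->
  normal_pdf m1 (Num.sqrt v1) x * normal_pdf m2 (Num.sqrt v2) x =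
  (affinity m1 v1 m2 v2 * normal_pdf ((m1 * v2 + m2 * v1) / (v1 + v2))
     (Num.sqrt (2 * v1 * v2 / (v1 + v2))) x) ^+ 2.
Proof.
move=> v10 v20.
have v0 : 0 < v1 + v2 by rewrite addr_gt0.
have w0 : 0 < 2 * v1 * v2 / (v1 + v2) by rewrite divr_gt0// !mulr_gt0.
rewrite !gaussian_pdfE// /affinity.
set a := Num.sqrt v1; set b := Num.sqrt v2.
have a0 : 0 < a by rewrite sqrtr_gt0.
have b0 : 0 < b by rewrite sqrtr_gt0.
have aE : v1 = a ^+ 2 by rewrite sqr_sqrtr ?ltW.
have bE : v2 = b ^+ 2 by rewrite sqr_sqrtr ?ltW.
have pi0 := @pi_gt0 R.
have sE (s v : R) : 0 < s -> v = s ^+ 2 -> Num.sqrt (v * pi *+ 2) = s * Num.sqrt (pi *+ 2).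
  by move=> s0 ->; rewrite -mulrnAr sqrtrM ?sqr_ge0// sqrtr_sqr gtr0_norm.
rewrite (sE a)// (sE b)//.
set q := 2 * (a * b) / _; set W := _ * pi *+ 2.
have q0 : 0 <= q by rewrite divr_ge0 ?ltW// !mulr_gt0.
have W0 : 0 < W by rewrite mulrn_wgt0// mulr_gt0.
have P0 : 0 < Num.sqrt (pi *+ 2) :> R by rewrite sqrtr_gt0 mulrn_wgt0.
have P2 : Num.sqrt (pi *+ 2) ^+ 2 = pi *+ 2 :> R.
  by rewrite sqr_sqrtr// mulrn_wge0 ?ltW.
rewrite mulrACA -expRD [X in _ = X ^+ 2]mulrACA -expRD exprMn; congr (_ * _).
  rewrite exprMn exprVn (sqr_sqrtr q0) (sqr_sqrtr (ltW W0)).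
  rewrite -invfM mulrACA -expr2 P2 /q /W aE bE.
  move: {W W0 P0 P2 sE} (@pi R) pi0 => p p0; field.
  by rewrite -aE -bE !gt_eqF.
by rewrite [RHS]expr2 -[RHS]expRD; congr expR; field; rewrite !gt_eqF.
Qed.

(** The affinity is a product of two factors in [[0, 1]], so its defect is at most the sum of
    theirs. The variance factor [sqrt q] is at least [q], with [1 - q = (a - b)^2 / (v1 + v2)]; the
    mean factor satisfies [expR t >= 1 + t]. *)
Lemma affinity_ge m1 v1 m2 v2 : 0 < v1 -> 0 < v2 ->
  1 - (((v1 - v2) / v2) ^+ 2 + (m1 - m2) ^+ 2 / v2) <= affinity m1 v1 m2 v2.
Proof.
move=> v10 v20; rewrite /affinity.
set a := Num.sqrt v1; set b := Num.sqrt v2.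
have a0 : 0 < a by rewrite sqrtr_gt0.
have b0 : 0 < b by rewrite sqrtr_gt0.
have aE : v1 = a ^+ 2 by rewrite sqr_sqrtr ?ltW.
have bE : v2 = b ^+ 2 by rewrite sqr_sqrtr ?ltW.
have v0 : 0 < v1 + v2 by rewrite addr_gt0.
set q := 2 * (a * b) / (v1 + v2); set t := - (m1 - m2) ^+ 2 / _.
have q0 : 0 <= q by rewrite divr_ge0 ?ltW// !mulr_gt0.
have q1 : q <= 1.
  rewrite ler_pdivrMr// mul1r aE bE; have := sqr_ge0 (a - b); lra.
have qs : q <= Num.sqrt q.
  rewrite -[leLHS]ger0_norm// -sqrtr_sqr ler_wsqrtr// expr2 ler_piMr//.
have s1 : Num.sqrt q <= 1 by rewrite -sqrtr1 ler_wsqrtr.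
have qge : 1 - ((v1 - v2) / v2) ^+ 2 <= q.
  rewrite lerBlDr -lerBlDl.
  have -> : 1 - q = (a - b) ^+ 2 / (v1 + v2).
    by rewrite /q aE bE; field; rewrite -aE -bE gt_eqF.
  have -> : ((v1 - v2) / v2) ^+ 2 = (a - b) ^+ 2 * ((a + b) ^+ 2 / v2 ^+ 2).
    by rewrite aE bE; field; rewrite gt_eqF.
  rewrite ler_wpM2l ?sqr_ge0// invf_ple ?posrE//; last first.
    by rewrite divr_gt0// exprn_gt0// addr_gt0.
  rewrite invf_div ler_pdivrMr ?exprn_gt0 ?addr_gt0// aE bE.
  have := mulr_gt0 a0 b0; have := mulr_ge0 (sqr_ge0 a) (sqr_ge0 a).
  have := mulr_ge0 (sqr_ge0 a) (sqr_ge0 b).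
  have := mulr_gt0 (mulr_gt0 a0 b0) v10; have := mulr_gt0 (mulr_gt0 a0 b0) v20.
  by rewrite aE bE; nra.
have tge : 1 - (m1 - m2) ^+ 2 / v2 <= expR t.
  apply: le_trans (expR_ge1Dx t); rewrite lerD2l /t mulNr lerN2.
  rewrite ler_wpM2l ?sqr_ge0// lef_pV2 ?posrE//; last by rewrite mulr_gt0.
  by lra.
have t1 : expR t <= 1.
  by rewrite -expR0 ler_expR /t mulNr oppr_le0 divr_ge0 ?sqr_ge0// mulr_ge0// ltW.
have e0 := expR_ge0 t.
nra.
Qed.

End gaussian_distance.

Section gaussian_total_variation.
Context {R : realType}.
Local Notation mu := (@lebesgue_measure R).
Implicit Types (m v lambda : R).

(** A bound on the L1 distance of the densities with [lambda] left free: it stays quadratic in the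
    mean gap and can be averaged over a random mean. *)
Definition gbound lambda m1 v1 m2 v2 : R :=
  lambda * (((v1 - v2) / v2) ^+ 2 + (m1 - m2) ^+ 2 / v2) + 2 / lambda.

(** With [z = sqrt(p q)], [A] and [B] are the squares of [sqrt p - sqrt q] and [sqrt p + sqrt q], so
    [|p - q| = sqrt(A B) <= lambda A / 2 + B / (2 lambda)]. Using [2 z <= p + q] in the last term
    gives the claim. *)
Lemma dist_le_sqr_mean (p q z lambda : R) : 0 <= p -> 0 <= q -> 0 <= z ->
  p * q = z ^+ 2 -> 0 < lambda ->
  `|p - q| + lambda * z <= (lambda / 2 + lambda^-1) * (p + q).
Proof.
move=> p0 q0 z0 pq l0; rewrite -lerBrDr.
set A := p + q - 2 * z; set B := p + q + 2 * z.
have A0 : 0 <= A.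
  rewrite subr_ge0 -ler_sqr ?nnegrE ?addr_ge0 ?mulr_ge0//.
  have := sqr_ge0 (p - q); rewrite exprMn -pq; lra.
have B0 : 0 <= B by rewrite !addr_ge0// mulr_ge0.
have AB : A * B = (p - q) ^+ 2.
  by rewrite /A /B -subr_sqr exprMn -pq; ring.
have li0 : 0 < lambda^-1 by rewrite invr_gt0.
apply: (@le_trans _ _ (lambda / 2 * A + lambda^-1 / 2 * B)).
  rewrite -ler_sqr ?nnegrE ?addr_ge0 ?mulr_ge0 ?(ltW l0) ?(ltW li0)//.
  rewrite real_normK ?num_real// -AB.
  rewrite -subr_ge0 (_ : _ - _ = (lambda / 2 * A - lambda^-1 / 2 * B) ^+ 2) ?sqr_ge0//.
  by field; rewrite gt_eqF.
have := mulr_ge0 (ltW li0) A0; rewrite -subr_ge0 => h.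
rewrite -subr_ge0 (_ : _ - _ = lambda^-1 * A / 2); last by rewrite /A /B; field; rewrite gt_eqF.
by rewrite mulr_ge0// mulr_ge0// ltW.
Qed.

(** Integrating the pointwise inequality gives [lambda (1 - BC) + 2 / lambda], because [p], [q] and
    the density [r] all have mass 1; then the defect of the affinity [BC] is bounded. *)
Lemma gaussian_L1 lambda m1 v1 m2 v2 : 0 < lambda -> 0 < v1 -> 0 < v2 ->
  (\int[mu]_x (`|normal_pdf m1 (Num.sqrt v1) x - normal_pdf m2 (Num.sqrt v2) x|)%:E
   <= (gbound lambda m1 v1 m2 v2)%:E)%E.
Proof.
move=> l0 v10 v20.
pose p x := normal_pdf m1 (Num.sqrt v1) x; pose q x := normal_pdf m2 (Num.sqrt v2) x.
pose BC := affinity m1 v1 m2 v2.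
pose r x := normal_pdf ((m1 * v2 + m2 * v1) / (v1 + v2)) (Num.sqrt (2 * v1 * v2 / (v1 + v2))) x.
have BC0 : 0 <= BC by rewrite mulr_ge0// ?sqrtr_ge0 ?expR_ge0.
have p0 x : 0 <= p x by exact: normal_pdf_ge0.
have q0 x : 0 <= q x by exact: normal_pdf_ge0.
have r0 x : 0 <= r x by exact: normal_pdf_ge0.
have mp : measurable_fun setT p by exact: measurable_normal_pdf.
have mq : measurable_fun setT q by exact: measurable_normal_pdf.
have mr : measurable_fun setT r by exact: measurable_normal_pdf.
pose c := lambda / 2 + lambda^-1.
have c0 : 0 <= c by rewrite addr_ge0// ltW ?invr_gt0// divr_gt0.
have H : (\int[mu]_x (`|p x - q x| + lambda * BC * r x)%:E <=
          \int[mu]_x (c * (p x + q x))%:E)%E.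
  apply: ge0_le_integral => //.
  - by move=> x _; rewrite lee_fin addr_ge0// !mulr_ge0// ltW.
  - apply/measurable_EFinP; apply: measurable_funD; last exact: measurable_funM.
    by apply: measurableT_comp => //; exact: measurable_funB.
  - by apply/measurable_EFinP; apply: measurable_funM => //; exact: measurable_funD.
  - move=> x _; rewrite lee_fin -mulrA; apply: dist_le_sqr_mean => //.
      exact: mulr_ge0.
    exact: gaussian_pdf_affinity.
have I1 : (\int[mu]_x (c * (p x + q x))%:E = (c * 2)%:E)%E.
  under eq_integral do rewrite EFinM.
  rewrite ge0_integralZl_EFin//; last 2 first.
  - by move=> x _; rewrite lee_fin addr_ge0.
  - by apply/measurable_EFinP; exact: measurable_funD.
  under eq_integral do rewrite EFinD.
  rewrite ge0_integralD//.
  - by rewrite !integral_normal_pdf.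
  - by move=> x _; rewrite lee_fin.
  - exact/measurable_EFinP.
  - by move=> x _; rewrite lee_fin.
  - exact/measurable_EFinP.
have I2 : (\int[mu]_x (`|p x - q x| + lambda * BC * r x)%:E =
   \int[mu]_x (`|p x - q x|)%:E + (lambda * BC)%:E)%E.
  under eq_integral do rewrite EFinD.
  have d0 x : setT x -> (0 <= (`|p x - q x|)%:E)%E by move=> _; rewrite lee_fin.
  have md : measurable_fun setT (fun x : measurableTypeR R => (`|p x - q x|)%:E).
    by apply/measurable_EFinP; apply: measurableT_comp => //; exact: measurable_funB.
  have s0 x : setT x -> (0 <= (lambda * BC * r x)%:E)%E.
    by move=> _; rewrite lee_fin !mulr_ge0// ltW.
  have ms : measurable_fun setT (fun x : measurableTypeR R => (lambda * BC * r x)%:E).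
    by apply/measurable_EFinP; exact: measurable_funM.
  apply: (eq_trans (ge0_integralD mu measurableT d0 md s0 ms)); congr (_ + _)%E.
  under eq_integral do rewrite EFinM.
  rewrite ge0_integralZl_EFin//.
  - by rewrite integral_normal_pdf mule1.
  - by move=> x _; rewrite lee_fin.
  - exact/measurable_EFinP.
  - by rewrite mulr_ge0// ltW.
rewrite I1 I2 -leeBrDr// in H; apply: (le_trans H).
rewrite -EFinB lee_fin /gbound.
have := ler_wpM2l (ltW l0) (affinity_ge m1 m2 v10 v20); rewrite -/BC /c.
have : 0 < lambda^-1 by rewrite invr_gt0.
lra.
Qed.

Lemma integral_gaussian_le (B M : R) m1 v1 m2 v2 (h : R -> R) :
  0 < v1 -> 0 < v2 -> 0 <= M -> measurable_fun setT h -> (forall x, 0 <= h x <= M) ->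
  (\int[mu]_x (`|normal_pdf m1 (Num.sqrt v1) x - normal_pdf m2 (Num.sqrt v2) x|)%:E
   <= B%:E)%E ->
  (\int[gaussian m1 v1]_x (h x)%:E <= \int[gaussian m2 v2]_x (h x)%:E + (M * B)%:E)%E.
Proof.
move=> v10 v20 M0 mh hM HB.
have mhe : measurable_fun setT (EFin \o h) by exact/measurable_EFinP.
have h0 x : (0 <= (EFin \o h) x)%E by rewrite lee_fin; case/andP: (hM x).
have I1 := ge0_integral_gaussian m1 v10 mhe h0.
have I2 := ge0_integral_gaussian m2 v20 mhe h0.
have le_eq (a b : \bar R) : a = b -> (a <= b)%E by move=> ->.
apply: (le_trans (le_eq _ _ I1)).
apply: (le_trans _ (leeD2r _ (le_eq _ _ (esym I2)))).
pose p x := normal_pdf m1 (Num.sqrt v1) x; pose q x := normal_pdf m2 (Num.sqrt v2) x.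
have mp : measurable_fun setT p by exact: measurable_normal_pdf.
have mq : measurable_fun setT q by exact: measurable_normal_pdf.
have md : measurable_fun setT (fun x : measurableTypeR R => (`|p x - q x|)%:E).
  by apply/measurable_EFinP; apply: measurableT_comp => //; exact: measurable_funB.
have p0 x : 0 <= p x by exact: normal_pdf_ge0.
have q0 x : 0 <= q x by exact: normal_pdf_ge0.
have mhq : measurable_fun setT (fun x : measurableTypeR R => (h x)%:E * (q x)%:E)%E.
  by apply: emeasurable_funM => //; exact/measurable_EFinP.
have mhp : measurable_fun setT (fun x : measurableTypeR R => (h x)%:E * (p x)%:E)%E.
  by apply: emeasurable_funM => //; exact/measurable_EFinP.
have mMd : measurable_fun setT (fun x : measurableTypeR R => M%:E * (`|p x - q x|)%:E)%E.
  exact: emeasurable_funM.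
apply: (@le_trans _ _ (\int[mu]_x ((h x)%:E * (q x)%:E + M%:E * (`|p x - q x|)%:E))%E).
  apply: ge0_le_integral => //.
  - by move=> x _; rewrite mule_ge0 ?lee_fin// ?p0// ?h0; case/andP: (hM x).
  - exact: emeasurable_funD.
  - move=> x _; rewrite -!EFinM -EFinD lee_fin.
    have /andP[hx0 hxM] := hM x.
    rewrite -/(p x) -lerBlDl -mulrBr.
    apply: (@le_trans _ _ (h x * `|p x - q x|)); first by rewrite ler_wpM2l// ler_norm.
    by rewrite ler_wpM2r.
have hq0 x : setT x -> (0 <= (h x)%:E * (q x)%:E)%E.
  by move=> _; rewrite -EFinM lee_fin mulr_ge0//; case/andP: (hM x).
have Md0 x : setT x -> (0 <= M%:E * (`|p x - q x|)%:E)%E.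
  by move=> _; rewrite -EFinM lee_fin mulr_ge0.
rewrite (ge0_integralD mu measurableT hq0 mhq Md0 mMd) leeD2l//.
rewrite ge0_integralZl_EFin// EFinM.
by apply: lee_wpmul2l => //; rewrite lee_fin.
Qed.

End gaussian_total_variation.

(** * Expected total variation *)

Section expectation_bounds.
Context {R : realType}.
Local Notation mu := (@lebesgue_measure R).
Implicit Types (m v lambda : R).

Lemma gaussian_fin_num m v (A : set R) : measurable A -> gaussian m v A \is a fin_num.
Proof. by move=> mA; exact: (@fin_num_measure _ _ _ (gaussian m v)). Qed.

Lemma gaussian_set_le lambda m1 v1 m2 v2 (A : set R) :
  0 < lambda -> 0 < v1 -> 0 < v2 -> measurable A ->
  (`|gaussian m1 v1 A - gaussian m2 v2 A| <= (gbound lambda m1 v1 m2 v2)%:E)%E.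
Proof.
move=> l0 v10 v20 mA.
pose J m v := (\int[gaussian m v]_x (\1_A x)%:E)%E.
have JE m v : J m v = gaussian m v A by rewrite /J integral_indic// setIT.
have mi : measurable_fun setT (\1_A : R -> R) by exact: measurable_indic.
have i01 (x : R) : 0 <= (\1_A x : R) <= 1.
  by rewrite indicE; case: (_ \in _); rewrite lexx ler01.
have L := gaussian_L1 m1 m2 l0 v10 v20.
have L' : (\int[mu]_x (`|normal_pdf m2 (Num.sqrt v2) x - normal_pdf m1 (Num.sqrt v1) x|)%:E
   <= (gbound lambda m1 v1 m2 v2)%:E)%E.
  by under eq_integral do rewrite distrC.
have H1 : (J m1 v1 <= J m2 v2 + _)%E := integral_gaussian_le v10 v20 ler01 mi i01 L.
have H2 : (J m2 v2 <= J m1 v1 + _)%E := integral_gaussian_le v20 v10 ler01 mi i01 L'.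
suff : (`|J m1 v1 - J m2 v2| <= (gbound lambda m1 v1 m2 v2)%:E)%E by rewrite !JE.
have fJ m v : J m v \is a fin_num by rewrite JE gaussian_fin_num.
clearbody J; rewrite !mul1r in H1 H2.
rewrite -(fineK (fJ m1 v1)) -(fineK (fJ m2 v2)) -!EFinD !lee_fin in H1 H2 *.
by rewrite ler_norml; apply/andP; split; lra.
Qed.

(** Monotonicity straight from the definition by simple functions, with no measurability condition:
    it applies to [tv_dist], a supremum over all measurable sets whose dependence on the outcome
    need not be shown measurable. *)
Lemma ge0_le_integral_simple d (T : measurableType d) (P : {measure set T -> \bar R})
  (f1 f2 : T -> \bar R) : (forall x, 0 <= f1 x)%E -> (forall x, f1 x <= f2 x)%E ->
  (\int[P]_x f1 x <= \int[P]_x f2 x)%E.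
Proof.
move=> f10 f12.
have f20 x : (0 <= f2 x)%E by exact: le_trans (f12 x).
rewrite (ge0_integralTE P f10) (ge0_integralTE P f20); apply: ereal_sup_le.
by move=> _ [h hf <-]; exists h => // x; exact: le_trans (f12 x).
Qed.

(** Writing [(x - m)^2 = 4 v s], the inequality [s <= expR s] gives [s expR (-2 s) <= expR (- s)],
    so the integrand is at most [4 v sqrt 2] times the density of [N(m, 2 v)]. The constant 8 comes
    from [sqrt 2 <= 2]. *)
Lemma gaussian_second_moment m v : 0 <= v ->
  (\int[gaussian m v]_x ((x - m) ^+ 2)%:E <= (8 * v)%:E)%E.
Proof.
move=> v0.
have mh : measurable_fun setT (fun x : R => ((x - m) ^+ 2)%:E).
  by apply/measurable_EFinP; apply: measurable_funX; exact: measurable_funB.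
have [v00|vn0] := eqVneq v 0.
  by rewrite (integral_gaussian0 m v00 mh) subrr expr0n v00 mulr0.
have {v0 vn0}vp : 0 < v by rewrite lt_neqAle eq_sym vn0.
have h0 (x : R) : (0 <= ((x - m) ^+ 2)%:E)%E by rewrite lee_fin sqr_ge0.
rewrite (ge0_integral_gaussian m vp mh h0).
have v2 : 0 < v *+ 2 by rewrite mulrn_wgt0.
have c0 : 0 <= 4 * v * Num.sqrt 2 by rewrite !mulr_ge0 ?sqrtr_ge0 ?ltW.
apply: (@le_trans _ _ (\int[mu]_x ((4 * v * Num.sqrt 2)%:E *
    (normal_pdf m (Num.sqrt (v *+ 2)) x)%:E))%E).
  apply: ge0_le_integral_simple => x.
    by rewrite -EFinM lee_fin mulr_ge0 ?sqr_ge0 ?normal_pdf_ge0.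
  rewrite -!EFinM lee_fin !gaussian_pdfE//.
  have -> : v *+ 2 * pi *+ 2 = 2 * (v * pi *+ 2) by ring.
  rewrite sqrtrM// invfM !mulrA mulfK ?gt_eqF ?sqrtr_gt0//.
  have W0 : 0 < Num.sqrt (v * pi *+ 2) by rewrite sqrtr_gt0 mulrn_wgt0// mulr_gt0// pi_gt0.
  have [s s0 ->] : exists2 s, 0 <= s & (x - m) ^+ 2 = 4 * v * s.
    exists ((x - m) ^+ 2 / (4 * v)); last by field; rewrite gt_eqF.
    by rewrite divr_ge0 ?sqr_ge0// mulr_ge0// ltW.
  rewrite -!mulrA ler_pM2l// ler_wpM2l ?(ltW vp)//.
  rewrite mulrCA ler_wpM2l ?invr_ge0 ?(ltW W0)//.
  have -> : expR (- (4 * (v * s)) / (v *+ 2)) = expR (- s) * expR (- s).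
    by rewrite -expRD; congr expR; field; rewrite gt_eqF.
  have -> : expR (- (4 * (v * s)) / (v *+ 2 *+ 2)) = expR (- s).
    by congr expR; field; rewrite gt_eqF.
  rewrite mulrA ler_piMl ?expR_ge0//.
  have es : s <= expR s by rewrite (le_trans _ (expR_ge1Dx s))// lerDr.
  by rewrite expRN ler_pdivrMr ?expR_gt0// mul1r.
rewrite ge0_integralZl_EFin//.
- rewrite integral_normal_pdf mule1 lee_fin.
  have : Num.sqrt 2 <= 2 :> R by rewrite -[leRHS]gtr0_norm// -sqrtr_sqr ler_sqrt// ?expr2; lra.
  move=> s2; rewrite -mulrA [v * _]mulrC mulrA ler_pM2r//; lra.
- by move=> x _; rewrite lee_fin normal_pdf_ge0.
- by apply/measurable_EFinP; exact: measurable_normal_pdf.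
Qed.

Lemma integral_law d (T : measurableType d) (P : probability T R) (M : T -> R) m v
  (h : R -> \bar R) : measurable_fun setT M ->
  (forall A, measurable A -> P (M @^-1` A) = gaussian m v A) ->
  measurable_fun setT h -> (forall x, 0 <= h x)%E ->
  (\int[P]_w h (M w) = \int[gaussian m v]_x h x)%E.
Proof.
move=> mM law mh h0.
pose X : {mfun T >-> R} := HB.pack M (isMeasurableFun.Build _ _ _ _ _ mM).
apply: (eq_trans (esym (ge0_integral_distribution (X : {RV P >-> R}) mh h0))).
by apply: eq_measure_integral => A mA _; exact: law.
Qed.

Lemma second_moment_le d (T : measurableType d) (P : probability T R) (M : T -> R) m v :
  0 <= v -> measurable_fun setT M ->
  (forall A, measurable A -> P (M @^-1` A) = gaussian m v A) ->
  (\int[P]_w ((M w) ^+ 2)%:E <= (2 * m ^+ 2 + 16 * v)%:E)%E.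
Proof.
move=> v0 mM law.
have mh : measurable_fun setT (fun x : R => ((x - m) ^+ 2)%:E).
  by apply/measurable_EFinP; apply: measurable_funX; exact: measurable_funB.
have h0 (x : R) : (0 <= ((x - m) ^+ 2)%:E)%E by rewrite lee_fin sqr_ge0.
have E := integral_law mM law mh h0.
have mhM : measurable_fun setT (fun w => ((M w - m) ^+ 2)%:E).
  by apply/measurable_EFinP; apply: measurable_funX; exact: measurable_funB.
apply: (@le_trans _ _ (\int[P]_w ((2 * m ^+ 2)%:E + 2%:E * ((M w - m) ^+ 2)%:E))%E).
  apply: ge0_le_integral_simple => w; first by rewrite lee_fin sqr_ge0.
  rewrite -EFinM -EFinD lee_fin; have := sqr_ge0 (M w - m - m); lra.
rewrite ge0_integralD//.
- rewrite (probability_integral_cst P) ge0_integralZl_EFin// [leRHS]EFinD leeD2l//.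
  rewrite (_ : 16 * v = 2 * (8 * v)); last by ring.
  rewrite EFinM; apply: lee_wpmul2l => //.
  apply: (le_trans _ (gaussian_second_moment m v0)).
  by rewrite le_eqVlt; apply/orP; left; apply/eqP; exact: E.
- by move=> w _; rewrite lee_fin mulr_ge0 ?sqr_ge0.
- by move=> w _; rewrite mule_ge0// lee_fin sqr_ge0.
- by apply: emeasurable_funM.
Qed.

Lemma tv_dist_ge0 (Q Q' : set R -> \bar R) : (0 <= tv_dist Q Q')%E.
Proof.
apply: (@le_trans _ _ (`|Q set0 - Q' set0|)%E); first exact: abse_ge0.
by apply: ereal_sup_ubound; exists set0 => //; exact: measurable0.
Qed.

Lemma tv_dist_eq0 (Q Q' : set R -> \bar R) :
  (forall A, measurable A -> Q A = Q' A /\ Q' A \is a fin_num) -> tv_dist Q Q' = 0%E.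
Proof.
move=> QQ'; apply/eqP; rewrite eq_le tv_dist_ge0 andbT.
apply: ge_ereal_sup => _ [A mA <-]; have [-> fQ] := QQ' A mA.
by rewrite subee// abse0.
Qed.

(** Both convergences in total variation use this bound: the variances are deterministic, and the
    squared mean gap is [kappa] times the square of one Gaussian variable [M], so its expectation
    needs only the second moment of [M]. *)
Lemma tv_expectation_le d (T : measurableType d) (P : probability T R)
  (Q : T -> set R -> \bar R) (M m1 m2 : T -> R) (m v v1 v2 kappa lambda : R) :
  0 < lambda -> 0 <= v -> 0 < v1 -> 0 < v2 -> 0 <= kappa ->
  measurable_fun setT M ->
  (forall A, measurable A -> P (M @^-1` A) = gaussian m v A) ->
  (forall w A, measurable A -> Q w A = gaussian (m1 w) v1 A) ->
  (forall w, (m1 w - m2 w) ^+ 2 = kappa * M w ^+ 2) ->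
  (\int[P]_w tv_dist (Q w) (gaussian (m2 w) v2) <=
   (lambda * (((v1 - v2) / v2) ^+ 2 + kappa * (2 * m ^+ 2 + 16 * v) / v2) + 2 / lambda)%:E)%E.
Proof.
move=> l0 v0 v10 v20 k0 mM law QE mE.
pose a := lambda * ((v1 - v2) / v2) ^+ 2 + 2 / lambda; pose b := lambda * kappa / v2.
have li0 : 0 <= lambda^-1 by rewrite invr_ge0 ltW.
have a0 : 0 <= a.
  apply: addr_ge0; last exact: mulr_ge0.
  by apply: mulr_ge0; [exact: ltW|exact: sqr_ge0].
have b0 : 0 <= b.
  apply: mulr_ge0; last by rewrite invr_ge0 ltW.
  by apply: mulr_ge0 => //; exact: ltW.
apply: (@le_trans _ _ (\int[P]_w (a%:E + b%:E * ((M w) ^+ 2)%:E))%E).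
  apply: ge0_le_integral_simple => w; first exact: tv_dist_ge0.
  apply: ge_ereal_sup => _ [A mA <-]; rewrite (QE _ _ mA).
  apply: (le_trans (gaussian_set_le (m1 w) (m2 w) l0 v10 v20 mA)).
  rewrite -EFinM -EFinD lee_fin /gbound mE /a /b.
  by rewrite le_eqVlt; apply/orP; left; apply/eqP; ring.
have mM2 : measurable_fun setT (fun w => ((M w) ^+ 2)%:E).
  by apply/measurable_EFinP; exact: measurable_funX.
rewrite ge0_integralD//.
- rewrite (probability_integral_cst P) ge0_integralZl_EFin//.
  + apply: (@le_trans _ _ (a%:E + b%:E * (2 * m ^+ 2 + 16 * v)%:E)%E).
      rewrite leeD2l//; apply: lee_wpmul2l; first by rewrite lee_fin.
      exact: second_moment_le law.
    rewrite -EFinM -EFinD lee_fin /a /b.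
    by rewrite le_eqVlt; apply/orP; left; apply/eqP; ring.
  + by move=> w _; rewrite lee_fin sqr_ge0.
- by move=> w _; rewrite mule_ge0// lee_fin sqr_ge0.
- by apply: emeasurable_funM.
Qed.

Lemma cvg0_lambda (t : nat -> \bar R) (E : nat -> R) : (forall n, 0 <= t n)%E ->
  (\forall n \near \oo, forall lambda : R, 0 < lambda ->
     (t n <= (lambda * E n + 2 / lambda)%:E)%E) ->
  E n @[n --> \oo] --> (0 : R) -> (t n @[n --> \oo] --> 0)%E.
Proof.
move=> t0 tE E0.
(* The choice is [lambda = 1 / s n], which balances the two terms and gives the bound [3 * s n]. The
   harmonic term keeps [s n] positive when [E n] vanishes. *)
pose e n := `|E n| + harmonic n; pose s n := Num.sqrt (e n).
have e0 n : 0 < e n by rewrite ltr_wpDl// harmonic_gt0.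
have s0 n : 0 < s n by rewrite sqrtr_gt0.
have es n : e n = s n ^+ 2 by rewrite sqr_sqrtr// ltW.
have cs : s n @[n --> \oo] --> (0 : R).
  have ce : e n @[n --> \oo] --> (0 : R).
    rewrite -[X in _ --> X](addr0 0); apply: cvgD; last exact: cvg_harmonic.
    by rewrite -(normr0 R); exact: cvg_norm.
  rewrite -(sqrtr0 R); apply: (cvg_comp e Num.sqrt ce).
  exact: sqrt_continuous.
apply: (@squeeze_cvge _ _ _ _ (fun=> 0%E) _ (fun n => (3 * s n)%:E)); last 2 first.
- exact: cvg_cst.
- apply: cvg_EFin; first exact: nearW.
  rewrite -(mulr0 3); exact: cvgMr.
near=> n; rewrite t0/=.
have tn : forall lambda : R, 0 < lambda -> (t n <= (lambda * E n + 2 / lambda)%:E)%E.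
  by near: n.
apply: le_trans (tn (s n)^-1 _) _; first by rewrite invr_gt0.
rewrite lee_fin invrK (_ : 3 * s n = s n + 2 * s n); last by ring.
rewrite lerD2r ler_pdivrMl// -expr2 -es.
by rewrite (le_trans (ler_norm _))// lerDl ltW// harmonic_gt0.
Unshelve. all: end_near. Qed.

End expectation_bounds.

(** * Asymptotics *)

Section final_lemmas.
Context {R : realType}.

(** [n] times the variance factor is a sum of squares of the retained coefficients of [g], so all of
    them vanish and the functional is 0 at every [y]. *)
Lemma projected_functional_degenerate n k (g : R -> R) (y : 'cV[R]_n) :
  (0 < n)%N -> (k <= if odd n then n else n.-1)%N ->
  variance_factor g n k = 0 -> projected_functional g k y = 0.
Proof.
move=> n0 kn v0; have := variance_factor_gcoef n0 kn g.
rewrite v0 mulr0 big_add1/= big_mkord => /esym/eqP.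
rewrite psumr_eq0 => [/allP H|j _]; last exact: sqr_ge0.
rewrite projected_functionalE// big1// => j _.
by have := H j (mem_index_enum j); rewrite /= sqrf_eq0 => /eqP ->; rewrite mul0r.
Qed.

Lemma projected_functional_observation n k (f g : R -> R) (e : 'I_n -> R) :
  projected_functional g k (observation f e) =
  projected_functional g k (samples f n) +
  \sum_(i < n) (weights g n *m hat_mx n k) 0 i * e i.
Proof.
have -> : observation f e = samples f n + \col_i e i.
  by apply/matrixP => i j; rewrite !mxE.
rewrite /projected_functional !mulmxDr mxE; congr (_ + _).
by rewrite mulmxA mxE; apply: eq_bigr => i _; rewrite [(\col_i e i) i 0]mxE.
Qed.

Lemma shrinkage_gt0 n (sigma gamma : R) : (0 < n)%N -> 0 < sigma -> 0 < gamma ->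
  0 < shrinkage n sigma gamma.
Proof.
move=> n0 s0 g0; have ng : 0 < n%:R * gamma by rewrite mulr_gt0// ltr0n.
by rewrite divr_gt0// addr_gt0// exprn_gt0.
Qed.

(** Here [1 - c = sigma^2 / (sigma^2 + n gamma)], which is at most [sigma^2 / (n gamma)]. The
    right-hand side is written with the ratio that tends to 0 by the rate assumption on [gamma]. *)
Lemma shrinkage_bound n (sigma gamma : R) : (0 < n)%N -> 0 < sigma -> 0 < gamma ->
  n%:R * (1 - shrinkage n sigma gamma) ^+ 2 <=
  sigma ^+ 4 * ((Num.sqrt n%:R)^-1 / gamma) ^+ 2.
Proof.
move=> n0 s0 g0; have n0' : 0 < n%:R :> R by rewrite ltr0n.
have ng : 0 < n%:R * gamma by rewrite mulr_gt0.
have s20 : 0 < sigma ^+ 2 by rewrite exprn_gt0.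
have d0 : 0 < sigma ^+ 2 + n%:R * gamma by rewrite addr_gt0.
have -> : 1 - shrinkage n sigma gamma = sigma ^+ 2 / (sigma ^+ 2 + n%:R * gamma).
  by rewrite /shrinkage; field; rewrite gt_eqF.
rewrite !exprMn !exprVn sqr_sqrtr ?ler0n//.
have -> : sigma ^+ 4 * (n%:R^-1 * (gamma ^+ 2)^-1) =
   n%:R * ((sigma ^+ 2) ^+ 2 * ((n%:R * gamma) ^+ 2)^-1).
  by field; rewrite !gt_eqF.
rewrite ler_wpM2l ?ler0n// ler_wpM2l ?sqr_ge0// lef_pV2 ?posrE ?exprn_gt0//.
by rewrite ler_sqr ?nnegrE ?ltW// ltrDr.
Qed.

Lemma integral_indicT d (T : measurableType d) (Q : {measure set T -> \bar R})
  (A : set T) : measurable A -> (\int[Q]_x (\1_A x)%:E = Q A)%E.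
Proof. by move=> mA; rewrite integral_indic// setIT. Qed.

Lemma gaussian_preimage_affine (m v a u : R) (A : set R) : 0 <= v -> measurable A ->
  gaussian m v ((fun x => a + u * x) @^-1` A) = gaussian (a + u * m) (u ^+ 2 * v) A.
Proof.
move=> v0 mA; pose h x : \bar R := (\1_A x)%:E.
have mh : measurable_fun setT h by apply/measurable_EFinP; exact: measurable_indic.
have h0 x : (0 <= h x)%E by rewrite lee_fin.
have E := ge0_integral_gaussian_affine m a u v0 mh h0.
have mpre : measurable ((fun x : R => a + u * x) @^-1` A).
  have maff : measurable_fun setT (fun x : R => a + u * x).
    by apply: measurable_funD => //; exact: measurable_funM.
  by rewrite -[X in measurable X]setTI; exact: maff.
have E1 := integral_indicT (gaussian m v) mpre.
have E2 := integral_indicT (gaussian (a + u * m) (u ^+ 2 * v)) mA.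
apply: (eq_trans (esym E1)); apply: (eq_trans _ E2); apply: (eq_trans _ E).
by apply: eq_integral => x _; rewrite /h !indicE.
Qed.

(** Adding [B] makes a bounded function nonnegative, so that the statements on nonnegative
    integrands apply; finiteness allows the constant to be cancelled afterwards. *)
Lemma integralDcst d (T : measurableType d) (Q : probability T R) (h : T -> R) (B : R) :
  measurable_fun setT h -> (forall x, `|h x| <= B) ->
  ((\int[Q]_x (h x)%:E)%E \is a fin_num) /\
  (\int[Q]_x (h x + B)%:E = \int[Q]_x (h x)%:E + B%:E)%E.
Proof.
move=> mh hB.
have ih : Q.-integrable setT (EFin \o h).
  apply: measurable_bounded_integrable => //.
    by apply: (le_lt_trans (probability_le1 _ _)); rewrite ?ltry.
  by exists B; split; [exact: num_real|move=> M BM x _; exact: le_trans (hB x) (ltW BM)].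
have iB : Q.-integrable setT (EFin \o cst B) by exact: finite_measure_integrable_cst.
split; first exact: integrable_fin_num.
apply: (eq_trans (integralD_EFin measurableT ih iB)).
by rewrite (probability_integral_cst Q B%:E).
Qed.

Lemma gaussian_bounded_le lambda (m1 v1 m2 v2 B : R) (h : R -> R) :
  0 < lambda -> 0 < v1 -> 0 < v2 -> 0 <= B ->
  measurable_fun setT h -> (forall x, `|h x| <= B) ->
  (`|\int[gaussian m1 v1]_x (h x)%:E - \int[gaussian m2 v2]_x (h x)%:E|
    <= (2 * B * gbound lambda m1 v1 m2 v2)%:E)%E.
Proof.
move=> l0 v10 v20 B0 mh hB.
pose J m v := (\int[gaussian m v]_x (h x)%:E)%E.
pose K m v := (\int[gaussian m v]_x (h x + B)%:E)%E.
have JF m v : J m v \is a fin_num.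
  by have [+ _] := integralDcst (gaussian m v) mh hB.
have KE m v : K m v = (J m v + B%:E)%E.
  by have [_ +] := integralDcst (gaussian m v) mh hB.
have mhB : measurable_fun setT (fun x => h x + B) by exact: measurable_funD.
have hB' x : 0 <= h x + B <= 2 * B.
  have := hB x; rewrite ler_norml => /andP[h1 h2]; apply/andP; split; lra.
have B20 : 0 <= 2 * B by rewrite mulr_ge0.
have L := gaussian_L1 m1 m2 l0 v10 v20.
have L' : (\int[lebesgue_measure]_x (`|normal_pdf m2 (Num.sqrt v2) x - normal_pdf m1 (Num.sqrt v1) x|)%:E
   <= (gbound lambda m1 v1 m2 v2)%:E)%E.
  by under eq_integral do rewrite distrC.
have H1 : (K m1 v1 <= K m2 v2 + _)%E := integral_gaussian_le v10 v20 B20 mhB hB' L.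
have H2 : (K m2 v2 <= K m1 v1 + _)%E := integral_gaussian_le v20 v10 B20 mhB hB' L'.
suff : (`|J m1 v1 - J m2 v2| <= (2 * B * gbound lambda m1 v1 m2 v2)%:E)%E by [].
clearbody K J; rewrite !KE in H1 H2.
rewrite -(fineK (JF m1 v1)) -(fineK (JF m2 v2)) -!EFinD !lee_fin in H1 H2 *.
by rewrite ler_norml; apply/andP; split; lra.
Qed.

Lemma cvg_powRV (alpha : R) (k : nat -> nat) : 0 < alpha ->
  k n @[n --> \oo] --> \oo -> ((k n)%:R `^ alpha)^-1 @[n --> \oo] --> (0 : R).
Proof.
move=> a0 koo; apply/cvgr0Pnorm_le => e e0.
have H : \forall N \near \oo, `|(N%:R `^ alpha)^-1| <= e.
  near=> N; rewrite ger0_norm ?invr_ge0 ?powR_ge0// invf_ple ?posrE//; last first.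
    by rewrite powR_gt0// ltr0n; near: N; exists 1%N.
  have : (e^-1 `^ alpha^-1) `^ alpha <= N%:R `^ alpha.
    rewrite ge0_ler_powR ?nnegrE ?powR_ge0 ?ler0n ?(ltW a0)//.
    by near: N; exact: nbhs_infty_ger.
  by rewrite -powRrM mulVf ?gt_eqF// powRr1// invr_ge0 ltW.
exact: koo H.
Unshelve. all: end_near. Qed.

Lemma cvg_dist_squeeze (a b : nat -> R) (l : R) :
  (\forall n \near \oo, `|a n - l| <= b n) ->
  b n @[n --> \oo] --> (0 : R) -> a n @[n --> \oo] --> l.
Proof.
move=> ab b0; apply/cvgrPdist_le => e e0; near=> n.
have /le_trans : `|a n - l| <= b n by near: n.
rewrite distrC; apply; rewrite (le_trans (ler_norm _))//; near: n.
by move/cvgr0Pnorm_le : b0; apply.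
Unshelve. all: end_near. Qed.

Lemma integral_law_bounded d (T : measurableType d) (P : probability T R)
    (M : T -> R) (m v B : R) (h : R -> R) : measurable_fun setT M ->
  (forall A, measurable A -> P (M @^-1` A) = gaussian m v A) ->
  measurable_fun setT h -> (forall x, `|h x| <= B) ->
  (\int[P]_w (h (M w))%:E = \int[gaussian m v]_x (h x)%:E)%E.
Proof.
move=> mM law mh hB.
have mhM : measurable_fun setT (fun w => h (M w)) by exact: measurableT_comp.
have [f1 E1] := integralDcst P mhM (fun w => hB (M w)).
have [f2 E2] := integralDcst (gaussian m v) mh hB.
have mhB : measurable_fun setT (fun x : R => (h x + B)%:E).
  by apply/measurable_EFinP; exact: measurable_funD.
have hB0 (x : R) : (0 <= (h x + B)%:E)%E.
  by rewrite lee_fin; have := hB x; rewrite ler_norml => /andP[h1 _]; lra.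
have E := integral_law mM law mhB hB0.
have {E1 E2 E} := eq_trans (esym E1) (eq_trans E E2).
move: f1 f2; move: (integral P _ _) (integral (gaussian m v) _ _).
by move=> [x||] [y||]// _ _ [] /addIr ->.
Qed.

Lemma cvg_gaussian_variance (r : nat -> R) (h : R -> R) :
  r n @[n --> \oo] --> (1 : R) -> continuous h -> bounded_fun h ->
  (\int[gaussian 0 (r n)]_x (h x)%:E @[n --> \oo] --> \int[gaussian 0 1]_x (h x)%:E)%E.
Proof.
move=> r1 ch [B0 [_ HB]].
have [B B1 hB] : exists2 B : R, 0 < B & forall x, `|h x| <= B.
  exists (`|B0 + 1| + 1); first by rewrite ltr_wpDl.
  move=> x; apply: le_trans (HB (B0 + 1) _ x I) _; first by rewrite ltrDl.
  by rewrite (le_trans (ler_norm _))// lerDl.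
have mh : measurable_fun setT h by exact: continuous_measurable_fun.
have [fin1 _] := integralDcst (gaussian 0 1) mh hB.
apply: (sube_cvg0 _ _).1 => //; apply/cvg_abse0P.
apply: (cvg0_lambda (E := fun n => (2 * B) ^+ 2 * (r n - 1) ^+ 2)).
- by move=> n; exact: abse_ge0.
- near=> n => lambda l0.
  have r0 : 0 < r n.
    by near: n; apply: (cvgr_gt _ r1); exact: ltr01.
  (* Using [lambda * (2 * B)] in [gbound] cancels the factor [2 * B] in the term [2 / lambda] and
     moves its square to the quadratic term. *)
  have lB0 : 0 < lambda * (2 * B) by rewrite !mulr_gt0.
  apply: le_trans (gaussian_bounded_le 0 0 lB0 r0 ltr01 (ltW B1) mh hB) _.
  rewrite lee_fin /gbound subrr expr0n mul0r addr0 divr1.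
  by rewrite le_eqVlt; apply/orP; left; apply/eqP; field; rewrite !gt_eqF.
- rewrite -(mulr0 ((2 * B) ^+ 2)); apply: cvgMl_tmp.
  have d0 : r n - 1 @[n --> \oo] --> (0 : R) by apply/subr_cvg0.
  rewrite -(mulr0 (0 : R)).
  rewrite (_ : (fun n => _) = fun n => (r n - 1) * (r n - 1)); first exact: cvgM.
  by apply/funext => n; rewrite expr2.
Unshelve. all: end_near. Qed.

End final_lemmas.

Theorem proposition5 (R : realType)
  (sigma : R) (sigma_gt0 : 0 < sigma)
  (f g : R -> R)
  (f_bounded : [bounded f x | x in (`[0, 1]%classic : set R)])
  (g_L2 : L2_01 g)
  (d : nat -> measure_display) (T : forall n, measurableType (d n))
  (P : forall n, probability (T n) R)
  (eps : forall n, 'I_n -> {RV (P n) >-> R})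
  (eps_law : forall n, (0 < n)%N -> forall (i : 'I_n) (A : set R),
     measurable A -> distribution (P n) (eps n i) A = gaussian 0 (sigma ^+ 2) A)
  (eps_indep : forall n, (0 < n)%N ->
     mutually_independent (P n) (fun i => eps n i : T n -> R))
  (k : nat -> nat)
  (k_range : forall n, (0 < n)%N ->
     (1 <= k n <= if odd n then n else n.-1)%N)
  (k_infty : k n @[n --> \oo] --> \oo)
  (gamma : nat -> R)
  (gamma_gt0 : forall n, (0 < n)%N -> 0 < gamma n)
  (gamma_rate : (fun n => (Num.sqrt n%:R)^-1%R : R^o) =o_\oo (gamma : nat -> R^o)) :
  let Y n (w : T n) := observation f (fun i => eps n i w) in
  let W n := posterior (prior n (k n) (gamma n)) sigma in
  let GYphi n (w : T n) := projected_functional g (k n) (Y n w) in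
  let GFphi n := projected_functional g (k n) (samples f n) in
  let GSG n := variance_factor g n (k n) in
  let I_g2 := int01 (fun x => g x ^+ 2) in
  ((\int[P n]_w tv_dist
       (pushforward (W n (Y n w)) (linear_functional g (n := n)))
       (gaussian (GYphi n w) (sigma ^+ 2 * GSG n))
     @[n --> \oo] --> 0)%E
   /\
   (forall n, (0 < n)%N -> forall A : set R, measurable A ->
     P n (GYphi n @^-1` A) = gaussian (GFphi n) (sigma ^+ 2 * GSG n) A))
  /\
  (forall alpha L : R, 0 < L -> 2^-1 < alpha ->
     sobolev alpha L f -> sobolev alpha L g -> 0 < I_g2 ->
     [/\ GSG n / (n%:R^-1 * I_g2) @[n --> \oo] --> (1 : R),
         (\int[P n]_w tv_dist
            (pushforward (W n (Y n w))
              (fun F => Num.sqrt n%:R * (linear_functional g F - GYphi n w)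
                        / (sigma * Num.sqrt I_g2))%R)
            (gaussian 0 1)
          @[n --> \oo] --> 0)%E
       & cvg_in_distribution P
           (fun n w => Num.sqrt n%:R * (GYphi n w - GFphi n)
                       / (sigma * Num.sqrt I_g2))
           (gaussian 0 1)])
  /\
  (forall alpha L : R, 0 < L -> 2^-1 < alpha ->
     sobolev alpha L f -> sobolev alpha L g -> 0 < I_g2 ->
     (fun n => n%:R : R^o) =o_\oo (fun n => (k n)%:R `^ (2 * alpha) : R^o) ->
     (fun n => Num.sqrt n%:R * (GFphi n - int01 (fun x => f x * g x))
               / (sigma * Num.sqrt I_g2) : R^o) =o_\oo (fun=> 1 : R^o)).
Proof.
move=> Y W GYphi GFphi GSG I_g2.
have kn n : (0 < n)%N -> (k n <= if odd n then n else n.-1)%N.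
  by move=> /k_range/andP[].
have k1 n : (0 < n)%N -> (0 < k n)%N by move=> /k_range/andP[].
have s20 : 0 < sigma ^+ 2 by rewrite exprn_gt0.
have [M [M0 fM]] : exists M : R, 0 <= M /\ forall x, x \in `[0, 1] -> `|f x| <= M.
  have [M0 [_ HM]] := f_bounded; exists `|M0 + 1|; split => // x x01.
  apply: le_trans (HM (M0 + 1) _ x _) (ler_norm _) => //.
  by rewrite ltrDl.
have GSG0 n : (0 < n)%N -> 0 <= GSG n by move=> n0; apply: variance_factor_ge0; [|exact: kn].
have GF2 n : (0 < n)%N -> GFphi n ^+ 2 <= n%:R * GSG n * M ^+ 2.
  by move=> n0; apply: projected_functional_samples_le => //; exact: kn.
pose c n := shrinkage n sigma (gamma n).
have c0 n : (0 < n)%N -> 0 < c n.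
  by move=> n0; apply: shrinkage_gt0 => //; exact: gamma_gt0.
have YE n w : GYphi n w = GFphi n + \sum_(i < n) (weights g n *m hat_mx n (k n)) 0 i * eps n i w.
  exact: projected_functional_observation.
have mGY n : measurable_fun setT (GYphi n).
  rewrite (_ : GYphi n = fun w => GFphi n + \sum_(i < n) (weights g n *m hat_mx n (k n)) 0 i * eps n i w).
    apply: measurable_funD => //; apply: measurable_sum => i.
    by apply: measurable_funM => //; exact: measurable_funPT.
  by apply/funext => w; exact: YE.
have law n : (0 < n)%N -> forall A : set R, measurable A ->
    P n (GYphi n @^-1` A) = gaussian (GFphi n) (sigma ^+ 2 * GSG n) A.
  move=> n0 A mA.
  have := law_linear_gaussian s20 (eps_law n n0) (eps_indep n n0) (GFphi n)
    (fun i => (weights g n *m hat_mx n (k n)) 0 i) mA.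
  rewrite -(variance_factor_sqr n0 (kn n n0) g) => <-.
  by congr (P n _); apply/seteqP; split => w /=; rewrite YE.
have postE n w A : (0 < n)%N -> measurable A ->
    W n (Y n w) (linear_functional g (n := n) @^-1` A) =
    gaussian (c n * GYphi n w) (c n * (sigma ^+ 2 * GSG n)) A.
  move=> n0 mA.
  exact: (posterior_linear_functional n0 (kn n n0) g (Y n w) sigma_gt0 (gamma_gt0 n n0) mA).
pose delta n := (Num.sqrt n%:R)^-1 / gamma n.
have delta0 : delta n @[n --> \oo] --> (0 : R).
  apply/cvgr0Pnorm_le => e e0.
  have H : \forall n \near \oo, `|(Num.sqrt n%:R)^-1 : R^o| <= e * `|gamma n : R^o|.
    by move/eqoP : gamma_rate; apply.
  near=> n; have n0 : (0 < n)%N by near: n; exists 1%N.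
  have g0 := gamma_gt0 n n0.
  rewrite /delta normrM [`|(gamma n)^-1|]normfV ler_pdivrMr ?normr_gt0 ?gt_eqF//.
  by near: n.
(* In the last factor, [2 M^2 / sigma^2] comes from the mean of [GY_phi], and [17 = 1 + 16] adds the
   relative error of the variances to the constant of the second moment bound. *)
pose D n := sigma ^+ 4 * delta n ^+ 2 * (2 * M ^+ 2 / sigma ^+ 2 + 17).
have D0 : D n @[n --> \oo] --> (0 : R).
  rewrite -(mul0r (2 * M ^+ 2 / sigma ^+ 2 + 17)); apply: cvgMr_tmp.
  rewrite -(mulr0 (sigma ^+ 4)); apply: cvgMl_tmp.
  rewrite -(mulr0 (0 : R)); rewrite (_ : (fun n => _) = fun n => delta n * delta n).
    exact: cvgM.
  by apply/funext => n; rewrite expr2.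
have cbound n : (0 < n)%N ->
    (1 - c n) ^+ 2 * (2 * n%:R * M ^+ 2 / sigma ^+ 2 + 17) <= D n.
  move=> n0; have B := shrinkage_bound n0 sigma_gt0 (gamma_gt0 n n0).
  rewrite -/(delta n) -/(c n) in B.
  have n1 : 1 <= n%:R :> R by rewrite ler1n.
  rewrite /D; apply: (@le_trans _ _ (n%:R * (1 - c n) ^+ 2 * (2 * M ^+ 2 / sigma ^+ 2 + 17))).
    rewrite [n%:R * _]mulrC -[leRHS]mulrA ler_wpM2l ?sqr_ge0//.
    have -> : n%:R * (2 * M ^+ 2 / sigma ^+ 2 + 17) =
      2 * n%:R * M ^+ 2 / sigma ^+ 2 + n%:R * 17 by ring.
    by rewrite lerD2l ler_peMl.
  by rewrite ler_wpM2r// addr_ge0// divr_ge0 ?(ltW s20)// mulr_ge0// sqr_ge0.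
have tv_ge0 n (F : T n -> set R -> \bar R) (Q : T n -> set R -> \bar R) :
    (0 <= \int[P n]_w tv_dist (F w) (Q w))%E.
  by apply: integral_ge0 => w _; exact: tv_dist_ge0.
split.
  split; last exact: law.
  apply: (cvg0_lambda (E := D)) => //.
  near=> n => lambda l0.
  have n0 : (0 < n)%N by near: n; exists 1%N.
  have D0' : 0 <= D n.
    by apply: le_trans (cbound n n0); rewrite mulr_ge0 ?sqr_ge0// addr_ge0// divr_ge0 ?(ltW s20)// !mulr_ge0// ?sqr_ge0.
  (* In the degenerate case the posterior and its approximation are both the Dirac mass at 0, and
     their distance is 0. *)
  have [v00|vn0] := eqVneq (GSG n) 0.
    rewrite integral0_eq => [|w _].
      rewrite lee_fin; apply: addr_ge0; apply: mulr_ge0 => //; first exact: ltW.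
      by rewrite invr_ge0 ltW.
    apply: tv_dist_eq0 => A mA.
    have GY0 : GYphi n w = 0 by exact: projected_functional_degenerate n0 (kn n n0) v00.
    split; last exact: gaussian_fin_num.
    apply: (eq_trans (postE n w A n0 mA)).
    by rewrite GY0 v00 !mulr0.
  have vp : 0 < GSG n by rewrite lt_neqAle eq_sym vn0 GSG0.
  have v0 : 0 < sigma ^+ 2 * GSG n by rewrite mulr_gt0.
  apply: le_trans (tv_expectation_le (Q := fun w => pushforward (W n (Y n w)) (linear_functional g (n := n)))
      (m1 := fun w => c n * GYphi n w) (v1 := c n * (sigma ^+ 2 * GSG n))
      (kappa := (1 - c n) ^+ 2) l0 (ltW v0) _ v0 (sqr_ge0 _) (mGY n) (law n n0) _ _) _.
  - by rewrite mulr_gt0// c0.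
  - by move=> w A mA; exact: postE.
  - by move=> w; ring.
  rewrite lee_fin lerD2r ler_wpM2l ?(ltW l0)//.
  apply: le_trans (cbound n n0).
  have -> : ((c n * (sigma ^+ 2 * GSG n) - sigma ^+ 2 * GSG n) / (sigma ^+ 2 * GSG n)) ^+ 2 =
     (1 - c n) ^+ 2 by field; rewrite !gt_eqF.
  rewrite -mulrA -[X in X + _]mulr1 -mulrDr ler_wpM2l ?sqr_ge0//.
  have -> : (2 * GFphi n ^+ 2 + 16 * (sigma ^+ 2 * GSG n)) / (sigma ^+ 2 * GSG n) =
     2 * (GFphi n ^+ 2 / (sigma ^+ 2 * GSG n)) + 16 by field; rewrite !gt_eqF.
  have : GFphi n ^+ 2 / (sigma ^+ 2 * GSG n) <= n%:R * M ^+ 2 / sigma ^+ 2.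
    rewrite ler_pdivrMr//; apply: le_trans (GF2 n n0) _.
    by rewrite le_eqVlt; apply/orP; left; apply/eqP; field; rewrite gt_eqF.
  lra.
have sig0 : sigma != 0 by rewrite gt_eqF.
split=> alpha L L0 ha sf sg I0.
  have a0 : 0 < alpha by rewrite (lt_trans _ ha)// invr_gt0.
  have [Q [eta Hg]] := sobolev_coefP ha sg.
  have mg : measurable_fun (`[0, 1]%classic : set R) g := g_L2.1.
  have [C [C0 HC]] := gcoef_bias ha mg mg Hg Hg.
  have I0' : I_g2 != 0 by rewrite gt_eqF.
  pose r n := n%:R * GSG n / I_g2.
  have nGSG : n%:R * GSG n @[n --> \oo] --> I_g2.
    apply: (cvg_dist_squeeze (b := fun n => C * ((k n)%:R `^ alpha)^-1)).
      near=> n; have n0 : (0 < n)%N by near: n; exists 1%N.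
      rewrite /GSG variance_factor_gcoef// ?kn//.
      have := HC n (k n); rewrite kn// k1// => /(_ isT).
      rewrite (_ : int01 (fun x => g x * g x) = I_g2); last first.
        by congr int01; apply/funext => x; rewrite expr2.
      by under eq_bigr do rewrite -expr2.
    by rewrite -(mulr0 C); apply: cvgMl_tmp; exact: cvg_powRV.
  have r1 : r n @[n --> \oo] --> (1 : R).
    by rewrite -(divff I0'); apply: cvgMr_tmp.
  (* The standardizing factor: it turns the variance [sigma^2 G Sigma G^T] into [r n], which tends
     to 1. *)
  pose u n := Num.sqrt n%:R / (sigma * Num.sqrt I_g2).
  have u2 n : u n ^+ 2 * (sigma ^+ 2 * GSG n) = r n.
    rewrite /u /r exprMn exprVn exprMn !sqr_sqrtr ?ler0n ?(ltW I0)//.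
    by field; rewrite I0' sig0.
  have u2n n : u n ^+ 2 = n%:R / (sigma ^+ 2 * I_g2).
    by rewrite /u exprMn exprVn exprMn !sqr_sqrtr ?ler0n ?(ltW I0).
  split.
  - rewrite (_ : (fun n => _) = r)//; apply/funext => n.
    by rewrite /r invfM invrK; ring.
  (* The standardized posterior has variance [c r] and is compared with variance 1. The first two
     terms bound [(c r - 1)^2], separating the error of [r] from the shrinkage; the last one bounds
     the expected squared mean. *)
  - apply: (cvg0_lambda (E := fun n => 2 * (r n - 1) ^+ 2 + 2 * (r n ^+ 2 * D n) + r n * D n)) => //.
      near=> n => lambda l0.
      have n0 : (0 < n)%N by near: n; exists 1%N.
      have r0 : 0 < r n by near: n; apply: (cvgr_gt _ r1); exact: ltr01.
      have v0 : 0 <= sigma ^+ 2 * GSG n by rewrite mulr_ge0 ?(ltW s20)// GSG0.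
      have cr0 : 0 < c n * r n by rewrite mulr_gt0// c0.
      have kap0 : 0 <= u n ^+ 2 * (1 - c n) ^+ 2 by rewrite mulr_ge0 ?sqr_ge0.
      pose lawu w := pushforward (W n (Y n w)) (fun F => Num.sqrt n%:R *
        (linear_functional g F - GYphi n w) / (sigma * Num.sqrt I_g2)).
      have lawuE w A : measurable A -> lawu w A = gaussian (u n * (c n - 1) * GYphi n w) (c n * r n) A.
        move=> mA.
        have mpre : measurable ((fun x : R => - (u n * GYphi n w) + u n * x) @^-1` A).
          have maff : measurable_fun setT (fun x : R => - (u n * GYphi n w) + u n * x).
            by apply: measurable_funD => //; exact: measurable_funM.
          by rewrite -[X in measurable X]setTI; exact: maff.
        have E1 := postE n w _ n0 mpre.
        have cv0 : 0 <= c n * (sigma ^+ 2 * GSG n) by rewrite mulr_ge0// ltW// c0.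
        have E2 := gaussian_preimage_affine (c n * GYphi n w) (- (u n * GYphi n w)) (u n) cv0 mA.
        have e1 : u n * (c n - 1) * GYphi n w = - (u n * GYphi n w) + u n * (c n * GYphi n w) by ring.
        have e2 : c n * r n = u n ^+ 2 * (c n * (sigma ^+ 2 * GSG n)) by rewrite -u2; ring.
        rewrite e1 e2; apply: (eq_trans _ (eq_trans E1 E2)).
        rewrite /lawu /pushforward; congr (W n (Y n w) _).
        by apply/seteqP; split => F /=; rewrite (_ : _ / _ = - (u n * GYphi n w) +
          u n * linear_functional g F)//; rewrite /u; ring.
      have meanE w : (u n * (c n - 1) * GYphi n w - 0) ^+ 2 =
          u n ^+ 2 * (1 - c n) ^+ 2 * GYphi n w ^+ 2 by ring.
      apply: (le_trans (tv_expectation_le (m2 := fun=> 0) l0 v0 cr0 ltr01 kap0 (mGY n) (law n n0) lawuE meanE)).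
      rewrite lee_fin lerD2r ler_wpM2l ?(ltW l0)// !divr1.
      have cD : (1 - c n) ^+ 2 <= D n.
        apply: le_trans (cbound n n0); rewrite ler_peMr ?sqr_ge0//.
        have : 0 <= 2 * n%:R * M ^+ 2 / sigma ^+ 2.
          by rewrite divr_ge0 ?(ltW s20)// !mulr_ge0// sqr_ge0.
        lra.
      apply: lerD.
        apply: (@le_trans _ _ (2 * (r n - 1) ^+ 2 + 2 * (r n ^+ 2 * (1 - c n) ^+ 2))).
          rewrite -subr_ge0 (_ : _ - _ = (r n - 1 + r n * (1 - c n)) ^+ 2) ?sqr_ge0//; ring.
        by rewrite lerD2l ler_wpM2l// ler_wpM2l ?sqr_ge0.
      apply: (@le_trans _ _ (r n * ((1 - c n) ^+ 2 * (2 * n%:R * M ^+ 2 / sigma ^+ 2 + 17)))); last first.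
        by rewrite ler_wpM2l ?(ltW r0)// cbound.
      have uGF : u n ^+ 2 * GFphi n ^+ 2 <= r n * (n%:R * M ^+ 2 / sigma ^+ 2).
        apply: (@le_trans _ _ (u n ^+ 2 * (n%:R * GSG n * M ^+ 2))).
          by rewrite ler_wpM2l ?sqr_ge0// GF2.
        by rewrite le_eqVlt; apply/orP; left; apply/eqP; rewrite -u2; field.
      have c20 := sqr_ge0 (1 - c n).
      have -> : u n ^+ 2 * (1 - c n) ^+ 2 * (2 * GFphi n ^+ 2 + 16 * (sigma ^+ 2 * GSG n)) =
         (1 - c n) ^+ 2 * (2 * (u n ^+ 2 * GFphi n ^+ 2) + 16 * r n) by rewrite -u2; ring.
      rewrite [leRHS]mulrCA ler_wpM2l//.
      have -> : r n * (2 * n%:R * M ^+ 2 / sigma ^+ 2 + 17) =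
        2 * (r n * (n%:R * M ^+ 2 / sigma ^+ 2)) + 17 * r n by field.
      lra.
    have d0 : r n - 1 @[n --> \oo] --> (0 : R) by apply/subr_cvg0.
    have d2 : 2 * (r n - 1) ^+ 2 @[n --> \oo] --> (2 * (0 * 0) : R).
      by under eq_fun do rewrite expr2; apply: cvgMl_tmp; exact: cvgM.
    have d3 : 2 * (r n ^+ 2 * D n) @[n --> \oo] --> (2 * (1 * 1 * 0) : R).
      by under eq_fun do rewrite expr2; apply: cvgMl_tmp; apply: cvgM => //; exact: cvgM.
    have d4 : r n * D n @[n --> \oo] --> (1 * 0 : R) by exact: cvgM.
    have d5 := cvgD (cvgD d2 d3) d4.
    have e0 : 2 * (0 * 0) + 2 * (1 * 1 * 0) + 1 * 0 = 0 :> R by ring.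
    by rewrite e0 in d5; exact: d5.
  (* For every [n > 0] the standardized estimator is exactly [N(0, r n)], so only the variance has
     to converge. *)
  - move=> h ch bh.
    have lim := cvg_gaussian_variance r1 ch bh.
    apply: cvg_trans lim; apply: near_eq_cvg; near=> n.
    have n0 : (0 < n)%N by near: n; exists 1%N.
    have [B0 [_ HB]] := bh.
    have hB x : `|h x| <= B0 + 1 by apply: HB => //; rewrite ltrDl.
    have mX : measurable_fun setT (fun w => Num.sqrt n%:R * (GYphi n w - GFphi n) / (sigma * Num.sqrt I_g2)).
      by apply: measurable_funM => //; apply: measurable_funM => //; exact: measurable_funB.
    have lawX A : measurable A ->
       P n ((fun w => Num.sqrt n%:R * (GYphi n w - GFphi n) / (sigma * Num.sqrt I_g2)) @^-1` A) =
       gaussian 0 (r n) A.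
      move=> mA.
      have mpre : measurable ((fun x : R => - (u n * GFphi n) + u n * x) @^-1` A).
        have maff : measurable_fun setT (fun x : R => - (u n * GFphi n) + u n * x).
          by apply: measurable_funD => //; exact: measurable_funM.
        by rewrite -[X in measurable X]setTI; exact: maff.
      have v0 : 0 <= sigma ^+ 2 * GSG n by rewrite mulr_ge0 ?(ltW s20)// GSG0.
      have E2 := gaussian_preimage_affine (GFphi n) (- (u n * GFphi n)) (u n) v0 mA.
      rewrite addNr u2 in E2.
      apply: (eq_trans _ (eq_trans (law n n0 _ mpre) E2)).
      congr (P n _); apply/seteqP; split => w /=;
        rewrite (_ : _ / _ = - (u n * GFphi n) + u n * GYphi n w)//; rewrite /u; ring.
    exact/esym/(integral_law_bounded mX lawX (continuous_measurable_fun ch) hB).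
move=> nk.
have a0 : 0 < alpha by rewrite (lt_trans _ ha)// invr_gt0.
have [Q [eta Hg]] := sobolev_coefP ha sg.
have [Q' [theta Hf]] := sobolev_coefP ha sf.
have mg : measurable_fun (`[0, 1]%classic : set R) g := g_L2.1.
have mf : measurable_fun (`[0, 1]%classic : set R) f := sf.1.1.
have [C [C0 HC]] := gcoef_bias ha mf mg Hf Hg.
pose s := sigma * Num.sqrt I_g2.
have s0 : 0 < s by rewrite mulr_gt0// sqrtr_gt0.
apply/eqoP => e e0.
(* Chosen so that [sqrt n <= (e s / (C + 1)) K], which multiplied by the bias bound [C / K] gives at
   most [e s]. The denominator [C + 1] allows [C = 0]. *)
pose e' := (e * s / (C + 1)) ^+ 2.
have C1 : 0 < C + 1 by rewrite ltr_wpDl.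
have e'0 : 0 < e' by rewrite exprn_gt0// divr_gt0// mulr_gt0.
have H : \forall n \near \oo, `|n%:R : R^o| <= e' * `|((k n)%:R `^ (2 * alpha) : R^o)|.
  by move/eqoP : nk; apply.
near=> n; have n0 : (0 < n)%N by near: n; exists 1%N.
have : `|n%:R : R| <= e' * `|(k n)%:R `^ (2 * alpha)| by near: n.
rewrite (ger0_norm (ler0n _ _)) (ger0_norm (powR_ge0 _ _)) => Hn.
rewrite normr1 mulr1 !normrM normfV -/s (gtr0_norm s0) (ger0_norm (sqrtr_ge0 _)).
set K := (k n)%:R `^ alpha.
have K0 : 0 < K by rewrite powR_gt0// ltr0n k1.
have sn : Num.sqrt n%:R <= e * s / (C + 1) * K.
  have p0 : 0 <= e * s / (C + 1) * K by rewrite mulr_ge0 ?(ltW K0)// divr_ge0 ?(ltW C1)// mulr_ge0 ?(ltW e0) ?(ltW s0).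
  rewrite -[leRHS]ger0_norm// -sqrtr_sqr ler_wsqrtr//.
  have K2 : (k n)%:R `^ (2 * alpha) = K ^+ 2.
    by rewrite /K -powR_mulrn ?powR_ge0// -powRrM mulrC.
  by rewrite exprMn -K2.
rewrite ler_pdivrMr//.
have bias : `|GFphi n - int01 (fun x => f x * g x)| <= C / K.
  have := HC n (k n); rewrite kn// k1// => /(_ isT).
  by rewrite /GFphi projected_functional_samples// kn.
apply: le_trans (ler_pM (sqrtr_ge0 _) (normr_ge0 _) sn bias) _.
have -> : e * s / (C + 1) * K * (C / K) = e * s * (C / (C + 1)) by field; rewrite !gt_eqF.
rewrite ler_piMr ?(ltW (mulr_gt0 e0 s0))//.
by rewrite ler_pdivrMr// mul1r lerDl.
Unshelve. all: end_near. Qed.
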